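(* Let $\mathcal{P}\subset\mathbb{R}^d$ be a bounded domain with piecewise smooth boundary and $\Pi_M=\{\mathbf{t}\in\mathbb{N}^d:\mathbf{t}/M\in\mathcal{P}\}$. Let $\lambda_1(\mathbf{t})=\sigma_0+\sum_{j=1}^d\sigma_j\mathbf{t}_j$ be a non-constant inhomogeneous linear form, and let $\xi^M_{\mathbf{t}},\nu^M_{\mathbf{t}},\xi^M_{\mathbf{t},p},\eta^M_{\mathbf{t},p}$ ($\mathbf{t}\in\Pi_M$) and the partitions $F_{\mathbf{t}}$ of $(\Omega,\mathbb{P})$ be as described in the context. Suppose there are $\mathbf{c}>0$, $R>0$ independent of $M$, and a set $E\subset\Omega$ (depending on $M$) with $\mathbb{P}(E^c)=\mathcal{O}(M^{-100d})$, such that: (h1) for any $\mathbf{t}\in\Pi_M$, $\mathbb{E}(\xi_{\mathbf{t}})=\mathcal{O}(M^{-d})$; (h2) for any $\mathbf{t}\in\Pi_M$, $\mathbb{P}(\xi_{\mathbf{t}}>1)=\mathcal{O}(M^{-2d})$; (h3) for $\mathbf{t}\neq\mathbf{t}'$ in $\Pi_M$, $\mathbb{P}(\xi_{\mathbf{t}}\ge1,\ \xi_{\mathbf{t}'}\ge1)=\mathcal{O}(M^{-2d})$; (h4) for $\mathbf{t},\mathbf{t}'\in\Pi_M$ with $\lambda_1(\mathbf{t})\ge\lambda_1(\mathbf{t}')+R\ln M$, any $p\in\{1,\dots,P\}$ and any $\omega\in E$: (a) $\mathbb{E}(\xi_{\mathbf{t}}|\mathcal{F}_{\mathbf{t}'})(\omega)=\frac{\mathbf{c}\,\mathfrak{m}(\mathfrak{X})}{M^d}+\mathcal{O}(M^{-2d})$,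 (b) $\mathbb{E}(\xi_{\mathbf{t},p}|\mathcal{F}_{\mathbf{t}'})(\omega)=\frac{\mathbf{c}\,\mathfrak{m}(K_p)}{M^d}+\mathcal{O}(M^{-2d})$, (c) $\mathbb{E}(\eta_{\mathbf{t},p}|\mathcal{F}_{\mathbf{t}'})(\omega)=\frac{\mathbf{c}\,\mathfrak{m}(K_p)}{M^d}+\mathcal{O}(M^{-2d})$; (h5) for $\mathbf{t},\bar{\mathbf{t}}\in\Pi_M$ with $\lambda_1(\bar{\mathbf{t}})>\lambda_1(\mathbf{t})+R\ln M$, any $p\in\{1,\dots,P\}$ and any $\omega\in E$, $\xi_{\mathbf{t},p}$ is constant on $F_{\bar{\mathbf{t}}}(\omega)$; (h6) for $\mathbf{t},\bar{\mathbf{t}}\in\Pi_M$ with $\lambda_1(\bar{\mathbf{t}})>\lambda_1(\mathbf{t})+R\ln M$ and any $\omega\in E$, $F_{\bar{\mathbf{t}}}(\omega)\subset F_{\mathbf{t}}(\omega)$. Then the sequence of point processes $$\left\{\Big(\nu^M_{\mathbf{t}},\frac{\mathbf{t}}{M}\Big)\right\}_{\mathbf{t}\in\Pi_M,\ \xi^M_{\mathbf{t}}=1}$$ converges as $M\to\infty$ to a Poisson process with intensity $\mathbf{c}$ on $(\mathfrak{X}\times\mathcal{P},\ \mathfrak{m}\times\mathrm{Leb})$.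
   Context: $(\Omega,\mathbb{P})$ is a probability space with expectation $\mathbb{E}$. $(\mathfrak{X},\mathfrak{m})$ is a probability space with a countable collection $\mathcal{Q}$ of finite partitions of $\mathfrak{X}$ converging to the point partition. For each $M\in\mathbb{N}$ there are random variables $\{\xi^M_{\mathbf{t}}\}_{\mathbf{t}\in\Pi_M}$ on $\Omega$ with values in the non-negative integers and $\mathfrak{X}$-valued random variables $\{\nu^M_{\mathbf{t}}\}_{\mathbf{t}\in\Pi_M}$ on $\Omega$. For each fixed partition $Q=(K_1,\dots,K_P)\in\mathcal{Q}$ one has a decomposition $\xi^M_{\mathbf{t}}=\sum_{p=1}^P\xi^M_{\mathbf{t},p}$ with $\xi^M_{\mathbf{t},p}$ non-negative integer valued, such that on $\{\xi^M_{\mathbf{t}}=1\}$ one has $\xi^M_{\mathbf{t},p}=\mathbf{1}_{\nu^M_{\mathbf{t}}\in K_p}$. Put $\eta^M_{\mathbf{t}}=\mathbf{1}_{\xi^M_{\mathbf{t}}=1}$ and $\eta^M_{\mathbf{t},p}=\mathbf{1}_{\xi^M_{\mathbf{t},p}=\xi^M_{\mathbf{t}}=1}$. The superscript $M$ is often dropped. For every $M$ a family of partitions $F_{\mathbf{t}}$ ($\mathbf{t}\in\Pi_M$) of $(\Omega,\mathbb{P})$ is given; $F_{\mathbf{t}}(\omega)$ is the element of $F_{\mathbf{t}}$ containing $\omega$ and $\mathcal{F}_{\mathbf{t}}$ is the $\sigma$-algebra generated by $F_{\mathbf{t}}$. The hypotheses are assumed for each $Q\in\mathcal{Q}$; constants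 in $\mathcal{O}$ may depend on $Q$ but not on $M$, $\mathbf{t}$, $\mathbf{t}'$, $\omega$. Convergence to a Poisson process means that for every $Q=(K_1,\dots,K_P)\in\mathcal{Q}$ and every division of $\mathcal{P}$ into finitely many pieces $\mathcal{P}_1,\dots,\mathcal{P}_S$ of positive volume (with piecewise smooth boundary), the numbers of points in $K_p\times\mathcal{P}_s$ converge jointly in distribution to independent Poisson variables with parameters $\mathbf{c}\,\mathfrak{m}(K_p)\mathrm{Leb}(\mathcal{P}_s)$.
   Formalization: The domain P is assumed to lie in the closed positive orthant, and the partitions F_t are measurable partitions in Rokhlin's sense (with conditional measures), with sigma-algebra the measurable unions of their elements; for countable partitions this is the literal generated one. *)

(* Defs.v *)
From HB Require Import structures.
From mathcomp Require Import all_boot all_order all_algebra finmap.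
From mathcomp Require Import all_classical all_reals all_analysis.
From mathcomp Require Import measurable_realfun.

Set Implicit Arguments.
Unset Strict Implicit.
Unset Printing Implicit Defensive.
Import Order.TTheory GRing.Theory Num.Theory.
Import numFieldNormedType.Exports.
Local Open Scope classical_set_scope.
Local Open Scope ring_scope.

(* Lebesgue outer measure of R^d, by countable covers with half-open boxes.
   It coincides with Lebesgue measure on measurable sets, in particular on sets
   with piecewise smooth boundary. *)
Definition leb (R : realType) (d : nat) (A : set 'rV[R]_d) : \bar R :=
  ereal_inf [set x | exists a b : nat -> 'rV[R]_d,
    [/\ forall k j, a k 0 j <= b k 0 j,
        A `<=` \bigcup_k [set y : 'rV[R]_d |
                            forall j, a k 0 j < y 0 j <= b k 0 j] &
        x = (\sum_(0 <= k <oo) (\prod_(j < d) (b k 0 j - a k 0 j))%:E)%E]].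

Definition C1_map (R : realType) (m n : nat) (f : 'rV[R]_m -> 'rV[R]_n) :=
  (forall x, differentiable f x) /\ continuous (jacobian f).

(* The boundary is a finite union of C^1 images of the closed unit cube of
   R^(d-1). A C^1 map on the closed cube extends to the whole space, so that
   patches are taken to be defined everywhere. No patch is required to be an
   immersion, hence edges, corners and conical points are allowed. *)
Definition piecewise_smooth_boundary (R : realType) (d : nat)
    (A : set 'rV[R]_d) :=
  exists n : nat, exists f : 'I_n -> 'rV[R]_d.-1 -> 'rV[R]_d,
    (forall i, C1_map (f i)) /\
    closure A `\` interior A =
      \bigcup_i (f i @` [set x : 'rV[R]_d.-1 | forall j, 0 <= x 0 j <= 1]).

Definition piecewise_smooth_domain (R : realType) (d : nat)
    (P : set 'rV[R]_d) :=
  [/\ open P, connected P, P !=set0, bounded_set P &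
      piecewise_smooth_boundary P].

Definition division (R : realType) (d S : nat) (P : set 'rV[R]_d)
    (D : 'I_S -> set 'rV[R]_d) :=
  [/\ trivIset setT D, \bigcup_s D s = P, forall s, (0 < leb (D s))%E &
      forall s, piecewise_smooth_boundary (D s)].

Definition idx (d : nat) := {ffun 'I_d -> nat}.

Definition scaled (R : realType) (d M : nat) (t : idx d) : 'rV[R]_d :=
  \row_j ((t j)%:R / M%:R).

Definition Pi (R : realType) (d : nat) (P : set 'rV[R]_d) (M : nat) :
  set (idx d) := [set t | P (scaled R M t)].

Definition affine_form (R : realType) (d : nat) (s0 : R) (s : 'I_d -> R)
  (t : idx d) : R := s0 + \sum_(j < d) s j * (t j)%:R.

Definition finite_partition (dX : measure_display) (X : measurableType dX)
    (n : nat) (K : 'I_n -> set X) :=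
  [/\ forall p, measurable (K p), trivIset setT K & \bigcup_p K p = setT].

(* A sequence of finite partitions converges to the point partition when every
   measurable set is approximated in measure by unions of their elements. *)
Definition cvg_to_point_partition (R : realType) (dX : measure_display)
    (X : measurableType dX) (m : probability X R) (np : nat -> nat)
    (K : forall k, 'I_(np k) -> set X) :=
  forall A, measurable A -> exists J : forall k, {set 'I_(np k)},
    m (A `+` \bigcup_(p in [set` J k]) K k p) @[k --> \oo] --> 0%E.

(* The sigma-algebra of a partition F: the measurable unions of elements of F.
   It is <<s F >> if F is countable (sigma_partE). If F is uncountable, <<s F >>
   only has the countable and co-countable unions of elements of F. *)
Definition sigma_part (d : measure_display) (T : measurableType d)
    (F : set (set T)) : set (set T) :=
  [set A | measurable A /\ forall B, F B -> B `&` A !=set0 -> B `<=` A].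

(* Y is a version of the conditional expectation of f given <<s G >>. *)
Definition is_condexp (R : realType) (d : measure_display)
    (T : measurableType d) (Pr : probability T R) (G : set (set T))
    (f Y : T -> R) :=
  [/\ measurable_fun [set: g_sigma_algebraType G]
        (Y : g_sigma_algebraType G -> R),
      Pr.-integrable setT (EFin \o Y) &
      forall A, <<s G >> A ->
        \int[Pr]_(w in A) (Y w)%:E = \int[Pr]_(w in A) (f w)%:E]%E.

Definition conditional_measures (R : realType) (d : measure_display)
    (T : measurableType d) (Pr : probability T R) (F : set (set T))
    (k : T -> probability T R) :=
  (forall A, measurable A ->
     is_condexp Pr (sigma_part F) (\1_A) (fun w => fine (k w A))) /\
  {ae Pr, forall w, k w (pblock F id w) = 1%E}.

(* Partitions of a probability space: measurable partitions in the sense of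
   Rokhlin, i.e. those with a system of conditional measures carried by their
   elements. Every countable partition into measurable sets is one
   (countable_prob_partition). *)
Definition prob_partition (R : realType) (d : measure_display)
    (T : measurableType d) (Pr : probability T R) (F : set (set T)) :=
  [/\ partition F id setT, F `<=` measurable &
      exists k, conditional_measures Pr F k].

Section countable_partitions.
Context (R : realType) (d : measure_display) (T : measurableType d).
Context (Pr : probability T R) (F : set (set T)).
Hypotheses (pF : partition F id setT) (mF : F `<=` measurable).
Hypothesis cF : countable F.

Let FT x : exists B, F B /\ B x.
Proof.
case: pF => + _ _ => cov; have : setT x by [].
by rewrite -cov => -[B FB Bx]; exists B.
Qed.

Let pbF x : F (pblock F id x) /\ pblock F id x x.
Proof. by have := getPex (FT x). Qed.

Let Funiq A B x : F A -> F B -> A x -> B x -> A = B.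
Proof. by case: pF => _ tF _ FA FB Ax Bx; apply: tF => //; exists x. Qed.

Let pbE B x : F B -> B x -> pblock F id x = B.
Proof. by move=> FB Bx; have [? ?] := pbF x; apply: Funiq Bx. Qed.

Lemma sigma_part_sigma_algebra : sigma_algebra setT (sigma_part F).
Proof.
split.
- by split=> // B _ [x []].
- move=> A [mA sA]; split; first exact: measurableD.
  move=> B FB [x [Bx [_ nAx]]] y By; split=> // Ay; apply: nAx.
  by apply: (sA B) => //; exists y.
- move=> A sA; split; first by apply: bigcup_measurable => k _; case: (sA k).
  move=> B FB [x [Bx [k _ Akx]]] y By; exists k => //.
  by case: (sA k) => _ /(_ B FB); apply => //; exists x.
Qed.

Let exG : exists G : nat -> set T,
  [/\ forall n, measurable (G n), trivIset setT G, \bigcup_n G n = setT &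
      forall n, G n = set0 \/ F (G n)].
Proof.
have /countable_injP[f finj] := cF.
exists (fun n => [set x | f (pblock F id x) = n]).
have GF n x : f (pblock F id x) = n ->
    [set x | f (pblock F id x) = n] = pblock F id x.
  move=> fx; have [FB Bx] := pbF x; apply/seteqP; split=> y /= => [fy|By].
    have [FC Cy] := pbF y.
    have -> // : pblock F id x = pblock F id y.
    by apply: finj; rewrite ?inE// fx fy.
  by rewrite (pbE FB By).
have dich n : [set x | f (pblock F id x) = n] = set0 \/
    F [set x | f (pblock F id x) = n].
  have [->|/set0P[x fx]] := eqVneq [set x | f (pblock F id x) = n] set0.
    by left.
  by right; rewrite (GF n x) //; case: (pbF x).
split=> //.
- by move=> n; have [->//|/mF] := dich n.
- by move=> i j _ _ [x [/= <- <-]].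
- by apply/seteqP; split=> // x _; exists (f (pblock F id x)).
Qed.

Lemma sigma_partE : sigma_part F = <<s F >>.
Proof.
have [G [mG tG cG dG]] := exG.
apply/seteqP; split=> A.
  move=> [mA sA].
  have -> : A = \bigcup_n (A `&` G n) by rewrite -setI_bigcupr cG setIT.
  apply: sigma_algebra_bigcup => n.
  have [->|FG] := dG n; first by rewrite setI0; exact: sigma_algebra0.
  have [->|/set0P AG] := eqVneq (A `&` G n) set0; first exact: sigma_algebra0.
  rewrite (_ : _ `&` _ = G n); first exact: sub_sigma_algebra.
  by apply/setIidPr; apply: sA => //; rewrite setIC.
apply: smallest_sub; first exact: sigma_part_sigma_algebra.
move=> B FB; split; first exact: mF.
by move=> C FC [x [Cx Bx]]; rewrite (Funiq FC FB Cx Bx).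
Qed.

Lemma countable_prob_partition : prob_partition Pr F.
Proof.
have [G [mG tG cG dG]] := exG.
have mpb w : measurable (pblock F id w) by apply: mF; case: (pbF w).
pose k w : probability T R := mnormalize (mrestr Pr (mpb w)) Pr.
have kE w A : k w A = if Pr (pblock F id w) == 0%E then Pr A else
    (Pr (A `&` pblock F id w) * (fine (Pr (pblock F id w)))^-1%:E)%E.
  rewrite /k /= /mnormalize /= /mrestr setTI.
  have -> : (Pr (pblock F id w) == +oo%E) = false.
    by apply/negbTE; rewrite -ltey -ge0_fin_numE// fin_num_measure.
  by rewrite orbF; case: ifPn.
split => //; exists k; split; last first.
  pose H n := if Pr (G n) == 0%E then G n else set0.
  suff : Pr.-negligible (\bigcup_n H n).
    apply: negligibleS => w /= kw.
    have [FB Bw] := pbF w.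
    have : setT w by [].
    rewrite -cG => -[n _ Gw].
    have GB : G n = pblock F id w.
      have [G0|FG] := dG n; first by rewrite G0 in Gw.
      exact: Funiq Gw Bw.
    exists n => //; rewrite /H; case: eqP => // P0.
    exfalso; apply: kw; rewrite kE setIid.
    rewrite -GB ifF; last by apply/eqP.
    have PG: Pr (G n) \is a fin_num by rewrite fin_num_measure.
    rewrite -[X in (X * _)%E](fineK PG) -EFinM divff//.
    by apply/eqP => P1; apply: P0; rewrite -(fineK PG) P1.
  apply: negligible_bigcup => n; rewrite /H; case: eqP => [P0|_].
    exact/negligibleP.
  exact: negligible_set0.
move=> A mA.
pose Y w := fine (k w A).
have Yc B w w' : F B -> B w -> B w' -> Y w = Y w'.
  by move=> FB Bw Bw'; rewrite /Y !kE (pbE FB Bw) (pbE FB Bw').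
have sY V : measurable V -> sigma_part F (Y @^-1` V).
  move=> mV.
  have sat B : F B -> B `&` (Y @^-1` V) !=set0 -> B `<=` Y @^-1` V.
    by move=> FB [x [Bx Vx]] y By; rewrite /preimage/= (Yc B y x).
  split => //.
  have -> : Y @^-1` V = \bigcup_n ((Y @^-1` V) `&` G n).
    by rewrite -setI_bigcupr cG setIT.
  apply: bigcup_measurable => n _.
  have [->|FG] := dG n; first by rewrite setI0.
  have [->//|/set0P AG] := eqVneq (Y @^-1` V `&` G n) set0.
  rewrite (_ : _ `&` _ = G n); first exact: mG.
  by apply/setIidPr; apply: sat => //; rewrite setIC.
have mY : measurable_fun setT Y.
  by move=> _ V mV; rewrite setTI; case: (sY V mV).
have Y01 w : 0 <= Y w <= 1.
  rewrite fine_ge0//= -lee_fin fineK ?fin_num_measure//.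
  exact: probability_le1.
split.
- move=> _ V mV; rewrite setTI; apply: sub_sigma_algebra; exact: sY.
- apply: measurable_bounded_integrable => //.
    by rewrite -ge0_fin_numE// fin_num_measure.
  exists 1; split => // M M1 w _ /=.
  by have /andP[Y0 Y1] := Y01 w; rewrite ger0_norm// (le_trans Y1)// ltW.
rewrite (sigma_algebra_id sigma_part_sigma_algebra) => D [mD sD].
have DE : D = \bigcup_n (D `&` G n) by rewrite -setI_bigcupr cG setIT.
have tD : trivIset setT (fun n => D `&` G n) by exact: trivIset_setIl.
have mDG n : measurable (D `&` G n) by exact: measurableI.
rewrite [in LHS]DE [in RHS]DE !ge0_integral_bigcup//; last first.
- by move=> w _; rewrite lee_fin; case/andP: (Y01 w).
- by apply/measurable_EFinP; apply: measurable_funTS.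
- apply/measurable_EFinP; apply: measurable_funTS; exact: measurable_indic.
apply: eq_eseriesr => n _.
have [->|/set0P DG] := eqVneq (D `&` G n) set0; first by rewrite !integral_set0.
have FG : F (G n) by have [G0|//] := dG n; move: DG; rewrite G0 setI0 => -[].
rewrite (_ : D `&` G n = G n); last first.
  by apply/setIidPr; apply: sD => //; rewrite setIC.
rewrite integral_indic//.
have [x [_ Gx]] := DG.
rewrite (eq_integral (cst (Y x)%:E)); last first.
  by move=> w; rewrite inE => Gw /=; rewrite -/(Y w) (Yc (G n) w x).
rewrite integral_cst// /Y fineK ?fin_num_measure// kE (pbE FG Gx).
case: ifPn => [/eqP P0|P0].
  have AG0 : Pr (A `&` G n) = 0%E.
    apply/eqP; rewrite -measure_le0 -P0.
    by apply: le_measure; rewrite ?inE//; exact: measurableI.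
  by rewrite [X in (_ * X)%E]P0 mule0 [RHS]AG0.
have PG: Pr (G n) \is a fin_num by rewrite fin_num_measure.
rewrite -muleA -[X in (_ * (_ * X))%E](fineK PG) -EFinM mulVf ?mule1//.
by apply: contra P0 => /eqP P1; rewrite -(fineK PG) P1.
Qed.

End countable_partitions.

Definition mutually_independent (R : realType) (d d' : measure_display)
    (T : measurableType d) (T' : measurableType d') (Pr : probability T R)
    (I : finType) (Z : I -> T -> T') :=
  forall (J : {set I}) (A : I -> set T'), (forall i, measurable (A i)) ->
    Pr (\bigcap_(i in [set` J]) (Z i @^-1` A i)) =
      (\prod_(i in J) Pr (Z i @^-1` A i))%E.

Definition cvg_in_distribution (R : realType) (d1 d2 : measure_display)
    (T1 : measurableType d1) (T2 : measurableType d2)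
    (P1 : probability T1 R) (P2 : probability T2 R) (m n : nat)
    (V : nat -> T1 -> 'M[R]_(m, n)) (W : T2 -> 'M[R]_(m, n)) :=
  forall f : 'M[R]_(m, n) -> R, continuous f -> bounded_fun f ->
    ('E_P1[f \o V M] @[M --> \oo] --> 'E_P2[f \o W])%E.

(* Joint convergence in distribution of the counts N p s to independent Poisson
   variables with parameters rate p s; the
   second argument of poisson_prob is a dummy, and the rate 0 gives the Dirac
   mass at 0. *)
Definition cvg_independent_poisson (R : realType) (d : measure_display)
    (T : measurableType d) (Pr : probability T R) (m n : nat)
    (N : nat -> T -> 'I_m -> 'I_n -> nat) (rate : 'I_m -> 'I_n -> R) :=
  exists (d' : measure_display) (T' : measurableType d')
    (Pr' : probability T' R) (Z : 'I_m * 'I_n -> {RV Pr' >-> nat}),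
  [/\ mutually_independent Pr' Z,
      forall p s A, Pr' (Z (p, s) @^-1` A) = poisson_prob (rate p s) 0%N A &
      cvg_in_distribution Pr Pr'
        (fun M w => \matrix_(p, s) (N M w p s)%:R)
        (fun w => \matrix_(p, s) (Z (p, s) w)%:R)].

Definition cvg_poisson_process (R : realType) (dT dX : measure_display)
    (T : measurableType dT) (Pr : probability T R)
    (X : measurableType dX) (m : probability X R)
    (np : nat -> nat) (K : forall k, 'I_(np k) -> set X)
    (d : nat) (P : set 'rV[R]_d) (c : R)
    (N : nat -> T -> set (X * 'rV[R]_d)) :=
  forall (k S : nat) (D : 'I_S -> set 'rV[R]_d), division P D ->
    cvg_independent_poisson Pr
      (fun M w p s => #|` fset_set (N M w `&` (K k p `*` D s)) |%N)
      (fun p s => c * fine (m (K k p)) * fine (leb (D s))).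

Definition eta_var (R : realType) (T : Type) (xi xip : T -> nat) (w : T) : R :=
  ((xip w == xi w) && (xi w == 1%N))%:R.

(* Points with distinct t are distinct, so that a set of points suffices: there
   are no multiplicities to record. *)
Definition point_process (R : realType) (dT dX : measure_display)
    (T : measurableType dT) (X : measurableType dX)
    (d : nat) (P : set 'rV[R]_d)
    (xi : nat -> idx d -> T -> nat) (nu : nat -> idx d -> T -> X)
    (M : nat) (w : T) : set (X * 'rV[R]_d) :=
  [set (nu M t w, scaled R M t) | t in [set t | Pi P M t /\ xi M t w = 1%N]].

(* Main.v *)
From HB Require Import structures.
Require Import Defs.
From mathcomp Require Import all_boot all_order all_algebra.
From mathcomp Require Import finmap ring lra.
From mathcomp Require Import all_classical all_reals all_analysis.
From mathcomp Require Import measurable_realfun.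
Set Implicit Arguments.
Unset Strict Implicit.
Unset Printing Implicit Defensive.
Import Order.TTheory GRing.Theory Num.Theory.
Import numFieldNormedType.Exports.
Local Open Scope classical_set_scope.
Local Open Scope ring_scope.

(** For a division [D] of the domain and a partition [K], the number of points of
    the process in [K p `*` D s] is a sum, over the lattice points [t], of
    indicators [hits M t (p, s)] of probability of order [M^-d].  For [u] in
    [0, 1]^I its generating function is the expectation of
    [\prod_t (1 - loss u M t)], where [loss u M t] is the sum over [i] of
    [(1 - u i) * hits M t i], since at most one [i] is hit at a given [t].  The
    heart of the proof is that this expectation tends to [expR (- Lam)], where
    [Lam] is the sum of [(1 - u i) * mu i * vol i] ([gf_cvg]).

    Cut the range of the linear form into [n] slabs of equal width, with [n] fixed
    while [M] grows.  Discard the lowest slab and the points whose level is within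
    [3 R0 ln M] of a cut: this costs [O(1/n) + o(1)].  As the domain is connected,
    every cut has a lattice point [t'] at bounded distance of it ([level_point]),
    so that [t'] is more than [R0 ln M] above all retained points below the cut,
    and more than [R0 ln M] below all retained points above it.  The hits below
    the cut are constant on the elements of [F M t'] that meet [E M], while the
    conditional expectation given [F M t'] of a hit [i] above the cut is close to
    [mu i / M^d]: so every hit is almost uncorrelated with any function of the
    hits in the lower slabs ([decoupling], [dec_hits]).  Inside a slab, which has
    about [M^d / n] points, the product is replaced by [1] minus the sum of the
    losses; by the bound on pairs, the error is [O(1/n^2)].  A telescoping product
    over the [n] slabs ([block_telescope]) then gives [expR (- Lam)] up to
    [O(1/n) + o(1)], and [n] is arbitrary.

    The set [E M] need not be a union of elements of [F M t'], and the number of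
    configurations of the past is exponential in the number of points, so that
    they cannot be treated one by one with an error for each.  Conditional
    measures solve this: the event that the past is [x] is replaced by the event
    that its conditional probability is [1].  The latter belongs to
    [sigma_part (F M t')] and almost surely coincides with the former on [E M],
    simultaneously for all [x].

    Two more ingredients are needed.  The number of lattice points of [M * D s] is
    asymptotic to [M^d * leb (D s)] ([lattice_count_cvg]), because the boundary is
    covered by [O(N^(d-1))] cubes of side [O(1/N)], as C^1 maps are Lipschitz on
    the unit cube, and because compactness reduces countable covers to finite ones.
    Finally, convergence of the generating functions on the whole cube [0, 1]^I to
    that of independent Poisson variables implies convergence of the point
    probabilities, one coordinate at a time ([gf_to_pmf_step], [gf_to_hybrid]),
    and then convergence in distribution, as no mass is lost
    ([gf_to_bounded]). *)

(** * Expectations of bounded measurable functions *)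

Section bounded_expectation.
Context (R : realType) (d : measure_display) (T : measurableType d).
Context (Pr : probability T R).
Implicit Types X Y : T -> R.

Definition bdd_meas X :=
  measurable_fun setT X /\ exists C : R, forall w, `|X w| <= C.

Definition Ex X : R := \int[Pr]_(w in setT) X w.

Lemma bdd_meas_int X : bdd_meas X -> Pr.-integrable setT (EFin \o X).
Proof.
move=> [mX [C XC]]; apply: measurable_bounded_integrable => //.
  by rewrite -ge0_fin_numE// fin_num_measure.
exists C; split; first exact: num_real.
by move=> M CM w _; apply: le_trans (XC w) (ltW CM).
Qed.

Lemma bdd_measD X Y : bdd_meas X -> bdd_meas Y -> bdd_meas (fun w => X w + Y w).
Proof.
move=> [mX [C XC]] [mY [D YD]]; split; first exact: measurable_funD.
by exists (C + D) => w; rewrite (le_trans (ler_normD _ _))// lerD.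
Qed.

Lemma bdd_measM X Y : bdd_meas X -> bdd_meas Y -> bdd_meas (fun w => X w * Y w).
Proof.
move=> [mX [C XC]] [mY [D YD]]; split; first exact: measurable_funM.
by exists (C * D) => w; rewrite normrM ler_pM.
Qed.

Lemma bdd_meas_cst (r : R) : bdd_meas (fun=> r).
Proof. by split=> //; exists `|r|. Qed.

Lemma bdd_measN X : bdd_meas X -> bdd_meas (fun w => - X w).
Proof.
move=> [mX [C XC]]; split; first exact: measurableT_comp.
by exists C => w; rewrite normrN.
Qed.

Lemma bdd_measB X Y : bdd_meas X -> bdd_meas Y -> bdd_meas (fun w => X w - Y w).
Proof. by move=> bX bY; apply: bdd_measD => //; exact: bdd_measN. Qed.

Lemma bdd_meas_norm X : bdd_meas X -> bdd_meas (fun w => `|X w|).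
Proof.
move=> [mX [C XC]]; split; first exact: measurableT_comp.
by exists C => w; rewrite normr_id.
Qed.

Lemma bdd_meas_sum (I : Type) (s : seq I) (P : pred I) (X : I -> T -> R) :
  (forall i, bdd_meas (X i)) -> bdd_meas (fun w => \sum_(i <- s | P i) X i w).
Proof.
move=> bX; elim: s => [|i s IH].
  by under [X in bdd_meas X]funext do rewrite big_nil; exact: bdd_meas_cst.
under [X in bdd_meas X]funext do rewrite big_cons.
by case: (P i) => //; exact: bdd_measD.
Qed.

Lemma bdd_meas_prod (I : Type) (s : seq I) (P : pred I) (X : I -> T -> R) :
  (forall i, bdd_meas (X i)) -> bdd_meas (fun w => \prod_(i <- s | P i) X i w).
Proof.
move=> bX; elim: s => [|i s IH].
  by under [X in bdd_meas X]funext do rewrite big_nil; exact: bdd_meas_cst.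
under [X in bdd_meas X]funext do rewrite big_cons.
by case: (P i) => //; exact: bdd_measM.
Qed.

Lemma bdd_meas_indic (A : set T) : measurable A -> bdd_meas (\1_A : T -> R).
Proof.
move=> mA; split; first exact: measurable_indic.
by exists 1 => w; rewrite indicE; case: (w \in A); rewrite ?normr1 ?normr0.
Qed.

Lemma Ex_cst (r : R) : Ex (fun=> r) = r.
Proof.
rewrite /Ex Rintegral_cst//.
have -> : fine (Pr setT) = 1 by rewrite probability_setT.
by rewrite mulr1.
Qed.

Lemma ExD X Y : bdd_meas X -> bdd_meas Y ->
  Ex (fun w => X w + Y w) = Ex X + Ex Y.
Proof. by move=> bX bY; rewrite /Ex RintegralD//; exact: bdd_meas_int. Qed.

Lemma ExB X Y : bdd_meas X -> bdd_meas Y ->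
  Ex (fun w => X w - Y w) = Ex X - Ex Y.
Proof. by move=> bX bY; rewrite /Ex RintegralB//; exact: bdd_meas_int. Qed.

Lemma ExZ (r : R) X : bdd_meas X -> Ex (fun w => r * X w) = r * Ex X.
Proof. by move=> bX; rewrite /Ex RintegralZl//; exact: bdd_meas_int. Qed.

Lemma Ex_sum (I : Type) (s : seq I) (P : pred I) (X : I -> T -> R) :
  (forall i, bdd_meas (X i)) ->
  Ex (fun w => \sum_(i <- s | P i) X i w) = \sum_(i <- s | P i) Ex (X i).
Proof.
move=> bX; elim: s => [|i s IH].
  by under [X in Ex X]funext do rewrite big_nil; rewrite Ex_cst big_nil.
under [X in Ex X]funext do rewrite big_cons.
rewrite big_cons; case: (P i) => //.
by rewrite ExD// ?IH//; exact: bdd_meas_sum.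
Qed.

Lemma Ex_ge0 X : (forall w, 0 <= X w) -> 0 <= Ex X.
Proof. by move=> X0; apply: Rintegral_ge0. Qed.

Lemma Ex_le X Y : bdd_meas X -> bdd_meas Y -> (forall w, X w <= Y w) ->
  Ex X <= Ex Y.
Proof. by move=> bX bY XY; apply: le_Rintegral => //; exact: bdd_meas_int. Qed.

Lemma Ex_norm X : bdd_meas X -> `|Ex X| <= Ex (fun w => `|X w|).
Proof. by move=> bX; apply: le_normr_Rintegral => //; exact: bdd_meas_int. Qed.

Lemma Ex_norm_le X Y : bdd_meas X -> bdd_meas Y ->
  (forall w, `|X w| <= Y w) -> `|Ex X| <= Ex Y.
Proof.
move=> bX bY XY; apply: le_trans (Ex_norm bX) _.
by apply: Ex_le => //; exact: bdd_meas_norm.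
Qed.

Lemma Ex_indic (A : set T) : measurable A -> Ex \1_A = fine (Pr A).
Proof. by move=> mA; rewrite /Ex /Rintegral integral_indic// setIT. Qed.

Lemma Ex_EFin X : bdd_meas X -> ('E_Pr[X] = (Ex X)%:E)%E.
Proof.
move=> bX; rewrite unlock /Ex /Rintegral fineK//.
by apply: integrable_fin_num => //; exact: bdd_meas_int.
Qed.

Lemma Ex_ae_le X Y (N : set T) : bdd_meas X -> bdd_meas Y ->
  Pr.-negligible N -> (forall w, ~ N w -> X w <= Y w) -> Ex X <= Ex Y.
Proof.
move=> bX bY [A [mA A0 NA]] XY.
have [C XC] := bX.2; have [D YD] := bY.2.
have bA : bdd_meas (fun w => (C + D) * \1_A w).
  by apply: bdd_measM; [exact: bdd_meas_cst|exact: bdd_meas_indic].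
have : Ex X <= Ex (fun w => Y w + (C + D) * \1_A w).
  apply: Ex_le => //; first exact: bdd_measD.
  move=> w; rewrite indicE; case: (boolP (w \in A)) => [_|wA].
    have := XC w; have := YD w; rewrite !ler_norml mulr1.
    by move=> /andP[? _] /andP[_ ?]; lra.
  rewrite mulr0 addr0; apply: XY => Nw; move/negP: wA; apply.
  by rewrite inE; exact: NA.
rewrite ExD// ExZ ?Ex_indic//; last exact: bdd_meas_indic.
by rewrite A0 /= mulr0 addr0.
Qed.

End bounded_expectation.

(** * Elementary inequalities *)

Section real_inequalities.
Context (R : realType).

(** First two Bonferroni inequalities for the product of the [1 - x t]: the
    defect of the linear approximation is controlled by the pairs. *)
Lemma prod_1B_lin (U : eqType) (s : seq U) (x : U -> R) : uniq s ->
  (forall t, 0 <= x t <= 1) ->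
  0 <= \prod_(t <- s) (1 - x t) - (1 - \sum_(t <- s) x t)
    <= \sum_(t <- s) \sum_(r <- s | r != t) x t * x r.
Proof.
move=> + x01; elim: s => [_|t s IH /= /andP[ts us]].
  by rewrite !big_nil subr0 subrr lexx.
have /andP[lo hi] := IH us.
have /andP[x0 x1] := x01 t.
have p0 : 0 <= \prod_(t <- s) (1 - x t).
  by apply: prodr_ge0 => r _; have /andP[_ ?] := x01 r; rewrite subr_ge0.
have p1 : \prod_(t <- s) (1 - x t) <= 1.
  by apply: prodr_ile1 => r _; have /andP[? ?] := x01 r; rewrite subr_ge0; lra.
have -> : \sum_(r <- t :: s) \sum_(r' <- t :: s | r' != r) x r * x r' =
  (x t * \sum_(r <- s) x r) + (\sum_(r <- s) x r * x t) +
  \sum_(r <- s) \sum_(r' <- s | r' != r) x r * x r'.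
  rewrite big_cons big_cons eqxx /= -addrA; congr (_ + _).
    rewrite mulr_sumr big_seq_cond [RHS]big_seq_cond.
    apply: eq_bigl => r; case: (boolP (r \in s)) => //= rs.
    by apply: contraNneq ts => <-.
  rewrite -big_split /=; rewrite big_seq [RHS]big_seq; apply: eq_bigr => r rs.
  by rewrite big_cons ifT//; apply: contraNneq ts => ->.
have S0 : 0 <= \sum_(r <- s) x r.
  by apply: sumr_ge0 => r _; have /andP[] := x01 r.
have S1 : 0 <= \sum_(r <- s) x r * x t.
  by rewrite -mulr_suml mulr_ge0.
rewrite !big_cons.
set p := (\prod_(j <- s) _) in lo hi p0 p1 *.
set S := (\sum_(j <- s) x j) in lo hi S0 *.
have E1 : (1 - x t) * p - (1 - (x t + S)) = (p - (1 - S)) + x t * (1 - p).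
  by ring.
have H1 : 0 <= x t * (1 - p) by rewrite mulr_ge0// subr_ge0.
have H2 : x t * (1 - p) <= x t * S by rewrite ler_wpM2l//; lra.
rewrite E1; apply/andP; split; first by rewrite addr_ge0.
lra.
Qed.

(** The additional factors multiply a number of [0, 1] by a number which is at
    least [1] minus the sum of their [x t], by [prod_1B_lin]. *)
Lemma prod_1B_subset (U : finType) (P Q : pred U) (x : U -> R) :
  (forall t, 0 <= x t <= 1) -> (forall t, Q t -> P t) ->
  `|\prod_(t | P t) (1 - x t) - \prod_(t | Q t) (1 - x t)|
    <= \sum_(t | P t && ~~ Q t) x t.
Proof.
move=> x01 QP.
rewrite (bigID Q) /=.
have PQ : (fun t => P t && Q t) =1 Q.
  by move=> t /=; case: (boolP (Q t)) => [/QP -> //|_]; rewrite andbF.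
rewrite (eq_bigl _ _ PQ).
rewrite -{2}[\prod_(t | Q t) _]mulr1 -mulrBr normrM.
have u1 t : 0 <= 1 - x t <= 1.
  by have /andP[? ?] := x01 t; rewrite subr_ge0; lra.
have pr (V : pred U) : 0 <= \prod_(t | V t) (1 - x t) <= 1.
  rewrite prodr_ge0 ?prodr_ile1// => t _; by have /andP[] := u1 t.
have /andP[a0 a1] := pr Q.
rewrite (ger0_norm a0).
set W := \prod_(t | P t && ~~ Q t) _.
have /andP[b0 b1] : 0 <= W <= 1 by exact: (pr (fun t => P t && ~~ Q t)).
rewrite ler0_norm ?subr_le0// opprB.
apply: (@le_trans _ _ (1 - W)); first by rewrite ler_piMl// subr_ge0.
rewrite /W; set V := fun t => P t && ~~ Q t.
have := @prod_1B_lin U [seq t <- index_enum U | V t] x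
  (filter_uniq _ (index_enum_uniq U)) x01.
rewrite !big_filter => /andP[+ _].
by rewrite /V; lra.
Qed.

(** The upper bound follows from [expR (- a) <= (1 + a)^-1]. *)
Lemma expRN_lin (a : R) : 0 <= a -> 0 <= expR (- a) - (1 - a) <= a ^+ 2.
Proof.
move=> a0; apply/andP; split; first by have := expR_ge1Dx (- a); lra.
have H1 : (1 + a) * expR (- a) <= 1.
  rewrite expRN -ler_pdivlMr ?invr_gt0 ?expR_gt0// invrK mul1r.
  exact: expR_ge1Dx.
have e0 : 0 < expR (- a) := expR_gt0 _.
rewrite -(ler_pM2l (_ : 0 < 1 + a)); last by lra.
apply: (@le_trans _ _ (1 - (1 + a) * (1 - a))); first by rewrite mulrBr; lra.
have : 0 <= a ^+ 3 by rewrite exprn_ge0.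
by rewrite !exprS expr0; nra.
Qed.

Lemma expRN_lip (a b : R) : 0 <= a -> 0 <= b ->
  `|expR (- a) - expR (- b)| <= `|a - b|.
Proof.
wlog ab : a b / a <= b.
  move=> H a0 b0; have [ab|/ltW ba] := leP a b; first exact: H.
  by rewrite distrC [leRHS]distrC; exact: H.
move=> a0 b0.
have e1 : expR (- a) <= 1 by rewrite -expR0 ler_expR; lra.
have e2 : expR (- b) <= expR (- a) by rewrite ler_expR; lra.
rewrite ger0_norm ?subr_ge0// ler0_norm ?subr_le0// opprB.
have -> : expR (- a) - expR (- b) = expR (- a) * (1 - expR (- (b - a))).
  by rewrite mulrBr mulr1 -expRD; congr (_ - expR _); lra.
have h1 := expR_ge1Dx (- (b - a)).
have h2 : expR (- (b - a)) <= 1 by rewrite -expR0 ler_expR; lra.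
apply: (@le_trans _ _ (1 - expR (- (b - a)))); last by lra.
by rewrite ler_piMl// subr_ge0.
Qed.

End real_inequalities.

(** * Decoupling a conditional expectation from the past *)

Section decoupling.
Context (R : realType) (d : measure_display) (T : measurableType d).
Context (Pr : probability T R).

(** The exceptional set will be the one where the conditional measures are not
    carried by the elements of the partition. *)
Lemma Ex_ae_norm (X Y : T -> R) (N : set T) : bdd_meas X -> bdd_meas Y ->
  Pr.-negligible N -> (forall w, ~ N w -> `|X w| <= Y w) ->
  `|Ex Pr X| <= Ex Pr Y.
Proof.
move=> bX bY nN XY; rewrite ler_norml; apply/andP; split.
  rewrite lerNl -mulN1r -ExZ//.
  apply: Ex_ae_le nN _ => //; first by apply: bdd_measM => //; exact: bdd_meas_cst.
  by move=> w Nw; have := XY w Nw; rewrite ler_norml => /andP[? _]; lra.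
apply: Ex_ae_le nN _ => // w Nw.
by have := XY w Nw; rewrite ler_norml => /andP[_ ?]; lra.
Qed.

Lemma sigma_part_s (F : set (set T)) : <<s sigma_part F >> = sigma_part F.
Proof. by apply: sigma_algebra_id; exact: sigma_part_sigma_algebra. Qed.

(** A version [Y] of a conditional expectation may be unbounded; multiplying it by
    the indicator of a set where it is controlled keeps the calculus of bounded
    functions applicable. *)
Lemma condexp_Ex (F : set (set T)) (f Y : T -> R) (A : set T) (C : R) :
  bdd_meas f -> is_condexp Pr (sigma_part F) f Y -> sigma_part F A ->
  (forall w, A w -> `|Y w| <= C) ->
  bdd_meas (fun w => \1_A w * Y w) /\
  Ex Pr (fun w => \1_A w * f w) = Ex Pr (fun w => \1_A w * Y w).
Proof.
move=> bf [_ iY /(_ A) IY] sA YC; have [mA _] := sA.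
have mY : measurable_fun setT Y.
  by apply/measurable_EFinP; exact: measurable_int iY.
have C0 : 0 <= `|C| by [].
split.
  split; first by apply: measurable_funM => //; exact: measurable_indic.
  exists `|C| => w; rewrite indicE; case: (boolP (w \in A)) => wA.
    by rewrite mul1r (le_trans (YC w _)) ?ler_norm//; exact: set_mem.
  by rewrite mul0r normr0.
rewrite sigma_part_s in IY; have {}IY := IY sA.
have H (g : T -> R) : Ex Pr (fun w => \1_A w * g w) = \int[Pr]_(w in A) g w.
  rewrite /Ex Rintegral_mkcond [RHS]Rintegral_mkcond; apply: eq_Rintegral => w _.
  by rewrite !patchE in_setT indicE; case: ifP; rewrite ?mul1r ?mul0r.
by rewrite !H /Rintegral IY.
Qed.

(** The function [phi \o kappa] of the past is only constant on the elements of [F]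
    that meet [E], hence not measurable with respect to [F].  It is replaced by [S],
    which gives the weight [phi i] to the event [B i] that the conditional
    probability of [kappa = i] is [1] and that [Y] is [e]-close to [q].  The [B i]
    are disjoint elements of [sigma_part F], so that [f] may be replaced by [Y]
    under the weight [S]; and [S] equals [phi \o kappa] almost surely on [E],
    whence the two errors [Pr (~` E)] and [q * Pr (~` E)]. *)
Lemma decoupling (F : set (set T)) (E : set T) (I : finType) (kappa : T -> I)
    (phi : I -> R) (f Y : T -> R) (q e : R) :
  prob_partition Pr F -> measurable E ->
  (forall i, measurable (kappa @^-1` [set i])) ->
  (forall i, 0 <= phi i <= 1) ->
  (forall w, E w -> forall w', pblock F id w w' -> kappa w' = kappa w) ->
  bdd_meas f -> (forall w, 0 <= f w <= 1) ->
  is_condexp Pr (sigma_part F) f Y ->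
  0 <= q -> 0 <= e -> (forall w, E w -> `|Y w - q| <= e) ->
  `|Ex Pr (fun w => phi (kappa w) * f w) - q * Ex Pr (phi \o kappa)|
    <= e + (1 + q) * fine (Pr (~` E)).
Proof.
move=> [pF mF [k [kF kN]]] mE mk phi01 kE bf f01 cY q0 e0 YE.
have mpb w : measurable (pblock F id w).
  apply: mF; case: pF => + _ _ => cov.
  have : setT w by [].
  rewrite -cov => -[B FB Bw].
  by have [] := getPex (ex_intro (fun B => F B /\ id B w) B (conj FB Bw)).
pose G := [set w | `|Y w - q| <= e].
pose B i := [set w | fine (k w (kappa @^-1` [set i])) = 1] `&` G.
have sG : sigma_part F G.
  rewrite -sigma_part_s; case: cY => mY _ _.
  have : measurable_fun setT (fun w : g_sigma_algebraType (sigma_part F) => `|Y w - q|).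
    apply: measurableT_comp => //; exact: measurable_funB.
  move=> /(_ measurableT _ (measurable_itv `]-oo, e])).
  have -> : G = (fun w : g_sigma_algebraType (sigma_part F) => `|Y w - q|)
      @^-1` `]-oo, e].
    by apply/seteqP; split=> w; rewrite /G /= in_itv.
  by rewrite setTI.
have sB i : sigma_part F (B i).
  rewrite -sigma_part_s; apply: (@measurableI _ (g_sigma_algebraType (sigma_part F))).
    have [+ _ _] := kF _ (mk i).
    move=> /(_ measurableT _ (measurable_set1 1)).
    by rewrite setTI.
  by rewrite /measurable /= sigma_part_s.
have mB i : measurable (B i) by have [] := sB i.
have Bi i j w : B i w -> B j w -> i = j.
  move=> [/= ki _] [/= kj _]; apply/eqP/negP => /negP ij.
  have : (k w (kappa @^-1` [set i] `|` kappa @^-1` [set j]) <= 1)%E.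
    by apply: probability_le1; exact: measurableU.
  have dij : kappa @^-1` [set i] `&` kappa @^-1` [set j] = set0.
    by apply/seteqP; split=> // x [/= xi xj]; case/eqP: ij; rewrite -xi -xj.
  have -> : (k w (kappa @^-1` [set i] `|` kappa @^-1` [set j]) =
      k w (kappa @^-1` [set i]) + k w (kappa @^-1` [set j]))%E.
    exact: measureU.
  have Hf x : k w (kappa @^-1` [set x]) = (fine (k w (kappa @^-1` [set x])))%:E.
    by rewrite fineK// fin_num_measure.
  by rewrite (Hf i) (Hf j) ki kj -EFinD lee_fin; lra.
pose S w := \sum_i phi i * \1_(B i) w.
have bB i : bdd_meas (fun w => phi i * \1_(B i) w).
  by apply: bdd_measM; [exact: bdd_meas_cst|exact: bdd_meas_indic].
have bS : bdd_meas S by exact: bdd_meas_sum.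
have SB i w : B i w -> S w = phi i.
  move=> Biw; rewrite /S (bigD1 i)//= big1 ?addr0.
    by rewrite indicE mem_set ?mulr1.
  move=> j ji; rewrite indicE memNset ?mulr0// => Bj.
  by case/eqP: ji; exact: Bi Bj Biw.
have S01 w : 0 <= S w <= 1.
  have [[i Biw]|nB] := pselect (exists i, B i w); first by rewrite (SB i).
  rewrite /S big1 ?lexx ?ler01// => i _; rewrite indicE memNset ?mulr0// => Biw.
  by apply: nB; exists i.
have SY w : `|S w * (Y w - q)| <= e.
  have [[i Biw]|nB] := pselect (exists i, B i w).
    rewrite (SB i)// normrM.
    have /andP[p0 p1] := phi01 i; rewrite (ger0_norm p0).
    by case: Biw => _ /= He; apply: le_trans He; rewrite ler_piMl.
  rewrite /S big1 ?mul0r ?normr0// => i _; rewrite indicE memNset ?mulr0// => Biw.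
  by apply: nB; exists i.
case: kN => N [mN N0 NN].
have nN : Pr.-negligible N by exists N; split.
have SE w : E w -> ~ N w -> S w = phi (kappa w).
  move=> Ew Nw; apply: SB; split; last exact: YE.
  have kp : k w (pblock F id w) = 1%E.
    by apply: contrapT => h; apply: Nw; exact: NN.
  have : (1%E <= k w (kappa @^-1` [set kappa w]))%E.
    rewrite -kp; apply: le_measure; rewrite ?inE// => w' pw /=.
    exact: kE pw.
  move=> h /=; have -> : k w (kappa @^-1` [set kappa w]) = 1%E; last by [].
  by apply/eqP; rewrite eq_le h andbT probability_le1.
have mkap : bdd_meas (phi \o kappa).
  rewrite (_ : phi \o kappa = fun w => \sum_i phi i * \1_(kappa @^-1` [set i]) w).
    apply: bdd_meas_sum => i.
    by apply: bdd_measM; [exact: bdd_meas_cst|exact: bdd_meas_indic].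
  apply/funext => w /=; rewrite (bigD1 (kappa w))//= indicE mem_set// mulr1.
  rewrite big1 ?addr0// => j jk; rewrite indicE memNset ?mulr0//= => jk'.
  by rewrite jk' eqxx in jk.
have bE : bdd_meas (\1_(~` E) : T -> R).
  by apply: bdd_meas_indic; exact: measurableC.
have EE : Ex Pr \1_(~` E) = fine (Pr (~` E)).
  by apply: Ex_indic; exact: measurableC.
have H1 : `|Ex Pr (fun w => phi (kappa w) * f w) - Ex Pr (fun w => S w * f w)|
    <= fine (Pr (~` E)).
  rewrite -ExB; [|exact: bdd_measM..].
  rewrite -EE; apply: Ex_ae_norm nN _ => //.
    by apply: bdd_measB; exact: bdd_measM.
  move=> w Nw; rewrite -mulrBl indicE in_setC.
  case: (boolP (w \in E)) => [/set_mem Ew|_] /=.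
    by rewrite SE// subrr mul0r normr0.
  have /andP[? ?] := f01 w; have /andP[? ?] := S01 w.
  have /andP[? ?] := phi01 (kappa w).
  rewrite normrM -[leRHS]mulr1 ler_pM// ?ler_norml; lra.
have H2 : `|Ex Pr S - Ex Pr (phi \o kappa)| <= fine (Pr (~` E)).
  rewrite -ExB// -EE; apply: Ex_ae_norm nN _ => //; first exact: bdd_measB.
  move=> w Nw; rewrite indicE in_setC.
  case: (boolP (w \in E)) => [/set_mem Ew|_] /=.
    by rewrite SE// subrr normr0.
  have /andP[? ?] := S01 w.
  have /andP[? ?] := phi01 (kappa w).
  by rewrite ler_norml; lra.
have YC i w : B i w -> `|Y w| <= q + e.
  move=> [_ /= He]; rewrite -(subrK q (Y w)) (le_trans (ler_normD _ _))//.
  by rewrite (ger0_norm q0) addrC lerD2l.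
have CE i := condexp_Ex bf cY (sB i) (YC i).
have SfE (g : T -> R) :
    (fun w => S w * g w) = (fun w => \sum_i phi i * (\1_(B i) w * g w)).
  by apply/funext => w; rewrite /S mulr_suml; apply: eq_bigr => i _; rewrite mulrA.
have bSY : bdd_meas (fun w => S w * Y w).
  rewrite SfE; apply: bdd_meas_sum => i.
  by apply: bdd_measM; [exact: bdd_meas_cst|exact: (CE i).1].
have H3 : Ex Pr (fun w => S w * f w) = Ex Pr (fun w => S w * Y w).
  have b1 i : bdd_meas (fun w => \1_(B i) w * f w).
    by apply: bdd_measM => //; exact: bdd_meas_indic.
  have b2 i : bdd_meas (fun w => \1_(B i) w * Y w) by exact: (CE i).1.
  have bZ (g : T -> R) i : bdd_meas g -> bdd_meas (fun w => phi i * g w).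
    by apply: bdd_measM; exact: bdd_meas_cst.
  rewrite !SfE Ex_sum; last by move=> i; exact: bZ.
  rewrite Ex_sum; last by move=> i; exact: bZ.
  by apply: eq_bigr => i _; rewrite ExZ// ExZ// (CE i).2.
have H4 : `|Ex Pr (fun w => S w * Y w) - q * Ex Pr S| <= e.
  rewrite -ExZ// -ExB//; last by apply: bdd_measM => //; exact: bdd_meas_cst.
  rewrite -[leRHS](Ex_cst Pr); apply: Ex_norm_le; last 1 first.
  - by move=> w; have := SY w; rewrite mulrBr [S w * q]mulrC.
  - by apply: bdd_measB => //; apply: bdd_measM => //; exact: bdd_meas_cst.
  - exact: bdd_meas_cst.
have H5 : `|q * Ex Pr S - q * Ex Pr (phi \o kappa)| <= q * fine (Pr (~` E)).
  by rewrite -mulrBr normrM (ger0_norm q0) ler_wpM2l.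
move: H1 H4 H5; rewrite H3 !ler_norml => /andP[? ?] /andP[? ?] /andP[? ?].
lra.
Qed.

End decoupling.

(** * Telescoping over blocks *)

Section blocks.
Context (R : realType) (d : measure_display) (T : measurableType d).
Context (Pr : probability T R) (U : finType) (v : U -> T -> R).
Context (blk : U -> nat) (q : U -> R) (de rho : R).
Hypothesis bv : forall f, bdd_meas (v f).
Hypothesis v01 : forall f w, 0 <= v f w <= 1.
Hypothesis q0 : forall f, 0 <= q f.
Hypothesis rho0 : 0 <= rho.

(** With [v f] an indicator, this is the indicator that nothing happens in the
    blocks [1], ..., [j].  Block [0] collects the discarded indices. *)
Definition void_upto (j : nat) (w : T) : R :=
  \prod_(f | (0 < blk f <= j)%N) (1 - v f w).

Lemma bdd_meas_1B f : bdd_meas (fun w => 1 - v f w).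
Proof. by apply: bdd_measB => //; exact: bdd_meas_cst. Qed.

Lemma bdd_void_upto j : bdd_meas (void_upto j).
Proof. by apply: bdd_meas_prod => f; exact: bdd_meas_1B. Qed.

Lemma prod_1B_01 (P : pred U) w : 0 <= \prod_(f | P f) (1 - v f w) <= 1.
Proof.
have h f : 0 <= 1 - v f w <= 1 by have /andP[? ?] := v01 f w; lra.
by rewrite prodr_ge0 ?prodr_ile1// => f _; have /andP[] := h f.
Qed.

Definition intensity (j : nat) : R := \sum_(f | blk f == j) q f.

Definition blk_error (j : nat) : R :=
  #|[pred f | blk f == j]|%:R * de + #|[pred f | blk f == j]|%:R ^+ 2 * rho
  + intensity j ^+ 2.

(** The product over the block is replaced by [1] minus the sum of its [v f], at the
    cost of the pairs; each [v f] is then replaced by [q f], at the cost [de]; and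
    finally [1 - intensity] by its exponential. *)
Lemma block_step j :
  (forall f, blk f = j.+1 ->
    `|Ex Pr (fun w => void_upto j w * v f w) - q f * Ex Pr (void_upto j)| <= de) ->
  (forall f g, f != g -> blk f = j.+1 -> blk g = j.+1 ->
    Ex Pr (fun w => v f w * v g w) <= rho) ->
  `|Ex Pr (void_upto j.+1) - expR (- intensity j.+1) * Ex Pr (void_upto j)|
    <= blk_error j.+1.
Proof.
move=> Hde Hrho.
pose A := void_upto j; pose B f := blk f == j.+1.
have AE w : void_upto j.+1 w = A w * \prod_(f | B f) (1 - v f w).
  rewrite /A /void_upto (bigID (fun f => (blk f <= j)%N)) /=; congr (_ * _).
    apply: eq_bigl => f; case: (ltnP 0 (blk f)) => //= _.
    by rewrite [LHS]andbC; case: leqP => // h; rewrite ltnW.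
  apply: eq_bigl => f; rewrite /B -ltnNge -andbA.
  case: eqP => [->|/eqP fj]; first by rewrite !ltnSn.
  by rewrite -eqn_leq (negbTE fj) andbF.
have A01 w : 0 <= A w <= 1 by exact: prod_1B_01.
have bA : bdd_meas A := bdd_void_upto j.
have bAv f : bdd_meas (fun w => A w * v f w) by exact: bdd_measM.
pose S w := \sum_(f | B f) v f w.
have bS : bdd_meas S by exact: bdd_meas_sum.
pose D w := \sum_(f | B f) \sum_(g | B g && (g != f)) v f w * v g w.
have bD : bdd_meas D.
  by apply: bdd_meas_sum => f; apply: bdd_meas_sum => g; exact: bdd_measM.
have H1 : `|Ex Pr (void_upto j.+1) - Ex Pr (fun w => A w * (1 - S w))| <= Ex Pr D.
  have b1 : bdd_meas (fun w => A w * (1 - S w)).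
    by apply: bdd_measM => //; apply: bdd_measB => //; exact: bdd_meas_cst.
  rewrite -ExB//; last exact: bdd_void_upto.
  apply: Ex_norm_le => //; first by apply: bdd_measB => //; exact: bdd_void_upto.
  move=> w; rewrite AE -mulrBr normrM.
  have /andP[a0 a1] := A01 w.
  rewrite (ger0_norm a0).
  have := @prod_1B_lin R U [seq f <- index_enum U | B f] (fun f => v f w)
    (filter_uniq _ (index_enum_uniq U)) (fun f => v01 f w).
  rewrite !big_filter => /andP[h1 h2].
  rewrite (ger0_norm h1).
  apply: le_trans (_ : _ <= \prod_(f | B f) (1 - v f w) - (1 - S w)) _.
    by rewrite ler_piMl.
  apply: le_trans h2 _; rewrite /D le_eqVlt; apply/orP; left; apply/eqP.
  apply: eq_bigr => f _.
  by rewrite big_filter_cond; apply: eq_bigl => g; rewrite andbC.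
have H2 : Ex Pr D <= #|[pred f | B f]|%:R ^+ 2 * rho.
  rewrite Ex_sum; last by move=> f; apply: bdd_meas_sum => g; exact: bdd_measM.
  have -> : #|[pred f | B f]|%:R ^+ 2 * rho =
      \sum_(f | B f) #|[pred f | B f]|%:R * rho.
    by rewrite sumr_const expr2 -mulrA mulr_natl.
  apply: ler_sum => f Bf.
  rewrite Ex_sum; last by move=> g; exact: bdd_measM.
  apply: le_trans (_ : _ <= \sum_(g | B g && (g != f)) rho) _.
    apply: ler_sum => g /andP[Bg gf].
    by apply: Hrho; rewrite 1?eq_sym//; apply/eqP.
  rewrite sumr_const -[leLHS]mulr_natl; apply: ler_wpM2r => //; rewrite ler_nat.
  by apply: subset_leq_card; apply/fintype.subsetP => g /andP[].
have H3 : `|Ex Pr (fun w => A w * (1 - S w)) - (1 - intensity j.+1) * Ex Pr A|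
    <= #|[pred f | B f]|%:R * de.
  have -> : (fun w => A w * (1 - S w)) = (fun w => A w - \sum_(f | B f) A w * v f w).
    by apply/funext => w; rewrite mulrBr mulr1 mulr_sumr.
  rewrite ExB//; last exact: bdd_meas_sum.
  rewrite Ex_sum// mulrBl mul1r opprB addrC addrA subrK.
  rewrite /intensity mulr_suml -sumrB.
  apply: le_trans (ler_norm_sum _ _ _) _.
  rewrite -sum1_card natr_sum mulr_suml; apply: ler_sum => f Bf.
  by rewrite mul1r distrC; apply: Hde; apply/eqP.
have I0 : 0 <= intensity j.+1 by exact: sumr_ge0.
have /andP[e0 e1] := expRN_lin I0.
have EA0 : 0 <= Ex Pr A by apply: Ex_ge0 => w; have /andP[] := A01 w.
have EA1 : Ex Pr A <= 1.
  rewrite -[leRHS](Ex_cst Pr); apply: Ex_le => //; first exact: bdd_meas_cst.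
  by move=> w; have /andP[] := A01 w.
have H4 : `|(1 - intensity j.+1) * Ex Pr A - expR (- intensity j.+1) * Ex Pr A|
    <= intensity j.+1 ^+ 2.
  rewrite -mulrBl normrM (ger0_norm EA0) distrC (ger0_norm e0).
  by apply: le_trans e1; rewrite ler_piMr.
have tri (x y z t : R) : x - t = (x - y) + (y - z) + (z - t) by lra.
rewrite (tri _ (Ex Pr (fun w => A w * (1 - S w))) ((1 - intensity j.+1) * Ex Pr A)).
apply: le_trans (ler_normD _ _) _; rewrite /blk_error lerD//.
apply: le_trans (ler_normD _ _) _; rewrite addrC lerD//.
exact: le_trans H1 H2.
Qed.

(** The errors add up because the factors [expR (- intensity)] are at most [1]. *)
Lemma block_telescope n :
  (forall j f, (j < n)%N -> blk f = j.+1 ->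
    `|Ex Pr (fun w => void_upto j w * v f w) - q f * Ex Pr (void_upto j)| <= de) ->
  (forall f g, f != g -> Ex Pr (fun w => v f w * v g w) <= rho) ->
  `|Ex Pr (void_upto n) - expR (- \sum_(j < n) intensity j.+1)|
    <= \sum_(j < n) blk_error j.+1.
Proof.
move=> Hde Hrho; elim: n Hde => [|n IH] Hde.
  rewrite !big_ord0 oppr0 expR0 (_ : void_upto 0 = fun=> 1); last first.
    by apply/funext => w; rewrite /void_upto big1// => f; case: (blk f).
  by rewrite Ex_cst subrr normr0.
have {}IH := IH (fun j f jn => Hde j f (ltnW jn)).
rewrite !big_ord_recr /= opprD expRD.
set e := expR (- intensity n.+1).
have e1 : 0 <= e <= 1.
  rewrite expR_ge0/= -expR0 ler_expR oppr_le0; exact: sumr_ge0.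
have S : `|Ex Pr (void_upto n.+1) - e * Ex Pr (void_upto n)| <= blk_error n.+1.
  apply: block_step => [f fn|f g fg _ _]; [exact: Hde|exact: Hrho].
have -> : Ex Pr (void_upto n.+1) - expR (- \sum_(i < n) intensity i.+1) * e =
   e * (Ex Pr (void_upto n) - expR (- \sum_(i < n) intensity i.+1)) +
  (Ex Pr (void_upto n.+1) - e * Ex Pr (void_upto n)) by ring.
apply: le_trans (ler_normD _ _) _; apply: lerD => //.
have /andP[a b] := e1.
rewrite normrM (ger0_norm a); apply: le_trans IH.
by rewrite ler_piMl.
Qed.

End blocks.

(** * Lipschitz bound for C^1 maps on the unit cube *)

Section C1_lipschitz.
Context (R : realType).

Lemma rV_coord_le_norm n (x : 'rV[R]_n) j : `|x 0 j| <= `|x|.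
Proof.
rewrite [leRHS]/Num.Def.normr/= mx_normrE.
exact: (le_bigmax _ (fun ij : 'I_1 * 'I_n => `|x ij.1 ij.2|) (0, j)).
Qed.

Definition unit_cube n : set 'rV[R]_n := [set x | forall j, 0 <= x 0 j <= 1].

Lemma compact_unit_cube n : compact (@unit_cube n).
Proof.
have -> : @unit_cube n = [set v | forall i, (v ord0 i : R) \in `[0, 1]].
  by apply/seteqP; split=> x /= xc j; have := xc j; rewrite in_itv.
have := @rV_compact R n (fun=> `[0, 1]%classic) (fun=> @segment_compact R 0 1).
exact.
Qed.

(** Chain rule along a line, coordinate by coordinate. *)
Lemma is_derive_line m n (f : 'rV[R]_m -> 'rV[R]_n) (x h : 'rV[R]_m) (s : R) j :
  (forall y, differentiable f y) ->
  is_derive s 1 (fun s => f (x + s *: h) 0 j)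
    ((h *m jacobian f (x + s *: h)) 0 j).
Proof.
move=> df.
pose g := fun s : R => x + s *: h.
have dg : is_diff s g ( *:%R^~ h).
  have := is_diffD (is_diff_cst x (s : R^o)) (is_diff_scalel s h).
  by rewrite add0r.
have dF : differentiable (f \o g) s by apply: differentiable_comp.
have DF : derivable (f \o g) s 1 by exact: diff_derivable.
have Dj : derivable (fun s => f (g s) 0 j) s 1.
  by have /derivable_mxP/(_ 0 j) := DF.
have := derive_mx DF.
rewrite deriveE// diff_comp//= (_ : 'd g s 1 = h); last first.
  by rewrite diff_val scale1r.
rewrite -deriveE// deriveEjacobian// => ->.
rewrite mxE; exact/derivableP.
Qed.

(** Mean value theorem along the segment from [y] to [x], which stays in the unit
    cube, where compactness bounds the Jacobian. *)
Lemma C1_lip m n (f : 'rV[R]_m -> 'rV[R]_n) : C1_map f ->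
  exists2 L : R, 0 <= L & forall x y (e : R), unit_cube x -> unit_cube y ->
    (forall i, `|x 0 i - y 0 i| <= e) -> forall j, `|f x 0 j - f y 0 j| <= L * e.
Proof.
move=> [df cJ].
have : bounded_set (jacobian f @` @unit_cube m).
  apply: compact_bounded; apply: continuous_compact; last exact: compact_unit_cube.
  exact: continuous_subspaceT.
move=> [B [_ HB]].
have JB x : unit_cube x -> `|jacobian f x| <= `|B| + 1.
  move=> cx; apply: (HB (`|B| + 1)); last by exists x.
  by rewrite (le_lt_trans (ler_norm B))// ltrDl.
exists (m%:R * (`|B| + 1)); first by rewrite mulr_ge0// addr_ge0.
move=> x y e cx cy xy j.
pose g (s : R) := f (y + s *: (x - y)) 0 j.
have Dg (s : R) : is_derive s (1 : R) g (((x - y) *m jacobian f (y + s *: (x - y))) 0 j).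
  exact: is_derive_line.
have cg : {within `[0, 1], continuous g}.
  apply: continuous_subspaceT => s.
  by apply: differentiable_continuous; apply/derivable1_diffP; have [] := Dg s.
have [s s01 gE] := @MVT_segment R g _ 0 1 ler01 (fun s _ => Dg s) cg.
have e1 : g 1 = f x 0 j by rewrite /g scale1r addrC subrK.
have e0 : g 0 = f y 0 j by rewrite /g scale0r addr0.
rewrite -e1 -e0 gE subr0 mulr1 mxE.
have cs : unit_cube (y + s *: (x - y)).
  move: s01; rewrite in_itv/= => /andP[s0 s1] i; rewrite !mxE.
  have /andP[? ?] := cx i; have /andP[? ?] := cy i.
  by apply/andP; split; nra.
apply: le_trans (ler_norm_sum _ _ _) _.
apply: le_trans (_ : _ <= \sum_(i < m) e * (`|B| + 1)) _; last first.
  by rewrite sumr_const card_ord -[leLHS]mulr_natl [e * _]mulrC mulrA.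
apply: ler_sum => i _; rewrite normrM ler_pM//.
  by have := xy i; rewrite !mxE.
apply: le_trans (JB _ cs).
rewrite [leRHS]/Num.Def.normr/= mx_normrE.
exact: (le_bigmax _ (fun ij : 'I_m * 'I_n => `|(jacobian f (y + s *: (x - y))) ij.1 ij.2|) (i, j)).
Qed.

End C1_lipschitz.

(** * Lattice points in boxes and slabs, and sets of content zero *)

Section lattice_counting.
Context (R : realType).

Lemma cvgr_prod_seq (T I : Type) (F : set_system T) {FF : Filter F} (s : seq I)
    (f : I -> T -> R) (l : I -> R) :
  (forall i, f i x @[x --> F] --> l i) ->
  \prod_(i <- s) f i x @[x --> F] --> \prod_(i <- s) l i.
Proof.
move=> fl; elim: s => [|i s IH].
  by under eq_fun do rewrite big_nil; rewrite big_nil; exact: cvg_cst.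
by under eq_fun do rewrite big_cons; rewrite big_cons; exact: cvgM.
Qed.

Lemma cvgr_sum_seq (T I : Type) (F : set_system T) {FF : Filter F} (s : seq I)
    (f : I -> T -> R) (l : I -> R) :
  (forall i, f i x @[x --> F] --> l i) ->
  \sum_(i <- s) f i x @[x --> F] --> \sum_(i <- s) l i.
Proof.
move=> fl; elim: s => [|i s IH].
  by under eq_fun do rewrite big_nil; rewrite big_nil; exact: cvg_cst.
by under eq_fun do rewrite big_cons; rewrite big_cons; exact: cvgD.
Qed.

(** Reduction modulo [mm j] of the [j]-th coordinate maps [S] injectively to a set
    with [\prod_j mm j] elements.  Both boxes and slabs are counted in this way. *)
Lemma card_mod_inj (d n : nat) (S : pred {ffun 'I_d -> 'I_n}) (mm : 'I_d -> nat) :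
  (forall j, (0 < mm j)%N) ->
  (forall f g, S f -> S g -> (forall j, f j = g j %[mod mm j]) -> f = g) ->
  (#|S| <= \prod_j mm j)%N.
Proof.
move=> m0 inj.
pose h (f : {ffun 'I_d -> 'I_n}) : {dffun forall j, 'I_(mm j)} :=
  [ffun j => Ordinal (ltn_pmod (f j) (m0 j))].
have hinj : {in S &, injective h}.
  move=> f g Sf Sg hfg; apply: inj => // j.
  by have /ffunP/(_ j) := hfg; rewrite !ffunE => -[].
rewrite -(card_in_imset hinj) (leq_trans (max_card _))//.
rewrite card_dep_ffun foldrE big_map big_enum /=.
by under eq_bigr do rewrite card_ord.
Qed.

Lemma modn_window (a b k : nat) (w : R) : 0 <= w -> k = (Num.trunc w).+1 ->
  `|a%:R - b%:R| <= w -> a = b %[mod k] -> a = b.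
Proof.
move=> w0 kE; wlog ab : a b / (a <= b)%N.
  move=> H hw hm; case: (leqP a b) => [ab|/ltnW ba]; first exact: H.
  by apply/esym/H => //; rewrite distrC.
move=> hw hm; have : (k %| b - a)%N by rewrite -eqn_mod_dvd//; apply/eqP.
have bk : (b - a < k)%N.
  rewrite kE ltnS truncn_ge_nat// natrB//.
  by rewrite (le_trans _ hw)// distrC ler_norm.
case: (posnP (b - a)) => [/eqP|ba0 /(dvdn_leq ba0)].
  by rewrite subn_eq0 => ba _; apply/eqP; rewrite eqn_leq ab.
by rewrite leqNgt bk.
Qed.

Lemma trunc_window (w : R) : 0 <= w -> (Num.trunc w).+1%:R <= w + 1.
Proof. by move=> w0; rewrite -natr1 lerD2r truncn_le. Qed.

Lemma card_box (d n : nat) (S : pred {ffun 'I_d -> 'I_n}) (al w : 'I_d -> R) :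
  (forall j, 0 <= w j) ->
  (forall f, S f -> forall j, al j <= (f j : nat)%:R <= al j + w j) ->
  #|S|%:R <= \prod_j (w j + 1).
Proof.
move=> w0 Sw.
apply: (@le_trans _ _ (\prod_j (Num.trunc (w j)).+1)%N%:R).
  rewrite ler_nat; apply: card_mod_inj => // f g Sf Sg fg.
  apply/ffunP => j; apply/val_inj/(modn_window (w0 j) erefl _ (fg j)).
  have /andP[? ?] := Sw f Sf j; have /andP[? ?] := Sw g Sg j.
  by rewrite ler_norml; lra.
rewrite natr_prod; apply: ler_prod => j _.
by rewrite ler0n trunc_window.
Qed.

(** Two points of [S] that agree in all coordinates but [j0] have [j0]-th
    coordinates at distance at most [w / `|s j0|]; the other coordinates are free,
    which is the modulus [n] in [card_mod_inj]. *)
Lemma card_slab (d n : nat) (S : pred {ffun 'I_d -> 'I_n}) (s : 'I_d -> R) (j0 : 'I_d)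
    (al w : R) : 0 <= w -> s j0 != 0 ->
  (forall f, S f -> al <= \sum_j s j * (f j : nat)%:R <= al + w) ->
  #|S|%:R <= (w / `|s j0| + 1) * n%:R ^+ d.-1.
Proof.
move=> w0 sj0 Sw.
have v0 : 0 <= w / `|s j0| by rewrite divr_ge0.
have [n0|n0] := posnP n.
  rewrite (_ : #|S| = 0%N) ?mulr_ge0 ?exprn_ge0 ?addr_ge0//.
  by apply: eq_card0 => f; exfalso; have := leq_trans (ltn_ord (f j0)) (eq_leq n0).
pose mm j := if j == j0 then (Num.trunc (w / `|s j0|)).+1 else n.
apply: (@le_trans _ _ (\prod_j mm j)%N%:R).
  rewrite ler_nat; apply: card_mod_inj => [j|f g Sf Sg fg].
    by rewrite /mm; case: ifP.
  have fgj j : j != j0 -> f j = g j.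
    move=> jj0; apply/val_inj; have := fg j; rewrite /mm (negbTE jj0).
    by rewrite !modn_small.
  apply/ffunP => j; have [->|/fgj//] := eqVneq j j0.
  apply/val_inj/(modn_window v0 (k := mm j0)) => //; first by rewrite /mm eqxx.
  have /andP[a1 a2] := Sw f Sf; have /andP[b1 b2] := Sw g Sg.
  rewrite ler_pdivlMr ?normr_gt0// -normrM.
  have -> : ((f j0 : nat)%:R - (g j0 : nat)%:R) * s j0 =
     \sum_j s j * (f j : nat)%:R - \sum_j s j * (g j : nat)%:R.
    rewrite -sumrB (bigD1 j0)//= big1 ?addr0; first by rewrite -mulrBr mulrC.
    by move=> i /fgj ->; rewrite subrr.
  by rewrite ler_norml; lra.
  exact: fg.
rewrite natr_prod (bigD1 j0)//= /mm eqxx ler_pM//; first exact: prodr_ge0.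
  exact: trunc_window.
rewrite (eq_bigr (fun=> n%:R)); last by move=> j /negbTE ->.
by rewrite prodr_const cardC1 card_ord.
Qed.

(** Jordan content zero, with equal cubes given by their centers and their half
    side [r]. *)
Definition content_zero (d : nat) (B : set 'rV[R]_d) :=
  forall e : R, 0 < e -> exists (cs : seq 'rV[R]_d) (r : R),
  [/\ 0 < r, (size cs)%:R * (2 * r) ^+ d <= e &
      forall y, B y -> exists2 c, c \in cs & forall j, `|y 0 j - c 0 j| <= r].

Lemma cube_grid (m N : nat) (x : 'rV[R]_m) : @unit_cube R m x ->
  exists g : {ffun 'I_m -> 'I_N.+1},
    forall j, `|x 0 j - (g j : nat)%:R / N.+1%:R| <= N.+1%:R^-1.
Proof.
move=> xc; exists [ffun j => inord (minn (Num.trunc (N.+1%:R * x 0 j)) N)] => j.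
rewrite ffunE inordK; last by rewrite ltnS geq_minr.
have /andP[x0 x1] := xc j.
have N0 : 0 < N.+1%:R :> R by [].
have Nx0 : 0 <= N.+1%:R * x 0 j by rewrite mulr_ge0.
have /andP[t1 t2] := truncn_itv Nx0.
have redN (t : nat) : `|N.+1%:R * x 0 j - t%:R| <= 1 ->
    `|x 0 j - t%:R / N.+1%:R| <= N.+1%:R^-1.
  move=> h; have -> : x 0 j - t%:R / N.+1%:R = (N.+1%:R * x 0 j - t%:R) / N.+1%:R.
    by rewrite mulrBl mulrAC mulfV ?gt_eqF// mul1r.
  by rewrite normrM normfV (ger0_norm (ltW N0)) ler_piMl// invr_ge0 ltW.
apply: redN.
have y1 : N.+1%:R * x 0 j <= N.+1%:R by rewrite ler_piMr.
set y := N.+1%:R * x 0 j in t1 t2 y1 *.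
rewrite -(natr1 (Num.trunc y)) in t2.
case: leqP => h; first by rewrite ler_norml; lra.
have : N.+1%:R <= (Num.trunc y)%:R :> R by rewrite ler_nat.
by rewrite -(natr1 N) in y1 * => ?; rewrite ler_norml; lra.
Qed.

(** A grid of step [1/N] on the unit cube of dimension [d - 1] has [O(N^(d-1))]
    points, and their images are the centers of cubes of side [O(1/N)] that cover
    the boundary: the total volume is [O(1/N)]. *)
Lemma psb_content_zero (d : nat) (A : set 'rV[R]_d) : (0 < d)%N ->
  piecewise_smooth_boundary A -> content_zero (closure A `\` interior A).
Proof.
move=> d0 [n [f [fC1 ->]]] e e0.
have /choice[Li HL] : forall i, exists L : R, 0 <= L /\
    forall x y (e : R), @unit_cube R _ x -> @unit_cube R _ y ->
    (forall i, `|x 0 i - y 0 i| <= e) -> forall j, `|f i x 0 j - f i y 0 j| <= L * e.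
  by move=> i; have [L L0 HL] := C1_lip (fC1 i); exists L.
pose L := 1 + \sum_i Li i.
have L0 : 0 < L by rewrite ltr_pwDl// sumr_ge0// => i _; have [] := HL i.
have LiL i : Li i <= L.
  rewrite /L (bigD1 i)//= addrCA lerDl addr_ge0// sumr_ge0// => k _.
  by have [] := HL k.
pose N := Num.trunc (n%:R * (2 * L) ^+ d / e).
have N0 : 0 < N.+1%:R :> R by [].
exists [seq f i (\row_j (((g : {ffun 'I_d.-1 -> 'I_N.+1}) j : nat)%:R / N.+1%:R)) |
  i <- enum 'I_n, g <- enum {ffun 'I_d.-1 -> 'I_N.+1}], (L / N.+1%:R).
split; first by rewrite divr_gt0.
  rewrite size_allpairs -!cardE card_ord card_ffun !card_ord natrM natrX.
  have -> : (2 * (L / N.+1%:R)) ^+ d =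
      (2 * L) ^+ d / (N.+1%:R ^+ d.-1 * N.+1%:R).
    by rewrite mulrA expr_div_n -exprSr (prednK d0).
  have -> : n%:R * N.+1%:R ^+ d.-1 * ((2 * L) ^+ d / (N.+1%:R ^+ d.-1 * N.+1%:R))
      = n%:R * (2 * L) ^+ d / N.+1%:R.
    by field; rewrite gt_eqF//= addrC natr1 expf_neq0// ?gt_eqF.
  rewrite ler_pdivrMr// [e * _]mulrC -ler_pdivrMr//.
  by apply/ltW; exact: truncnS_gt.
move=> y [i _ [x xc <-]].
have [g xg] := @cube_grid _ N x xc.
exists (f i (\row_j ((g j : nat)%:R / N.+1%:R))).
  apply/allpairsP; exists (i, g) => /=; split=> //; by rewrite mem_enum.
move=> j; have [Li0 /(_ x (\row_j ((g j : nat)%:R / N.+1%:R)) N.+1%:R^-1)] := HL i.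
move=> H; apply: (le_trans (H _ _ _ j)) => //.
- move=> k; rewrite mxE divr_ge0//= ler_pdivrMr// mul1r ler_nat.
  by rewrite ltnW.
- by move=> k; rewrite mxE.
- by rewrite ler_pM2r// invr_gt0.
Qed.

End lattice_counting.

(** * Lattice points and Lebesgue outer measure *)

Section lattice_volume.
Context (R : realType) (d : nat).
Hypothesis d0 : (0 < d)%N.
Implicit Types A : set 'rV[R]_d.

Definition lattice_pt (n : nat) (f : {ffun 'I_d -> 'I_n}) : idx d :=
  [ffun j => (f j : nat)].

(** The bound [B * M] on the coordinates makes the count finite; it loses nothing
    when [A] lies in the box [0, B]^d. *)
Definition lattice_count (B : nat) A (M : nat) : nat :=
  #|[pred f : {ffun 'I_d -> 'I_(B * M).+1} | `[< A (scaled R M (lattice_pt f)) >]]|.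

Lemma scaledE n (f : {ffun 'I_d -> 'I_n}) M j :
  scaled R M (lattice_pt f) 0 j = (f j : nat)%:R / M%:R.
Proof. by rewrite mxE ffunE. Qed.

Lemma card_cover (U : finType) (I : eqType) (s : seq I) (S : pred U)
    (Q : I -> pred U) :
  (forall f, S f -> exists2 i, i \in s & Q i f) ->
  (#|S| <= \sum_(i <- s) #|Q i|)%N.
Proof.
move=> SQ; rewrite -sum1_card.
rewrite (eq_bigr (fun i => \sum_(f in Q i) 1)%N); last first.
  by move=> i _; rewrite sum1_card.
rewrite (exchange_big_dep predT)//= [leqRHS](bigID S) /=.
apply: leq_trans (leq_addr _ _); apply: leq_sum => f Sf.
have [i si Qi] := SQ f Sf.
by rewrite (big_rem i)//= ifT.
Qed.

(** A closed interval of length [l] contains at most [M * l + 1] multiples of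
    [M^-1]. *)
Lemma count_le_boxes (B M : nat) A (bs : seq ('rV[R]_d * 'rV[R]_d)) : (0 < M)%N ->
  (forall b j, b \in bs -> b.1 0 j <= b.2 0 j) ->
  (forall y, A y -> exists2 b, b \in bs & forall j, b.1 0 j <= y 0 j <= b.2 0 j) ->
  (lattice_count B A M)%:R / M%:R ^+ d <=
    \sum_(b <- bs) \prod_(j < d) (b.2 0 j - b.1 0 j + M%:R^-1).
Proof.
move=> M0 b12 Abs; have M0' : 0 < M%:R :> R by rewrite ltr0n.
pose Q (b : 'rV[R]_d * 'rV[R]_d) : pred {ffun 'I_d -> 'I_(B * M).+1} :=
  fun f => [forall j, b.1 0 j <= (f j : nat)%:R / M%:R <= b.2 0 j].
rewrite ler_pdivrMr ?exprn_gt0// mulr_suml.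
apply: (@le_trans _ _ (\sum_(b <- bs) #|Q b|)%N%:R).
  rewrite ler_nat; apply: card_cover => f /asboolP /Abs[b bsb bf].
  by exists b => //; apply/forallP => j; rewrite -scaledE.
rewrite natr_sum big_seq [leRHS]big_seq; apply: ler_sum => b bsb.
have -> : M%:R ^+ d = \prod_(j < d) (M%:R : R) by rewrite prodr_const card_ord.
rewrite -big_split /=.
apply: le_trans (_ : _ <= \prod_j (M%:R * (b.2 0 j - b.1 0 j) + 1)) _.
  apply: (@card_box _ _ _ _ (fun j => M%:R * b.1 0 j)).
    by move=> j; rewrite mulr_ge0// subr_ge0 b12.
  move=> f /forallP Qf j; have := Qf j.
  by rewrite ler_pdivlMr// ler_pdivrMr// => /andP[? ?]; lra.
rewrite le_eqVlt; apply/orP; left; apply/eqP; apply: eq_bigr => j _.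
by rewrite mulrDl mulVf ?gt_eqF// [_ * M%:R]mulrC.
Qed.

Lemma leb_ge0 A : (0 <= leb A)%E.
Proof.
apply: le_ereal_inf_tmp => x [a [b [ab _ ->]]].
apply: nneseries_ge0 => k _ _.
by rewrite lee_fin prodr_ge0// => j _; rewrite subr_ge0.
Qed.

(** A finite cover is completed to a countable one by empty boxes, which have
    volume [0] because [d > 0]. *)
Lemma leb_le_boxes A (s : seq ('rV[R]_d * 'rV[R]_d)) :
  (forall b j, b \in s -> b.1 0 j <= b.2 0 j) ->
  (forall y, A y -> exists2 b, b \in s & forall j, b.1 0 j < y 0 j <= b.2 0 j) ->
  (leb A <= (\sum_(b <- s) \prod_(j < d) (b.2 0 j - b.1 0 j))%:E)%E.
Proof.
move=> s12 As; apply: ereal_inf_lbound.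
pose z : 'rV[R]_d * 'rV[R]_d := (0, 0).
exists (fun k => (nth z s k).1), (fun k => (nth z s k).2).
have tail k : (size s <= k)%N -> nth z s k = z by move=> ?; rewrite nth_default.
have ab k j : (nth z s k).1 0 j <= (nth z s k).2 0 j.
  have [/tail ->//|ks] := leqP (size s) k.
  by apply: s12; rewrite mem_nth.
split=> //.
  move=> y Ay; have [b bs yb] := As y Ay.
  by exists (index b s) => //= j; rewrite nth_index.
rewrite (nneseries_split 0 (size s)); last first.
  by move=> k _; rewrite lee_fin prodr_ge0// => j _; rewrite subr_ge0.
rewrite add0n [X in (_ + X)%E]eseries0 ?adde0; last first.
  move=> i si _; rewrite tail//=.
  by rewrite (bigD1 (Ordinal d0))//= !mxE subrr mul0r.
by rewrite (big_nth z) sumEFin.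
Qed.

Lemma nat_ceil (x : R) (n : nat) : 0 <= x <= n%:R ->
  exists2 t : nat, (t <= n)%N & t%:R - 1 < x <= t%:R.
Proof.
move=> /andP[x0 xn].
have ex : exists t : nat, x <= t%:R by exists n.
case: (ex_minnP ex) => t xt tmin; exists t; first exact: tmin.
rewrite xt andbT; case: t xt tmin => [_ _|t xt tmin].
  by rewrite sub0r; lra.
rewrite -natr1 addrK ltNge; apply/negP => /tmin.
by rewrite ltnn.
Qed.

(** Otherwise the points of [A] would form a nonempty open and closed subset of the
    segment from [y] to [z]. *)
Lemma boundary_cross A (y z : 'rV[R]_d) : A y -> ~ A z ->
  exists2 s : R, 0 <= s <= 1 & (closure A `\` interior A) (y + s *: (z - y)).
Proof.
move=> Ay nAz; apply: contrapT => nb.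
pose g (s : R) := y + s *: (z - y).
have cg : continuous g.
  move=> s; apply: cvgD; first exact: cvg_cst.
  by apply: cvgZr_tmp; exact: cvg_id.
have gint s : `[0, 1]%classic s -> closure A (g s) -> interior A (g s).
  rewrite /= in_itv /= => s01 cs; apply: contrapT => ni.
  by apply: nb; exists s.
pose B := `[0, 1]%classic `&` (g @^-1` A).
have c01 := @segment_connected R 0 1.
have : B = `[0, 1]%classic.
  apply: c01.
  - exists 0; split; first by rewrite /= in_itv /= lexx ler01.
    by rewrite /g /preimage /= scale0r addr0.
  - exists (g @^-1` (interior A)).
      by apply: open_comp; [move=> s _; exact: cg|exact: open_interior].
    apply/seteqP; split=> s [s01 h]; split=> //.
      by apply: gint => //; exact: subset_closure.
    exact: interior_subset h.
  - exists (g @^-1` (closure A)).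
      by apply: closed_comp; [move=> s _; exact: cg|exact: closed_closure].
    apply/seteqP; split=> s [s01 h]; split=> //.
      exact: subset_closure.
    exact: interior_subset (gint _ s01 h).
move=> /seteqP[_ /(_ 1)]; rewrite /B /= in_itv /= lexx ler01 => /(_ isT)[_].
by rewrite /g scale1r addrC subrK.
Qed.

(** Cover [A] by the half-open cells of side [1/M] that meet it.  The upper corner of
    such a cell is a lattice point of [A], or else the cell is crossed by the
    boundary and this corner is close to one of the cubes that cover the boundary. *)
Lemma leb_le_count (B M : nat) A (cs : seq 'rV[R]_d) (r : R) : (0 < M)%N -> 0 < r ->
  (forall x j, A x -> 0 <= x 0 j <= B%:R) ->
  (forall y, (closure A `\` interior A) y ->
     exists2 c, c \in cs & forall j, `|y 0 j - c 0 j| <= r) ->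
  (leb A <= ((lattice_count B A M)%:R / M%:R ^+ d +
             (size cs)%:R * (2 * r + 3 * M%:R^-1) ^+ d)%:E)%E.
Proof.
move=> M0 r0 AB csA; have M0' : 0 < M%:R :> R by rewrite ltr0n.
have Mn0 : M%:R != 0 :> R by rewrite gt_eqF.
pose U := {ffun 'I_d -> 'I_(B * M).+1}.
pose cell (f : U) (y : 'rV[R]_d) := forall j,
  ((f j : nat)%:R - 1) / M%:R < y 0 j <= (f j : nat)%:R / M%:R.
pose S : pred U := fun f => `[< exists2 y, A y & cell f y >].
pose bx (f : U) : 'rV[R]_d * 'rV[R]_d :=
  (\row_j (((f j : nat)%:R - 1) / M%:R), \row_j ((f j : nat)%:R / M%:R)).
have bxw f j : (bx f).2 0 j - (bx f).1 0 j = M%:R^-1.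
  by rewrite !mxE -mulrBl; rewrite opprB addrC subrK mul1r.
pose Qc (c : 'rV[R]_d) : pred U := fun f =>
  [forall j, M%:R * (c 0 j - r) - 1 <= (f j : nat)%:R <=
      M%:R * (c 0 j - r) - 1 + (2 * (M%:R * r) + 2)].
have Sbound : (#|S| <= lattice_count B A M +
    \sum_(c <- cs) #|Qc c|)%N.
  pose Sin : pred U := fun f => `[< A (scaled R M (lattice_pt f)) >].
  rewrite -(cardID Sin S); apply: leq_add.
    apply: (@subset_leq_card U [predI S & Sin] Sin).
    by apply/fintype.subsetP => f /andP[].
  apply: card_cover => f; rewrite !inE => /andP[nin /asboolP[y Ay yf]].
  have nA : ~ A (scaled R M (lattice_pt f)) by move=> h; move/negP: nin; apply; apply/asboolP.
  have [s /andP[s0 s1] bs] := boundary_cross Ay nA.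
  have [c ccs cr] := csA _ bs.
  exists c => //; apply/forallP => j.
  have := cr j; rewrite !mxE ffunE.
  set t := (f j : nat)%:R.
  have /andP[y1 y2] := yf j; rewrite -/t in y1 y2.
  have {}y1 : t - 1 < M%:R * y 0 j by rewrite mulrC -ltr_pdivrMr.
  have {}y2 : M%:R * y 0 j <= t by rewrite mulrC -ler_pdivlMr.
  rewrite -(ler_pM2l M0') -{1}(ger0_norm (ltW M0')) -normrM.
  have -> : M%:R * (y 0 j + s * (t / M%:R - y 0 j) - c 0 j) =
     (1 - s) * (M%:R * y 0 j) + s * t - M%:R * c 0 j by field.
  rewrite ler_norml => /andP[h1 h2].
  by apply/andP; split; nra.
have leb1 : (leb A <= (#|S|%:R / M%:R ^+ d)%:E)%E.
  have -> : #|S|%:R / M%:R ^+ d =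
      \sum_(b <- [seq bx f | f <- enum S]) \prod_(j < d) (b.2 0 j - b.1 0 j).
    rewrite big_map big_enum /=.
    under eq_bigr do under eq_bigr do rewrite bxw.
    by rewrite sumr_const prodr_const card_ord exprVn mulr_natl.
  apply: leb_le_boxes.
    by move=> b j /mapP[f _ ->]; rewrite -subr_ge0 bxw invr_ge0 ltW.
  move=> y Ay.
  have /choice[t Ht] : forall j, exists t : nat, (t <= B * M)%N /\
      t%:R - 1 < M%:R * y 0 j <= t%:R.
    move=> j; have /andP[y0 yB] := AB y j Ay.
    have [|t tB Ht] := @nat_ceil (M%:R * y 0 j) (B * M); last by exists t.
    apply/andP; split; first by rewrite mulr_ge0// ltW.
    by rewrite natrM mulrC ler_pM2r.
  pose f : U := [ffun j => inord (t j)].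
  have fy : cell f y.
    move=> j; rewrite ffunE inordK ?ltnS; last by case: (Ht j).
    by rewrite ltr_pdivrMr// ler_pdivlMr// [y 0 j * _]mulrC; case: (Ht j).
  exists (bx f); last by move=> j; rewrite !mxE; exact: fy.
  by apply: map_f; rewrite mem_enum; apply/asboolP; exists y.
apply: le_trans leb1 _; rewrite lee_fin ler_pdivrMr ?exprn_gt0// mulrDl divfK ?expf_neq0//.
apply: le_trans (_ : _ <= (lattice_count B A M +
    \sum_(c <- cs) #|Qc c|)%N%:R) _.
  by rewrite ler_nat.
rewrite natrD lerD2l natr_sum -mulrA -exprMn.
apply: le_trans (_ : _ <= \sum_(c <- cs) ((2 * r + 3 * M%:R^-1) * M%:R) ^+ d) _.
  apply: ler_sum => c _.
  have -> : ((2 * r + 3 * M%:R^-1) * M%:R) ^+ d =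
      \prod_(j < d) (2 * (M%:R * r) + 2 + 1 : R).
    by rewrite prodr_const card_ord; congr (_ ^+ _); field.
  apply: (card_box (al := fun j => M%:R * (c 0 j - r) - 1)).
    by move=> j; rewrite addr_ge0// mulr_ge0// mulr_ge0// ltW.
  by move=> f /forallP.
by rewrite big_const_seq count_predT iter_addr_0 -[leLHS]mulr_natl.
Qed.

End lattice_volume.

Section volume_limit.
Context (R : realType) (d : nat).
Hypothesis d0 : (0 < d)%N.
Implicit Types A : set 'rV[R]_d.

Lemma enlarge (l : 'I_d -> R) (e : R) : 0 < e ->
  exists2 x : R, 0 < x & \prod_j (l j + 2 * x) <= \prod_j l j + e.
Proof.
move=> e0.
have H : \prod_j (l j + 2 * harmonic n) @[n --> \oo] --> \prod_j l j.
  apply: cvgr_prod_seq => j; rewrite -[X in _ --> X]addr0.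
  apply: cvgD; first exact: cvg_cst.
  by rewrite -(mulr0 2); apply: cvgM; [exact: cvg_cst|exact: cvg_harmonic].
move/cvgrPdist_le : H => /(_ _ e0) [n _ /(_ n (leqnn n))].
rewrite distrC => /ler_normlP[_ h].
by exists (harmonic n); [rewrite /harmonic/= invr_gt0|rewrite -lerBlDl].
Qed.

Lemma open_box (a b : 'rV[R]_d) : open [set y : 'rV[R]_d | forall j, a 0 j < y 0 j < b 0 j].
Proof.
rewrite openE => y /= yab.
suff : nbhs y (fun z : 'rV[R]_d => forall j, a 0 j < z 0 j < b 0 j) by [].
apply: (@filter_forall _ _ (fun j (z : 'rV[R]_d) => a 0 j < z 0 j < b 0 j) _
  (nbhs_filter y)) => j.
have /andP[ay yb] := yab j.
have cj := @coord_continuous R 1 d 0 j y.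
have : \forall z \near (y 0 j : R), a 0 j < z < b 0 j.
  have : nbhs (y 0 j) `]a 0 j, b 0 j[%classic.
    by apply: open_nbhs_nbhs; split; [exact: interval_open|rewrite /= in_itv /= ay].
  by apply: filterS => z /=; rewrite in_itv.
by move=> /cj.
Qed.

Lemma compact_closure_box A (B : nat) :
  (forall x j, A x -> 0 <= x 0 j <= B%:R) -> compact (closure A).
Proof.
move=> AB.
have cB : compact [set v : 'rV[R]_d | forall i, (v ord0 i : R) \in `[0, B%:R]].
  have := @rV_compact R d (fun=> `[0, B%:R]%classic) (fun=> @segment_compact R 0 B%:R).
  exact.
apply: (subclosed_compact _ cB); first exact: closed_closure.
have /closure_id -> := compact_closed (@norm_hausdorff _ _) cB.
by apply: closure_subset => x Ax j; rewrite in_itv /=; exact: AB.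
Qed.

Lemma geo_partial (e : R) (n : nat) : 0 < e -> \sum_(k < n) e / (2 ^+ k.+1) <= e.
Proof.
move=> e0; suff -> : \sum_(k < n) e / (2 ^+ k.+1) = e - e / 2 ^+ n.
  by rewrite lerBlDr lerDl divr_ge0 ?ltW// exprn_gt0.
elim: n => [|n IH]; first by rewrite big_ord0 expr0 divr1 subrr.
by rewrite big_ord_recr /= IH exprS; field; rewrite expf_neq0.
Qed.

(** A countable cover of [A] by half-open boxes which is almost optimal, slightly
    enlarged to open boxes, together with small open cubes around the boundary,
    covers the compact closure of [A]; a finite subcover has almost the volume of
    the cover. *)
Lemma outer_cover A (B : nat) (e : R) : 0 < e ->
  (forall x j, A x -> 0 <= x 0 j <= B%:R) ->
  content_zero (closure A `\` interior A) -> leb A \is a fin_num ->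
  exists bs : seq ('rV[R]_d * 'rV[R]_d),
  [/\ forall b j, b \in bs -> b.1 0 j <= b.2 0 j,
      forall y, A y -> exists2 b, b \in bs & forall j, b.1 0 j <= y 0 j <= b.2 0 j &
      \sum_(b <- bs) \prod_(j < d) (b.2 0 j - b.1 0 j) <= fine (leb A) + e].
Proof.
move=> e0 AB cz fA.
have e3 : 0 < e / 3 by rewrite divr_gt0.
(* The half sides of the cubes are doubled below to make them open, which
   multiplies their volume by [2 ^+ d]. *)
have [cs [r [r0 crs csA]]] := cz (e / 3 / 2 ^+ d) (divr_gt0 e3 (exprn_gt0 _ (ltr0n R 2))).
have [_ [a [b [ab Aab ->]]] labe] := lb_ereal_inf_adherent e3 fA.
have vol0 k : 0 <= \prod_(j < d) (b k 0 j - a k 0 j).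
  by rewrite prodr_ge0// => j _; rewrite subr_ge0.
have ek0 k : 0 < e / 3 / 2 ^+ k.+1 by rewrite divr_gt0.
have /choice[x Hx] : forall k, exists x : R, 0 < x /\
    \prod_j (b k 0 j - a k 0 j + 2 * x) <= \prod_j (b k 0 j - a k 0 j) + e / 3 / 2 ^+ k.+1.
  by move=> k; have [x x0 Hx] := enlarge (fun j => b k 0 j - a k 0 j) (ek0 k); exists x.
pose cube (c : 'rV[R]_d) : 'rV[R]_d * 'rV[R]_d :=
  (\row_j (c 0 j - 2 * r), \row_j (c 0 j + 2 * r)).
pose big k : 'rV[R]_d * 'rV[R]_d :=
  (\row_j (a k 0 j - x k), \row_j (b k 0 j + x k)).
pose opn (p : 'rV[R]_d * 'rV[R]_d) := [set y : 'rV[R]_d | forall j, p.1 0 j < y 0 j < p.2 0 j].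
pose f (k : nat) : set 'rV[R]_d :=
  if k is k'.+1 then opn (big k') else \bigcup_(c in [set` cs]) opn (cube c).
have fo k : setT k -> open (f k).
  case: k => [|k] _; last exact: open_box.
  by apply: bigcup_open => c _; exact: open_box.
have := compact_closure_box AB; rewrite compact_cover => cA.
have [y Ay|D _ AD] := cA nat setT f fo.
  have [iy|ny] := pselect (interior A y).
    have [k _ yk] := Aab _ (interior_subset iy).
    exists k.+1 => // j; rewrite !mxE.
    by have /andP[? ?] := yk j; have [? _] := Hx k; apply/andP; split; lra.
  have [|c cc yc] := csA y; first by split.
  exists 0%N => //; exists c => //= j; rewrite !mxE.
  by have := yc j; rewrite ler_norml => /andP[? ?]; apply/andP; split; lra.
pose n := \max_(i <- D) i.
exists ([seq cube c | c <- cs] ++ [seq big k | k <- iota 0 n]); split.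
- move=> p j; rewrite mem_cat => /orP[] /mapP[k _ ->]; rewrite !mxE; first by lra.
  by have [? _] := Hx k; have := ab k j; lra.
- move=> y /subset_closure /AD[k kD] fk.
  have weak p : opn p y -> forall j, p.1 0 j <= y 0 j <= p.2 0 j.
    by move=> py j; have /andP[h1 h2] := py j; rewrite !ltW.
  case: k kD fk => [_ [c cc]|k kD] /weak yp.
    by exists (cube c) => //; rewrite mem_cat map_f.
  exists (big k) => //; rewrite mem_cat (map_f big) ?orbT//.
  by rewrite mem_iota /= add0n; apply: (@leq_bigmax_seq _ _ xpredT id k.+1).
- rewrite big_cat /= !big_map.
  have -> : \sum_(c <- cs) \prod_(j < d) ((cube c).2 0 j - (cube c).1 0 j) =
      (size cs)%:R * (2 * r) ^+ d * 2 ^+ d.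
    rewrite (eq_bigr (fun=> (2 * r) ^+ d * 2 ^+ d)); last first.
      move=> c _; rewrite (eq_bigr (fun=> 2 * r * 2)) ?prodr_const ?card_ord ?exprMn//.
      by move=> j _; rewrite !mxE; ring.
    by rewrite big_const_seq count_predT iter_addr_0 -[LHS]mulr_natl mulrA.
  have h1 : (size cs)%:R * (2 * r) ^+ d * 2 ^+ d <= e / 3.
    by rewrite -ler_pdivlMr// exprn_gt0.
  have h2 : \sum_(k <- iota 0 n) \prod_(j < d) ((big k).2 0 j - (big k).1 0 j) <=
     \sum_(k < n) \prod_(j < d) (b k 0 j - a k 0 j) + \sum_(k < n) (e / 3 / 2 ^+ k.+1).
    rewrite -big_split /= -(big_mkord xpredT (fun k : nat =>
      \prod_(j < d) (b k 0 j - a k 0 j) + e / 3 / 2 ^+ k.+1)) /=.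
    rewrite /index_iota subn0; apply: ler_sum => k _.
    apply: le_trans (Hx k).2; rewrite le_eqVlt; apply/orP; left; apply/eqP.
    by apply: eq_bigr => j _; rewrite !mxE; ring.
  have h3 := geo_partial n e3.
  have h4 : \sum_(k < n) \prod_(j < d) (b k 0 j - a k 0 j) <= fine (leb A) + e / 3.
    rewrite -lee_fin EFinD fineK//; apply: le_trans (ltW labe).
    rewrite -sumEFin -(big_mkord xpredT (fun k : nat => (\prod_(j < d) (b k 0 j - a k 0 j))%:E)).
    by apply: nneseries_lim_ge => k _ _; rewrite lee_fin.
  by lra.
Qed.

(** [count_le_boxes], applied to the finite cover of [outer_cover], bounds the count
    from above; [leb_le_count] bounds it from below. *)
Lemma lattice_count_cvg A (B : nat) :
  (forall x j, A x -> 0 <= x 0 j <= B%:R) -> piecewise_smooth_boundary A ->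
  leb A \is a fin_num /\
  (lattice_count B A n.+1)%:R / n.+1%:R ^+ d @[n --> \oo] --> fine (leb A).
Proof.
move=> AB pA; have cz := psb_content_zero d0 pA.
have fA : leb A \is a fin_num.
  have [cs [r [r0 _ csA]]] := cz 1 ltr01.
  rewrite ge0_fin_numE; last exact: leb_ge0.
  apply: le_lt_trans (leb_le_count d0 (isT : (0 < 1)%N) r0 AB csA) _.
  by rewrite ltry.
split=> //; apply/cvgrPdist_le => e e0.
have e2 : 0 < e / 2 by rewrite divr_gt0.
have [bs [b12 bsA bsv]] := outer_cover e2 AB cz fA.
have [cs [r [r0 csr csA]]] := cz _ e2.
have H1 : \sum_(b <- bs) \prod_(j < d) (b.2 0 j - b.1 0 j + n.+1%:R^-1) @[n --> \oo]
    --> \sum_(b <- bs) \prod_(j < d) (b.2 0 j - b.1 0 j).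
  apply: cvgr_sum_seq => b; apply: cvgr_prod_seq => j.
  rewrite -[X in _ --> X]addr0.
  by apply: cvgD; [exact: cvg_cst|exact: cvg_harmonic].
have H2 : (size cs)%:R * (2 * r + 3 * n.+1%:R^-1) ^+ d @[n --> \oo]
    --> (size cs)%:R * (2 * r) ^+ d.
  apply: cvgM; first exact: cvg_cst.
  have -> : (2 * r) ^+ d = \prod_(j < d) (2 * r) by rewrite prodr_const card_ord.
  under eq_fun do rewrite -[X in _ ^+ X](card_ord d) -prodr_const.
  apply: cvgr_prod_seq => j; rewrite -[X in _ --> X]addr0.
  apply: cvgD; first exact: cvg_cst.
  by rewrite -(mulr0 3); apply: cvgM; [exact: cvg_cst|exact: cvg_harmonic].
near=> n.
have n0 : (0 < n.+1)%N by [].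
have u := @count_le_boxes R d B n.+1 A bs n0 b12 bsA.
have l := @leb_le_count R d d0 B n.+1 A cs r n0 r0 AB csA.
rewrite -(fineK fA) lee_fin in l.
have E1 : `|\sum_(b <- bs) \prod_(j < d) (b.2 0 j - b.1 0 j) -
  \sum_(b <- bs) \prod_(j < d) (b.2 0 j - b.1 0 j + n.+1%:R^-1)| <= e / 2.
  by near: n; move/cvgrPdist_le : H1; apply.
have E2 : `|(size cs)%:R * (2 * r) ^+ d -
    (size cs)%:R * (2 * r + 3 * n.+1%:R^-1) ^+ d| <= e / 2.
  by near: n; move/cvgrPdist_le : H2; apply.
move: E1 E2 u l bsv csr.
rewrite !ler_norml => /andP[? ?] /andP[? ?] ? ? ? ?.
by apply/andP; split; lra.
Unshelve. all: by end_near. Qed.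

End volume_limit.

(** * Levels of the linear form *)

Section levels.
Context (R : realType) (d : nat) (P : set 'rV[R]_d) (s : 'I_d -> R).

Definition lin (x : 'rV[R]_d) : R := \sum_(j < d) s j * x 0 j.

Definition linN (t : idx d) : R := \sum_(j < d) s j * (t j)%:R.

Lemma lin_scaled M t : (0 < M)%N -> M%:R * lin (scaled R M t) = linN t.
Proof.
move=> M0; rewrite mulr_sumr; apply: eq_bigr => j _; rewrite mxE.
by field; rewrite pnatr_eq0 -lt0n.
Qed.

Lemma continuous_lin : continuous lin.
Proof.
move=> x; apply: (@cvgr_sum_seq R _ _ _ (nbhs_filter x)) => j.
by apply: cvgM; [exact: cvg_cst|exact: coord_continuous].
Qed.

Lemma orthant_box : bounded_set P -> (forall x j, P x -> 0 <= x 0 j) ->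
  exists B : nat, forall x j, P x -> 0 <= x 0 j <= B%:R.
Proof.
move=> [C [_ HC]] P0; exists (Num.trunc (`|C| + 1)).+1 => x j Px.
rewrite P0//=; apply: le_trans (ltW (truncnS_gt _)).
have : `|x| <= `|C| + 1.
  by apply: (HC (`|C| + 1)) => //; rewrite (le_lt_trans (ler_norm C))// ltrDl.
by apply: le_trans; apply: le_trans (rV_coord_le_norm x j); exact: ler_norm.
Qed.

(** The endpoints are the infimum and the supremum of the linear form, which differ
    because the domain is open and the form is not constant. *)
Lemma lin_range : open P -> P !=set0 -> bounded_set P ->
  (forall x j, P x -> 0 <= x 0 j) -> (exists j, s j != 0) ->
  exists a b : R, [/\ a < b, forall x, P x -> a <= lin x <= b &
    forall v, a < v < b -> (exists2 x, P x & lin x < v) /\ (exists2 y, P y & v < lin y)].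
Proof.
move=> oP [z Pz] bP P0 [j0 sj0].
have [B PB] := orthant_box bP P0.
have bnd x : P x -> - (\sum_j `|s j| * B%:R) <= lin x <= \sum_j `|s j| * B%:R.
  move=> Px; rewrite -ler_norml; apply: le_trans (ler_norm_sum _ _ _) _.
  apply: ler_sum => j _; rewrite normrM ler_wpM2l//.
  by have /andP[x0 xB] := PB x j Px; rewrite ger0_norm.
pose I := lin @` P.
have I0 : I !=set0 by exists (lin z); exists z.
have hi : has_inf I.
  by split=> //; exists (- (\sum_j `|s j| * B%:R)) => _ [x Px <-]; case/andP: (bnd x Px).
have hs : has_sup I.
  by split=> //; exists (\sum_j `|s j| * B%:R) => _ [x Px <-]; case/andP: (bnd x Px).
have ge_inf x : P x -> inf I <= lin x by move=> Px; apply: ge_inf; [case: hi|exists x].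
have le_sup x : P x -> lin x <= sup I by move=> Px; apply: ub_le_sup; [case: hs|exists x].
exists (inf I), (sup I); split.
- have /nbhs_ballP[r /= r0 rP] : nbhs z P by exact: open_nbhs_nbhs.
  pose z' : 'rV[R]_d := z + (r / 2 * Num.sg (s j0)) *: delta_mx 0 j0.
  have Pz' : P z'.
    apply: rP; split=> // i j; rewrite /ball /= !mxE opprD addrA subrr sub0r normrN.
    rewrite normrM [Num.norm (_ * Num.sg _)]normrM normr_sg sj0 mulr1 ger0_norm ?divr_ge0 ?ltW//.
    by case: (_ && _); rewrite /= ?mulr1n ?mulr0n ?normr1 ?normr0 ?mulr1 ?mulr0//; lra.
  apply: le_lt_trans (ge_inf _ Pz) _; apply: lt_le_trans (le_sup _ Pz').
  have -> : lin z' = lin z + r / 2 * `|s j0|.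
    rewrite /lin (bigD1 j0)//= [in RHS](bigD1 j0)//= !mxE !eqxx /= mulr1.
    rewrite (eq_bigr (fun j => s j * z 0 j)); last first.
      by move=> j jj0; rewrite !mxE eqxx (negbTE jj0) mulr0 addr0.
    by rewrite normrEsg; ring.
  by rewrite ltrDl mulr_gt0 ?divr_gt0// normr_gt0.
- by move=> x Px; rewrite ge_inf// le_sup.
- move=> v /andP[av vb]; split.
    have v0 : 0 < v - inf I by rewrite subr_gt0.
    have [_ [x Px <-] xv] := inf_adherent v0 hi.
    by exists x => //; rewrite addrC subrK in xv.
  have v0 : 0 < sup I - v by rewrite subr_gt0.
  have [_ [x Px <-] xv] := sup_adherent v0 hs.
  by exists x => //; rewrite opprB addrC subrK in xv.
Qed.

(** By connectedness the form takes the value [v] at some [z] of the domain.  The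
    integer part of [M * z] is a lattice point which, for [M] large, stays in a ball
    around [z] contained in the domain. *)
Lemma level_point v : open P -> connected P -> (forall x j, P x -> 0 <= x 0 j) ->
  (exists2 x, P x & lin x < v) -> (exists2 y, P y & v < lin y) ->
  \forall M \near \oo, exists2 t, Pi P M t & `|linN t - M%:R * v| <= \sum_j `|s j|.
Proof.
move=> oP cP P0 [x Px xv] [y Py vy].
have : connected (lin @` P).
  apply: connected_continuous_connected => //.
  by apply: continuous_subspaceT; exact: continuous_lin.
move=> /connected_intervalP /(_ (lin x) (lin y)).
move=> /(_ (ex_intro2 _ _ x Px erefl) (ex_intro2 _ _ y Py erefl) v).
rewrite (ltW xv) (ltW vy) => /(_ isT)[z Pz zv].
have /nbhs_ballP[r /= r0 rP] : nbhs z P by exact: open_nbhs_nbhs.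
exists (Num.trunc r^-1).+1 => // M /= rM.
have M0 : (0 < M)%N by apply: leq_trans rM.
have M0' : 0 < M%:R :> R by rewrite ltr0n.
have Mr : M%:R^-1 < r.
  rewrite invf_plt ?posrE//; apply: lt_le_trans (truncnS_gt _) _.
  by rewrite ler_nat.
pose t : idx d := [ffun j => Num.trunc (M%:R * z 0 j)].
have tz j : `|(t j)%:R - M%:R * z 0 j| <= 1.
  have /truncn_itv/andP[] : 0 <= M%:R * z 0 j by rewrite mulr_ge0// P0.
  rewrite ffunE -natr1; set k := (Num.trunc _)%:R => h1 h2.
  by rewrite ler_norml; lra.
exists t.
  apply: rP; split=> // i j; rewrite ord1 /ball /= !mxE.
  have -> : z 0 j - (t j)%:R / M%:R = - ((t j)%:R - M%:R * z 0 j) / M%:R.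
    by field; rewrite gt_eqF.
  rewrite normrM normfV normrN (ger0_norm (ltW M0')).
  by apply: le_lt_trans Mr; rewrite ler_piMl// invr_ge0 ltW.
rewrite -zv mulr_sumr -sumrB; apply: le_trans (ler_norm_sum _ _ _) _.
apply: ler_sum => j _; rewrite mulrCA -mulrBr normrM.
by rewrite ler_piMr.
Qed.

End levels.

(** * Limit of the generating function *)

Section generating_function.
Context (R : realType) (dO : measure_display) (Omega : measurableType dO).
Context (Pr : probability Omega R) (d : nat) (I : finType).
Context (P : set 'rV[R]_d) (s : 'I_d -> R) (j0 : 'I_d) (B : nat) (R0 : R).
Context (hit : nat -> idx d -> I -> Omega -> bool) (zone : I -> set 'rV[R]_d).
Context (mu : I -> R) (Cd C1 C3 : R).
Hypothesis sj0 : s j0 != 0.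
Hypothesis R0_gt0 : 0 < R0.
Hypothesis mu0 : forall i, 0 <= mu i.
Hypotheses (Cd0 : 0 <= Cd) (C10 : 0 <= C1) (C30 : 0 <= C3).
Hypothesis zoneP : forall i, zone i `<=` P.
Hypothesis bhit : forall M t i, (0 < M)%N ->
  bdd_meas (fun w => (hit M t i w)%:R : R).
Hypothesis excl : forall M t w i i', (0 < M)%N ->
  hit M t i w -> hit M t i' w -> i = i'.
Hypothesis hit_zone : forall M t i w, (0 < M)%N -> hit M t i w ->
  zone i (scaled R M t).

Definition loss (u : I -> R) (M : nat) (t : idx d) (w : Omega) : R :=
  \sum_i (1 - u i) * (hit M t i w)%:R.

Definition any_hit (M : nat) (t : idx d) (w : Omega) : R :=
  \sum_i (hit M t i w)%:R.

Hypothesis single : forall M t, (0 < M)%N ->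
  Ex Pr (any_hit M t) <= C1 / M%:R ^+ d.
Hypothesis pair : forall M t t', (0 < M)%N -> t != t' ->
  Ex Pr (fun w => any_hit M t w * any_hit M t' w) <= C3 / M%:R ^+ (2 * d).
Hypothesis dec : forall u M t t' i (V : seq (idx d)),
  (forall i, 0 <= u i <= 1) -> (0 < M)%N ->
  Pi P M t -> Pi P M t' -> zone i (scaled R M t) ->
  linN s t >= linN s t' + R0 * ln M%:R ->
  (forall r, r \in V -> Pi P M r /\ linN s t' > linN s r + R0 * ln M%:R) ->
  `|Ex Pr (fun w => \prod_(r <- V) (1 - loss u M r w) * (hit M t i w)%:R)
    - mu i / M%:R ^+ d * Ex Pr (fun w => \prod_(r <- V) (1 - loss u M r w))|
  <= Cd / M%:R ^+ (2 * d).

Lemma bdd_loss u M t : (0 < M)%N -> bdd_meas (loss u M t).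
Proof.
move=> M0; apply: bdd_meas_sum => i.
by apply: bdd_measM; [exact: bdd_meas_cst|exact: bhit].
Qed.

Lemma bdd_any_hit M t : (0 < M)%N -> bdd_meas (any_hit M t).
Proof. by move=> M0; apply: bdd_meas_sum => i; exact: bhit. Qed.

(** [loss] and [any_hit] are sums with at most one nonzero term. *)
Lemma one_hit M t w (g : I -> R) : (0 < M)%N ->
  (exists2 i, hit M t i w & \sum_j g j * (hit M t j w)%:R = g i /\
     (forall j, j != i -> hit M t j w = false)) \/
  (forall j, hit M t j w = false).
Proof.
move=> M0; have [[i hi]|nh] := pselect (exists i, hit M t i w); last first.
  by right => j; apply/negP => h; apply: nh; exists j.
have hj j : j != i -> hit M t j w = false.
  by move=> ji; apply/negP => h; case/eqP: ji; exact: excl h hi.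
left; exists i => //; split=> //.
rewrite (bigD1 i)//= hi mulr1 big1 ?addr0// => j ji.
by rewrite hj// mulr0.
Qed.

Lemma loss_le_any u M t w : (forall i, 0 <= u i <= 1) -> (0 < M)%N ->
  0 <= loss u M t w <= any_hit M t w.
Proof.
move=> u01 M0; apply/andP; split.
  by apply: sumr_ge0 => i _; have /andP[_ ?] := u01 i; rewrite mulr_ge0// subr_ge0.
apply: ler_sum => i _; have /andP[? _] := u01 i.
by rewrite ler_piMl// lerBlDr lerDl.
Qed.

Lemma any_hit01 M t w : (0 < M)%N -> 0 <= any_hit M t w <= 1.
Proof.
move=> M0; have [[i hi [E _]]|nh] := one_hit t w (fun=> 1) M0.
  rewrite /any_hit; under eq_bigr do rewrite -[_%:R]mul1r.
  by rewrite E ler01 lexx.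
by rewrite /any_hit big1 ?lexx ?ler01// => i _; rewrite nh.
Qed.

Lemma loss01 u M t w : (forall i, 0 <= u i <= 1) -> (0 < M)%N ->
  0 <= loss u M t w <= 1.
Proof.
move=> u01 M0; have /andP[-> h] := loss_le_any t w u01 M0.
by apply: le_trans h _; have /andP[] := any_hit01 t w M0.
Qed.

Lemma prod_pow_hit u M t w : (0 < M)%N ->
  \prod_i u i ^+ hit M t i w = 1 - loss u M t w.
Proof.
move=> M0; have [[i hi [E hj]]|nh] := one_hit t w (fun i => 1 - u i) M0.
  rewrite /loss E (bigD1 i)//= hi expr1 big1 ?mulr1; first by ring.
  by move=> j /hj ->; rewrite expr0.
rewrite big1; last by move=> j _; rewrite nh expr0.
by rewrite /loss big1 ?subr0// => j _; rewrite nh mulr0.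
Qed.

Section fixed_scale.
Context (u : I -> R) (M n : nat) (a b : R).
Hypothesis u01 : forall i, 0 <= u i <= 1.
Hypotheses (M0 : (0 < M)%N) (n0 : (0 < n)%N) (ab : a < b).
Hypothesis rangeP : forall x, P x -> a <= lin s x <= b.

Local Notation U := {ffun 'I_d -> 'I_(B * M).+1}.

Let h : R := (b - a) / n%:R.
Let lev (i : nat) : R := a + i%:R * h.
(* Each cut is surrounded by a discarded strip of half width [gap]: a separating
   point is within [R0 ln M] of the cut, hence [2 R0 ln M] away from the rest. *)
Let gap : R := 3 * (R0 * ln M%:R).
Let lam (f : U) : R := linN s (lattice_pt f).
Let inP (f : U) : bool := `[< Pi P M (lattice_pt f) >].

(* The error in the level of a separating point, in [level_point], has to be
   absorbed in the gap. *)
Hypothesis gap_big : \sum_j `|s j| <= R0 * ln M%:R.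
Hypothesis separators : forall j, (0 < j < n)%N ->
  exists2 t, Pi P M t & `|linN s t - M%:R * lev j| <= \sum_j `|s j|.

Definition in_slab (f : U) (i : 'I_n) : bool :=
  [&& inP f, (0 < i)%N, M%:R * lev i + gap < lam f & lam f < M%:R * lev i.+1 - gap].

(* Slabs are numbered from [0], so that the lowest one is discarded together with
   the gaps: no lattice point is known to lie below it. *)
Definition slab (f : U) : nat := oapp val 0%N [pick i | in_slab f i].

Let rate (f : U) : R :=
  \sum_i (1 - u i) * `[< zone i (scaled R M (lattice_pt f)) >]%:R * mu i / M%:R ^+ d.

Let M0' : 0 < M%:R :> R. Proof. by rewrite ltr0n. Qed.
Let h0 : 0 < h. Proof. by rewrite divr_gt0 ?ltr0n// subr_gt0. Qed.
Let S0 : 0 <= \sum_j `|s j|. Proof. exact: sumr_ge0. Qed.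
Let gap0 : 0 <= gap.
Proof. by rewrite mulr_ge0// (le_trans S0). Qed.

Let slabP f j : slab f = j.+1 -> [/\ inP f, (j.+1 < n)%N,
  M%:R * lev j.+1 + gap < lam f & lam f < M%:R * lev j.+2 - gap].
Proof.
rewrite /slab; case: pickP => //= i /and4P[fP i0 h1 h2] ij.
by rewrite -ij; split.
Qed.

Let lev_le i j : (i <= j)%N -> lev i <= lev j.
Proof. by move=> ij; rewrite lerD2l ler_pM2r// ler_nat. Qed.

Let lamS f : M%:R * lin s (scaled R M (lattice_pt f)) = lam f.
Proof. exact: lin_scaled. Qed.

Let lam_range f : inP f -> M%:R * a <= lam f <= M%:R * b.
Proof.
move=> /asboolP fP; rewrite -lamS !ler_pM2l//; exact: rangeP.
Qed.

Let levn : lev n = b.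
Proof. by rewrite /lev /h mulrC divfK ?pnatr_eq0 -?lt0n// addrC subrK. Qed.

Let slab0P f : inP f -> slab f = 0%N ->
  M%:R * a <= lam f <= M%:R * a + M%:R * h \/
  exists2 i : nat, (i <= n)%N & M%:R * lev i - gap <= lam f <= M%:R * lev i - gap + 2 * gap.
Proof.
move=> fP; rewrite /slab; case: pickP => /= [i /and4P[_ i0 _ _] i00|nos _].
  by rewrite i00 in i0.
have /andP[la lb] := lam_range fP.
have ex : exists k, lam f <= M%:R * lev k by exists n; rewrite levn.
case: (ex_minnP ex) => k lk kmin.
have kn : (k <= n)%N by apply: kmin; rewrite levn.
case: k lk kmin kn => [|k] lk kmin kn.
  left; rewrite la /=; apply: le_trans lk _.
  by rewrite /lev mul0r addr0 lerDl mulr_ge0 ?ltW.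
have lk' : M%:R * lev k < lam f.
  by rewrite ltNge; apply/negP => /kmin; rewrite ltnn.
case: k lk kmin kn lk' => [|k] lk kmin kn lk'.
  by left; rewrite la /= -mulrDr; rewrite /lev mul1r in lk.
have := nos (Ordinal kn); rewrite /in_slab fP /= => /negbT.
rewrite negb_and -!leNgt => /orP[h1|h1]; right.
  by exists k.+1; [exact: ltnW|apply/andP; split; lra].
by exists k.+2 => //; apply/andP; split; lra.
Qed.

(* Up to the factor [M ^+ d], [be] bounds the number of points of a slab, and [ga]
   the number of discarded points. *)
Let kap : R := (B.+1)%:R ^+ d.-1.
Let be : R := kap * (h / `|s j0| + M%:R^-1).
Let ga : R := kap * (h / `|s j0| + M%:R^-1 +
  n.+1%:R * (2 * gap / M%:R / `|s j0| + M%:R^-1)).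

Let d0 : (0 < d)%N. Proof. exact: leq_ltn_trans (ltn_ord j0). Qed.

Let slab_bound (w : R) : 0 <= w ->
  (w / `|s j0| + 1) * (B * M).+1%:R ^+ d.-1 <=
  kap * (w / M%:R / `|s j0| + M%:R^-1) * M%:R ^+ d.
Proof.
move=> w0.
have -> : M%:R ^+ d = M%:R ^+ d.-1 * M%:R :> R by rewrite -exprSr prednK.
have -> : kap * (w / M%:R / `|s j0| + M%:R^-1) * (M%:R ^+ d.-1 * M%:R) =
    (w / `|s j0| + 1) * (kap * M%:R ^+ d.-1).
  by field; rewrite normr_eq0 sj0 /= gt_eqF.
apply: ler_wpM2l; first by rewrite addr_ge0// divr_ge0.
rewrite /kap -exprMn lerXn2r ?nnegrE ?mulr_ge0//.
by rewrite -natrM ler_nat mulSn addnC -addn1 leq_add2l.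
Qed.

Let card_slab_le j : #|[pred f | slab f == j.+1]|%:R <= be * M%:R ^+ d.
Proof.
have w0 : 0 <= M%:R * h by rewrite mulr_ge0 ?ltW.
apply: le_trans (card_slab (al := M%:R * lev j.+1) w0 sj0 _) _.
  move=> f /eqP /slabP[_ _ h1 h2].
  have -> : \sum_j s j * (f j : nat)%:R = lam f.
    by apply: eq_bigr => i _; rewrite ffunE.
  rewrite -mulrDr.
  have <- : lev j.+2 = lev j.+1 + h by rewrite /lev -[in LHS]natr1; ring.
  by apply/andP; split; have := gap0; lra.
apply: le_trans (slab_bound w0) _.
by rewrite /be [M%:R * h]mulrC mulfK// gt_eqF.
Qed.

Let card_left_le : #|[pred f | inP f && (slab f == 0%N)]|%:R <= ga * M%:R ^+ d.
Proof.
pose Q (k : nat) : pred U := if k is k'.+1 then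
    fun f => M%:R * lev k' - gap <= lam f <= M%:R * lev k' - gap + 2 * gap
  else fun f => M%:R * a <= lam f <= M%:R * a + M%:R * h.
have lamE (f : U) : \sum_j s j * (f j : nat)%:R = lam f.
  by apply: eq_bigr => i _; rewrite ffunE.
apply: (@le_trans _ _ (\sum_(k <- iota 0 n.+2) #|Q k|)%N%:R).
  rewrite ler_nat; apply: card_cover => f /andP[fP /eqP s0].
  case: (slab0P fP s0) => [h1|[i ni h1]]; first by exists 0%N.
  by exists i.+1 => //; rewrite mem_iota /= add0n !ltnS.
have w0 : 0 <= M%:R * h by rewrite mulr_ge0 ?ltW.
have w1 : 0 <= 2 * gap by rewrite mulr_ge0.
rewrite /= big_cons natrD natr_sum.
have -> : ga * M%:R ^+ d = kap * (h / `|s j0| + M%:R^-1) * M%:R ^+ d +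
    n.+1%:R * (kap * (2 * gap / M%:R / `|s j0| + M%:R^-1) * M%:R ^+ d).
  by rewrite /ga; ring.
apply: lerD.
  apply: le_trans (card_slab (al := M%:R * a) w0 sj0 _) _.
    by move=> f; rewrite lamE.
  apply: le_trans (slab_bound w0) _.
  by rewrite [M%:R * h]mulrC mulfK// gt_eqF.
have gap_card k : #|Q k.+1|%:R <=
    kap * (2 * gap / M%:R / `|s j0| + M%:R^-1) * M%:R ^+ d.
  apply: le_trans (slab_bound w1).
  by apply: (card_slab (al := M%:R * lev k - gap) w1 sj0) => f; rewrite lamE.
apply: le_trans (_ : _ <= \sum_(k <- iota 1 n.+1)
    kap * (2 * gap / M%:R / `|s j0| + M%:R^-1) * M%:R ^+ d) _.
  rewrite big_seq [leRHS]big_seq; apply: ler_sum => k.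
  by rewrite in_cons mem_iota; case: k => // k _; exact: gap_card.
by rewrite big_const_seq count_predT iter_addr_0 size_iota -[leLHS]mulr_natl.
Qed.

Let v (f : U) (w : Omega) : R := loss u M (lattice_pt f) w.

Let de : R := #|I|%:R * (Cd / M%:R ^+ (2 * d)).
Let rho : R := C3 / M%:R ^+ (2 * d).
Let Q : R := \sum_i mu i.

Let latt_inj : injective (fun f : U => lattice_pt f).
Proof.
move=> f g /ffunP fg; apply/ffunP => j; apply/val_inj.
by have := fg j; rewrite !ffunE.
Qed.

Let rate_ge0 f : 0 <= rate f.
Proof.
apply: sumr_ge0 => i _; have /andP[_ ?] := u01 i.
by rewrite divr_ge0 ?exprn_ge0// !mulr_ge0// subr_ge0.
Qed.

Let rate_le f : rate f <= Q / M%:R ^+ d.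
Proof.
rewrite /rate /Q mulr_suml; apply: ler_sum => i _.
rewrite ler_pM2r ?invr_gt0 ?exprn_gt0//.
have /andP[? ?] := u01 i; rewrite ler_piMl// mulr_ile1// ?subr_ge0//.
  by rewrite lerBlDr lerDl.
by case: asboolP.
Qed.

Let rate_out f : ~~ inP f -> rate f = 0.
Proof.
move=> /asboolP nP; rewrite /rate big1// => i _.
by case: asboolP => [/zoneP //|_]; rewrite mulr0 !mul0r.
Qed.

Let v_out f w : ~~ inP f -> v f w = 0.
Proof.
move=> /asboolP nP; rewrite /v /loss big1// => i _.
case: (boolP (hit M (lattice_pt f) i w)) => [hi|_]; last by rewrite mulr0.
by exfalso; apply: nP; apply: (zoneP (hit_zone M0 hi)).
Qed.

Let step_dec j f : (j < n)%N -> slab f = j.+1 ->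
  `|Ex Pr (fun w => void_upto v slab j w * v f w) - rate f * Ex Pr (void_upto v slab j)|
  <= de.
Proof.
move=> jn /slabP[fP jn1 h1 h2].
have [t' t'P ht'] := separators (jn1 : (0 < j.+1 < n)%N).
move: ht'; rewrite ler_norml => /andP[l1 l2].
pose V := [seq lattice_pt g | g <- [seq g <- index_enum U | (0 < slab g <= j)%N]].
have voidE w : void_upto v slab j w = \prod_(r <- V) (1 - loss u M r w).
  by rewrite /void_upto big_map big_filter.
have L0 : 0 <= R0 * ln M%:R := le_trans S0 gap_big.
have gE : gap = 3 * (R0 * ln M%:R) by [].
have gb := gap_big; rewrite gE in h1.
have D i : zone i (scaled R M (lattice_pt f)) ->
    `|Ex Pr (fun w => void_upto v slab j w * (hit M (lattice_pt f) i w)%:R)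
      - mu i / M%:R ^+ d * Ex Pr (void_upto v slab j)| <= Cd / M%:R ^+ (2 * d).
  move=> zi.
  have -> : void_upto v slab j = fun w => \prod_(r <- V) (1 - loss u M r w).
    by apply/funext.
  apply: (dec (t' := t')) => //; first exact/asboolP.
    by rewrite -/(lam f); lra.
  move=> r /mapP[g]; rewrite mem_filter => /andP[/andP[g0 gj] _] ->.
  case E : (slab g) g0 gj => [//|i'] _ gj.
  have [gP _ _ h3] := slabP E; split; first exact/asboolP.
  rewrite gE in h3; have : lev i'.+2 <= lev j.+1 by apply: lev_le.
  by rewrite -(ler_pM2l M0') -/(lam g); lra.
have bV : bdd_meas (void_upto v slab j).
  by apply: bdd_void_upto => g; exact: bdd_loss.
have bVh i : bdd_meas (fun w => void_upto v slab j w * (hit M (lattice_pt f) i w)%:R).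
  by apply: bdd_measM => //; exact: bhit.
have -> : (fun w => void_upto v slab j w * v f w) =
    (fun w => \sum_i (1 - u i) * (void_upto v slab j w * (hit M (lattice_pt f) i w)%:R)).
  by apply/funext => w; rewrite /v /loss mulr_sumr; apply: eq_bigr => i _; rewrite mulrCA.
rewrite Ex_sum; last by move=> i; apply: bdd_measM => //; exact: bdd_meas_cst.
rewrite /rate mulr_suml -sumrB; apply: le_trans (ler_norm_sum _ _ _) _.
have -> : de = \sum_(i : I) (Cd / M%:R ^+ (2 * d)) by rewrite sumr_const /de mulr_natl.
apply: ler_sum => i _; rewrite ExZ//.
have CM0 : 0 <= Cd / M%:R ^+ (2 * d) by rewrite divr_ge0// exprn_ge0.
have /andP[ui0 ui1] := u01 i.
case: asboolP => [zi|nz].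
  rewrite mulr1 -!mulrA -mulrBr normrM mulrA.
  apply: le_trans (D i zi); rewrite ler_piMl// ger0_norm; lra.
rewrite mulr0 !mul0r subr0 (_ : (fun w => _) = fun=> 0).
  by rewrite Ex_cst mulr0 normr0.
apply/funext => w; case: (boolP (hit _ _ _ _)) => [/(hit_zone M0)//|_].
by rewrite mulr0.
Qed.

(** The first term is the share of the discarded points, both in the expectation and
    in the total intensity.  The second one is the sum of the errors of the blocks. *)
Lemma gf_fixed_scale :
  `|Ex Pr (fun w => \prod_(f : U) (1 - v f w)) - expR (- \sum_f rate f)| <=
  ga * (C1 + Q) + n%:R * (be * (#|I|%:R * Cd) / M%:R ^+ d + be ^+ 2 * (C3 + Q ^+ 2)).
Proof.
have Md0 : 0 < M%:R ^+ d :> R by rewrite exprn_gt0.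
have Q0 : 0 <= Q by exact: sumr_ge0.
have v01 f w : 0 <= v f w <= 1 by exact: loss01.
have bv f : bdd_meas (v f) by exact: bdd_loss.
have rho0 : 0 <= rho by rewrite divr_ge0// exprn_ge0.
have pairs f g : f != g -> Ex Pr (fun w => v f w * v g w) <= rho.
  move=> fg; apply: le_trans (@pair M (lattice_pt f) (lattice_pt g) M0 _).
    apply: Ex_le; [exact: bdd_measM|apply: bdd_measM; exact: bdd_any_hit|].
    move=> w; have /andP[? ?] := loss_le_any (lattice_pt f) w u01 M0.
    have /andP[? ?] := loss_le_any (lattice_pt g) w u01 M0.
    exact: ler_pM.
  by apply: contra fg => /eqP/latt_inj ->.
have T2 := block_telescope bv v01 rate_ge0 rho0 (n := n) step_dec pairs.
have slabn f : (slab f <= n)%N.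
  by case E : (slab f) => [//|j]; have [_ /ltnW] := slabP E.
have T1 : `|Ex Pr (fun w => \prod_(f : U) (1 - v f w)) - Ex Pr (void_upto v slab n)|
    <= ga * C1.
  have ball : bdd_meas (fun w => \prod_(f : U) (1 - v f w)).
    by apply: bdd_meas_prod => f; apply: bdd_measB => //; exact: bdd_meas_cst.
  rewrite -ExB//; last exact: bdd_void_upto.
  apply: le_trans (_ : _ <= Ex Pr (fun w => \sum_(f | inP f && (slab f == 0%N)) v f w)) _.
    apply: Ex_norm_le.
    - by apply: bdd_measB => //; exact: bdd_void_upto.
    - exact: bdd_meas_sum.
    - move=> w; apply: le_trans (prod_1B_subset (P := predT) (v01 ^~ w) _) _ => //=.
      rewrite (bigID inP) /= [X in _ + X]big1 ?addr0; last first.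
        by move=> f /andP[_]; exact: v_out.
      rewrite le_eqVlt; apply/orP; left; apply/eqP; apply: eq_bigl => f.
      by rewrite andbC slabn andbT lt0n negbK.
  rewrite Ex_sum//.
  apply: le_trans (_ : _ <= \sum_(f | inP f && (slab f == 0%N)) C1 / M%:R ^+ d) _.
    apply: ler_sum => f _; apply: le_trans (single (lattice_pt f) M0).
    apply: Ex_le => //; first exact: bdd_any_hit.
    by move=> w; have /andP[] := loss_le_any (lattice_pt f) w u01 M0.
  rewrite sumr_const -[leLHS]mulr_natl mulrCA mulrC ler_wpM2r//.
  by rewrite ler_pdivrMr//; exact: card_left_le.
have T3 : `|expR (- \sum_(j < n) intensity slab rate j.+1) - expR (- \sum_f rate f)|
    <= ga * Q.
  apply: le_trans (expRN_lip _ _) _.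
  - by apply: sumr_ge0 => j _; exact: sumr_ge0.
  - exact: sumr_ge0.
  have -> : \sum_(j < n) intensity slab rate j.+1 = \sum_(f | (0 < slab f)%N) rate f.
    rewrite /intensity (exchange_big_dep (fun f => (0 < slab f)%N)) /=; last first.
      by move=> j f _ /eqP ->.
    apply: eq_bigr => f f0.
    case E : (slab f) f0 => [//|j] _.
    have [_ jn _ _] := slabP E.
    by rewrite (big_pred1 (Ordinal (ltnW jn))).
  rewrite [X in _ - X](bigID (fun f => (0 < slab f)%N)) /= opprD addrA subrr sub0r normrN.
  rewrite ger0_norm; last exact: sumr_ge0.
  apply: le_trans (_ : _ <= \sum_(f | inP f && (slab f == 0%N)) Q / M%:R ^+ d) _.
    rewrite (bigID inP) /= [X in _ + X]big1 ?addr0; last first.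
      by move=> f /andP[_]; exact: rate_out.
    rewrite (eq_bigl (fun f => inP f && (slab f == 0%N))); last first.
      by move=> f; rewrite andbC lt0n negbK.
    by apply: ler_sum => f _.
  rewrite sumr_const -[leLHS]mulr_natl mulrCA mulrC ler_wpM2r//.
  by rewrite ler_pdivrMr//; exact: card_left_le.
have be0 : 0 <= be.
  apply: mulr_ge0; first exact: exprn_ge0.
  by apply: addr_ge0; [rewrite divr_ge0// ltW|rewrite invr_ge0 ltW].
have T2' : \sum_(j < n) blk_error slab rate de rho j.+1 <=
    n%:R * (be * (#|I|%:R * Cd) / M%:R ^+ d + be ^+ 2 * (C3 + Q ^+ 2)).
  apply: le_trans (_ : _ <= \sum_(j < n) (be * (#|I|%:R * Cd) / M%:R ^+ d +
      be ^+ 2 * (C3 + Q ^+ 2))) _; last first.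
    by rewrite sumr_const card_ord -[leLHS]mulr_natl.
  apply: ler_sum => j _; rewrite /blk_error mulrDr addrA.
  have cj := card_slab_le j.
  have M2 : M%:R ^+ (2 * d) = (M%:R ^+ d) ^+ 2 :> R by rewrite mulnC exprM.
  apply: lerD; [apply: lerD|].
  - rewrite /de M2; apply: le_trans (ler_wpM2r _ cj) _.
      by rewrite mulr_ge0// divr_ge0// exprn_ge0// ltW.
    rewrite le_eqVlt; apply/orP; left; apply/eqP; field.
    by rewrite expf_neq0// gt_eqF.
  - rewrite /rho M2; apply: (@le_trans _ _ ((be * M%:R ^+ d) ^+ 2 * (C3 / (M%:R ^+ d) ^+ 2))).
      apply: ler_wpM2r; first by rewrite divr_ge0// exprn_ge0// ltW.
      by rewrite lerXn2r ?nnegrE// mulr_ge0// ltW.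
    rewrite le_eqVlt; apply/orP; left; apply/eqP; field.
    by rewrite expf_neq0// gt_eqF.
  - have i0 : 0 <= intensity slab rate j.+1 by exact: sumr_ge0.
    have i1 : intensity slab rate j.+1 <= be * Q.
      apply: le_trans (_ : _ <= \sum_(f | slab f == j.+1) Q / M%:R ^+ d) _.
        by apply: ler_sum => f _; exact: rate_le.
      rewrite sumr_const -[leLHS]mulr_natl mulrCA mulrC; apply: ler_wpM2r => //.
      by rewrite ler_pdivrMr.
    by rewrite -exprMn lerXn2r// nnegrE mulr_ge0.
have tri (x y z t : R) : x - t = (x - y) + (y - z) + (z - t) by lra.
rewrite (tri _ (Ex Pr (void_upto v slab n))
  (expR (- \sum_(j < n) intensity slab rate j.+1))).
apply: le_trans (ler_normD _ _) _.
apply: le_trans (lerD (ler_normD _ _) (lexx _)) _.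
have := le_trans T2 T2'; rewrite mulrDr; lra.
Qed.


End fixed_scale.
(** For fixed [n] the error bound of [gf_fixed_scale] tends to [Th / n] as [M] tends
    to infinity, where [Th] does not depend on [n]. *)
Lemma gf_cvg (u : I -> R) (vol : I -> R) :
  (forall i, 0 <= u i <= 1) ->
  open P -> connected P -> P !=set0 -> bounded_set P ->
  (forall x j, P x -> 0 <= x 0 j) ->
  (forall i, (lattice_count B (zone i) M.+1)%:R / M.+1%:R ^+ d @[M --> \oo] --> vol i) ->
  Ex Pr (fun w => \prod_i u i ^+
    (\sum_(f : {ffun 'I_d -> 'I_(B * M.+1).+1}) hit M.+1 (lattice_pt f) i w)%N)
  @[M --> \oo] --> \prod_i expR (mu i * vol i * (u i - 1)).
Proof.
move=> u01 oP cP P_ne bP P0 volE.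
have [a [b [ab rangeP between]]] := lin_range oP P_ne bP P0 (ex_intro _ j0 sj0).
pose Q : R := \sum_i mu i.
pose kap : R := (B.+1)%:R ^+ d.-1.
pose ba : R := (b - a) / `|s j0|.
have ba0 : 0 <= ba by rewrite divr_ge0// subr_ge0 ltW.
pose Th : R := kap * ba * (C1 + Q) + (kap * ba) ^+ 2 * (C3 + Q ^+ 2).
pose rates (M : nat) : R :=
  \sum_i (1 - u i) * mu i * ((lattice_count B (zone i) M)%:R / M%:R ^+ d).
pose Lam : R := \sum_i (1 - u i) * mu i * vol i.
have cRates : expR (- rates M.+1) @[M --> \oo] --> expR (- Lam).
  apply: continuous_cvg; first exact: continuous_expR.
  apply: cvgN; apply: cvgr_sum_seq => i.
  by apply: cvgM; [exact: cvg_cst|exact: volE].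
have -> : \prod_i expR (mu i * vol i * (u i - 1)) = expR (- Lam).
  rewrite /Lam -sumrN expR_sum; apply: eq_bigr => i _.
  by congr expR; ring.
apply/cvgrPdist_le => e e0.
(* This choice of [n] makes [Th / n] at most [e / 3]. *)
pose n := (Num.trunc (3 * Th / e)).+1.
have n0 : (0 < n)%N by [].
have n0' : 0 < n%:R :> R by [].
have Thn : Th / n%:R <= e / 3.
  rewrite ler_pdivrMr// -ler_pdivrMl ?divr_gt0//.
  have -> : (e / 3)^-1 * Th = 3 * Th / e by field; rewrite gt_eqF.
  by apply/ltW; exact: truncnS_gt.
pose h : R := (b - a) / n%:R.
pose be (x : R) : R := kap * (h / `|s j0| + x).
pose ga (x y : R) : R := kap * (h / `|s j0| + x + n.+1%:R * (2 * (3 * (R0 * y)) / `|s j0| + x)).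
have ch : (M.+1%:R^-1 : R) @[M --> \oo] --> (0 : R) := cvg_harmonic.
(* Here [ln M = 2 ln (sqrt M) <= 2 sqrt M]. *)
have cl : ln M.+1%:R / M.+1%:R @[M --> \oo] --> (0 : R).
  apply: (@squeeze_cvgr _ _ _ _ (fun=> 0) (fun M => 2 * Num.sqrt (M.+1%:R^-1))).
  - near=> M; have M1 : 1 <= M.+1%:R :> R by rewrite ler1n.
    rewrite divr_ge0 ?ln_ge0//= ler_pdivrMr//.
    set r := Num.sqrt (M.+1%:R : R).
    have r0 : 0 < r by rewrite sqrtr_gt0.
    have E1 : M.+1%:R = r ^+ 2 by rewrite sqr_sqrtr.
    have -> : 2 * Num.sqrt (M.+1%:R^-1) * M.+1%:R = 2 * r.
      by rewrite sqrtrV// -/r E1; field; rewrite gt_eqF.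
    by rewrite E1 lnXn// -[leLHS]mulr_natl ler_pM2l// ltW// ln_sublinear.
  - exact: cvg_cst.
  - rewrite -(mulr0 2) -(sqrtr0 R); apply: cvgM; first exact: cvg_cst.
    apply: continuous_cvg ch; exact: sqrt_continuous.
have cErr : ga (M.+1%:R^-1) (ln M.+1%:R / M.+1%:R) * (C1 + Q) +
    n%:R * (be (M.+1%:R^-1) * (#|I|%:R * Cd) * M.+1%:R^-1 + be (M.+1%:R^-1) ^+ 2 * (C3 + Q ^+ 2))
    @[M --> \oo] --> Th / n%:R.
  have -> : Th / n%:R = ga 0 0 * (C1 + Q) +
      n%:R * (be 0 * (#|I|%:R * Cd) * 0 + be 0 ^+ 2 * (C3 + Q ^+ 2)).
    by rewrite /Th /ga /be /ba /h; field; rewrite ?normr_eq0 ?sj0 ?pnatr_eq0.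
  have cbe : be (M.+1%:R^-1) @[M --> \oo] --> be 0.
    by apply: cvgM; [exact: cvg_cst|apply: cvgD => //; exact: cvg_cst].
  apply: cvgD; apply: cvgM; try exact: cvg_cst.
    apply: cvgM; first exact: cvg_cst.
    apply: cvgD; first by apply: cvgD => //; exact: cvg_cst.
    apply: cvgM; first exact: cvg_cst.
    apply: cvgD => //; apply: cvgM; last exact: cvg_cst.
    apply: cvgM; first exact: cvg_cst.
    apply: cvgM; first exact: cvg_cst.
    by apply: cvgM; first exact: cvg_cst.
  apply: cvgD.
    by apply: cvgM => //; apply: cvgM => //; exact: cvg_cst.
  apply: cvgM; last exact: cvg_cst.
  by under eq_fun do rewrite expr2; rewrite expr2; exact: cvgM.
have e3 : 0 < e / 3 by rewrite divr_gt0.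
have seps : \forall M \near \oo, forall j : 'I_n, (0 < j)%N ->
    exists2 t, Pi P M t & `|linN s t - M%:R * (a + j%:R * h)| <= \sum_j `|s j|.
  apply: (@filter_forall _ _ _ _ eventually_filter) => j.
  have [j_0|j_0] := posnP j; first by near=> M; rewrite j_0.
  have hj : a < a + j%:R * h < b.
    rewrite ltrDl mulr_gt0 ?ltr0n//= ?divr_gt0 ?subr_gt0//.
    rewrite addrC -ltrBrDr /h mulrCA gtr_pMr ?subr_gt0//.
    by rewrite ltr_pdivrMr// mul1r ltr_nat.
  have [x_ y_] := between _ hj.
  near=> M => _; near: M.
  exact: level_point oP cP P0 x_ y_.
have lnbig : \forall M \near \oo, \sum_j `|s j| <= R0 * ln (M.+1%:R : R).
  exists (Num.trunc (expR ((\sum_j `|s j|) / R0))).+1 => // M /= hM.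
  rewrite mulrC -ler_pdivrMr// -ler_expR lnK ?posrE//.
  apply: le_trans (ltW (truncnS_gt _)) _.
  by rewrite ler_nat ltnW// ltnS.
have seps' : \forall M \near \oo, forall j, (0 < j < n)%N ->
    exists2 t, Pi P M.+1 t & `|linN s t - M.+1%:R * (a + j%:R * h)| <= \sum_j `|s j|.
  move: seps => [N _ HN]; exists N => // M /= NM j /andP[j_0 jn].
  exact: HN _ (leqW NM) (Ordinal jn) j_0.
near=> M.
have HM : `|expR (- Lam) - expR (- rates M.+1)| <= e / 3.
  by near: M; move/cvgrPdist_le : cRates; apply.
have HE : `|Th / n%:R - (ga (M.+1%:R^-1) (ln M.+1%:R / M.+1%:R) * (C1 + Q) +
    n%:R * (be (M.+1%:R^-1) * (#|I|%:R * Cd) * M.+1%:R^-1 + be (M.+1%:R^-1) ^+ 2 * (C3 + Q ^+ 2)))|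
    <= e / 3.
  by near: M; move/cvgrPdist_le : cErr; apply.
have HL : \sum_j `|s j| <= R0 * ln (M.+1%:R : R) by near: M.
have HS : forall j, (0 < j < n)%N ->
    exists2 t, Pi P M.+1 t & `|linN s t - M.+1%:R * (a + j%:R * h)| <= \sum_j `|s j|.
  by near: M.
have H := gf_fixed_scale u01 (ltn0Sn M) n0 ab rangeP HL HS.
have Erate : \sum_(f : {ffun 'I_d -> 'I_(B * M.+1).+1}) \sum_i
    (1 - u i) * `[< zone i (scaled R M.+1 (lattice_pt f)) >]%:R * mu i / M.+1%:R ^+ d
    = rates M.+1.
  rewrite exchange_big; apply: eq_bigr => i _ /=.
  rewrite /lattice_count -sum1_card natr_sum mulr_suml mulr_sumr.
  rewrite [RHS]big_mkcond /=; apply: eq_bigr => f _.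
  by rewrite inE; case: asboolP => _ /=; ring.
have EP : (fun w => \prod_i u i ^+
      (\sum_(f : {ffun 'I_d -> 'I_(B * M.+1).+1}) hit M.+1 (lattice_pt f) i w)%N) =
    (fun w => \prod_(f : {ffun 'I_d -> 'I_(B * M.+1).+1}) (1 - loss u M.+1 (lattice_pt f) w)).
  apply/funext => w.
  under eq_bigr do rewrite -prodrXr.
  by rewrite exchange_big; apply: eq_bigr => f _; exact: prod_pow_hit.
rewrite EP; rewrite /= Erate in H.
have Hbd : ga (M.+1%:R^-1) (ln M.+1%:R / M.+1%:R) * (C1 + Q) +
    n%:R * (be (M.+1%:R^-1) * (#|I|%:R * Cd) * M.+1%:R^-1 + be (M.+1%:R^-1) ^+ 2 * (C3 + Q ^+ 2))
    <= e / 3 + e / 3.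
  move: HE; rewrite ler_norml => /andP[+ _]; rewrite lerNl opprB lerBlDr => HE'.
  by apply: le_trans HE' _; rewrite lerD2l.
have HM' : `|Ex Pr (fun w => \prod_(f : {ffun 'I_d -> 'I_(B * M.+1).+1})
    (1 - loss u M.+1 (lattice_pt f) w)) - expR (- rates M.+1)| <= e / 3 + e / 3.
  apply: le_trans H _; apply: le_trans Hbd; apply: lerD.
    rewrite le_eqVlt; apply/orP; left; apply/eqP.
    by rewrite /ga -/Q -/kap -/h; congr (_ * (_ + _ * (_ / _ + _)) * _); ring.
  apply: ler_wpM2l => //; apply: lerD; last by [].
  apply: ler_wpM2l.
    apply: mulr_ge0; last exact: mulr_ge0.
    apply: mulr_ge0; first exact: exprn_ge0.
    by rewrite addr_ge0// divr_ge0// divr_ge0// subr_ge0 ltW.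
  rewrite lef_pV2 ?posrE ?exprn_gt0//.
  have d0 : (0 < d)%N := leq_ltn_trans (leq0n _) (ltn_ord j0).
  by rewrite -[leLHS]expr1 -natrX -natrX ler_nat leq_pexp2l.
rewrite -(subrKA (expR (- rates M.+1))); apply: le_trans (ler_normD _ _) _.
apply: le_trans (lerD HM (_ : _ <= e / 3 + e / 3)) _; first by rewrite distrC.
by rewrite le_eqVlt; apply/orP; left; apply/eqP; field.
Unshelve. all: by end_near. Qed.

End generating_function.

(** * From generating functions to point probabilities *)

Section poisson_limit.
Context (R : realType).

(** Contrary to [poisson_pmf], this is also the right value at the rate [0]. *)
Definition pois (lam : R) (b : nat) : R := lam ^+ b / b`!%:R * expR (- lam).

Lemma exp_partial (x : R) : 0 <= x ->
  \sum_(k < n) x ^+ k / k`!%:R @[n --> \oo] --> expR x.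
Proof.
move=> x0; rewrite (_ : (fun n => _) = series (exp_coeff x)).
  exact: is_cvg_series_exp_coeff.
by apply/funext => n; rewrite /series /= big_mkord.
Qed.

(** In the tail of the exponential series of [x * u], the factor [u ^+ a.+1] can be
    taken out. *)
Lemma exp_remainder (x u : R) (a : nat) : 0 <= x -> 0 <= u <= 1 ->
  0 <= expR (x * u) - \sum_(k < a.+1) (x * u) ^+ k / k`!%:R <= u ^+ a.+1 * expR x.
Proof.
move=> x0 /andP[u0 u1].
have xu0 : 0 <= x * u by rewrite mulr_ge0.
have cy := exp_partial xu0; have cx := exp_partial x0.
have t0 (y : R) k : 0 <= y -> 0 <= y ^+ k / k`!%:R.
  by move=> y0; rewrite divr_ge0 ?exprn_ge0.
have Hq n : (a.+1 <= n)%N ->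
  0 <= \sum_(k < n) (x * u) ^+ k / k`!%:R - \sum_(k < a.+1) (x * u) ^+ k / k`!%:R <=
  u ^+ a.+1 * \sum_(k < n) x ^+ k / k`!%:R.
  have sE (y : R) m : \sum_(k < m) y ^+ k / k`!%:R = \sum_(0 <= k < m) y ^+ k / k`!%:R.
    by rewrite big_mkord.
  move=> an; rewrite !sE.
  rewrite (big_cat_nat (leq0n _) an) //=. rewrite addrAC subrr add0r.
  rewrite sumr_ge0 /=; last by move=> i _; exact: t0.
  rewrite (big_cat_nat (leq0n _) an) //= mulrDr -[leLHS]add0r lerD//.
    by rewrite mulr_ge0 ?exprn_ge0// sumr_ge0// => k _; rewrite t0.
  rewrite mulr_sumr; apply: ler_sum_nat => k /andP[ak kn].
  have -> : (x * u) ^+ k / k`!%:R = u ^+ k * (x ^+ k / k`!%:R).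
    by rewrite exprMn; ring.
  apply: ler_wpM2r; first exact: t0.
  exact: ler_wiXn2l.
set q := \sum_(k < a.+1) _.
have lo : 0 <= expR (x * u) - q.
  rewrite subr_ge0; apply: ler_cvg_to (cvg_cst q) cy _.
  near=> n; have an : (a.+1 <= n)%N by near: n; exact: nbhs_infty_ge.
  by have /andP[h _] := Hq n an; rewrite -subr_ge0.
rewrite lo /= lerBlDr.
have cz : u ^+ a.+1 * \sum_(k < n) x ^+ k / k`!%:R + q @[n --> \oo] --> u ^+ a.+1 * expR x + q.
  by apply: cvgD; [apply: cvgM => //; exact: cvg_cst|exact: cvg_cst].
apply: ler_cvg_to cy cz _.
near=> n; have an : (a.+1 <= n)%N by near: n; exact: nbhs_infty_ge.
by have /andP[_ h] := Hq n an; rewrite -lerBlDr.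
Unshelve. all: by end_near. Qed.

Lemma pois_gf (lam u : R) (a : nat) : 0 <= lam -> 0 <= u <= 1 ->
  0 <= expR (lam * (u - 1)) - \sum_(b < a.+1) u ^+ b * pois lam b <= u ^+ a.+1.
Proof.
move=> lam0 u01; have := exp_remainder a lam0 u01.
have -> : \sum_(b < a.+1) u ^+ b * pois lam b =
    (\sum_(k < a.+1) (lam * u) ^+ k / k`!%:R) * expR (- lam).
  rewrite mulr_suml; apply: eq_bigr => b _.
  by rewrite /pois exprMn; ring.
rewrite mulrBr mulr1 expRD -mulrBl => /andP[h1 h2].
have e0 : 0 < expR (- lam) := expR_gt0 _.
apply/andP; split; first by rewrite mulr_ge0// ltW.
apply: le_trans (ler_wpM2r (ltW e0) h2) _.
by rewrite -mulrA -expRD subrr expR0 mulr1.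
Qed.

Lemma pois_sum1 (lam : R) : 0 <= lam ->
  \sum_(b < n) pois lam b @[n --> \oo] --> (1 : R).
Proof.
move=> lam0; have -> : (1 : R) = expR lam * expR (- lam) by rewrite -expRD subrr expR0.
rewrite /pois; under eq_fun do rewrite -mulr_suml.
by apply: cvgM; [exact: exp_partial|exact: cvg_cst].
Qed.

Lemma pois_prob (lam : R) (n b : nat) : 0 <= lam ->
  poisson_prob lam n [set b] = (pois lam b)%:E.
Proof.
move=> l0; rewrite /poisson_prob /pois; case: ltP => [lp|ln].
  rewrite esum_set1; last by rewrite lee_fin poisson_pmf_ge0.
  by rewrite /poisson_pmf lp.
have -> : lam = 0 by apply/eqP; rewrite eq_le ln.
rewrite diracE oppr0 expR0 mulr1 expr0n; case: b => [|b] /=.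
  by rewrite mem_set//= fact0 divr1.
by rewrite memNset ?mul0r.
Qed.

End poisson_limit.

Section gf_to_pmf.
Context (R : realType) (d : measure_display) (T : measurableType d).
Context (Pr : probability T R).

Lemma bdd_meas_nat (N : T -> nat) (g : nat -> R) (C : R) :
  measurable_fun setT N -> (forall n, `|g n| <= C) ->
  bdd_meas (fun w => g (N w)).
Proof.
move=> mN gC; split; last by exists C.
by apply: (measurableT_comp (f := g)).
Qed.

(** By strong induction on [a].  Dividing the generating function by [u ^+ a], once
    the terms [b < a] have been subtracted, gives the coefficient of [u ^+ a] up to
    [O(u)], both for the sequence and for the limit; so first [u] is taken small,
    and then [M] large.  The weight [W] carries the other coordinates. *)
Lemma gf_to_pmf_step (W : nat -> T -> R) (N : nat -> T -> nat) (C lam : R) :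
  0 <= C -> 0 <= lam ->
  (forall M, bdd_meas (W M)) -> (forall M w, 0 <= W M w <= 1) ->
  (forall M, measurable_fun setT (N M)) ->
  (forall u : R, 0 <= u <= 1 ->
     Ex Pr (fun w => W M w * u ^+ N M w) @[M --> \oo] --> C * expR (lam * (u - 1))) ->
  forall a, Ex Pr (fun w => W M w * (N M w == a)%:R) @[M --> \oo] --> C * pois lam a.
Proof.
move=> C0 lam0 bW W01 mN gf a.
elim/ltn_ind: a => a IH.
pose x M b : R := Ex Pr (fun w => W M w * (N M w == b)%:R).
have bind M b : bdd_meas (fun w => W M w * (N M w == b)%:R).
  apply: bdd_measM => //; apply: (bdd_meas_nat (g := fun n => (n == b)%:R) (C := 1)) => //.
  by move=> n; case: eqP; rewrite ?normr1 ?normr0.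
have bpow M u : 0 <= u <= 1 -> bdd_meas (fun w => W M w * u ^+ N M w).
  move=> /andP[u0 u1]; apply: bdd_measM => //.
  apply: (bdd_meas_nat (g := fun n => u ^+ n) (C := 1)) => // n.
  by rewrite ger0_norm ?exprn_ge0// exprn_ile1.
have key M u : 0 <= u <= 1 ->
    0 <= Ex Pr (fun w => W M w * u ^+ N M w) - \sum_(b < a.+1) u ^+ b * x M b <= u ^+ a.+1.
  move=> u01; have /andP[u0 u1] := u01.
  have -> : \sum_(b < a.+1) u ^+ b * x M b =
      Ex Pr (fun w => \sum_(b < a.+1) u ^+ b * (W M w * (N M w == b)%:R)).
    rewrite Ex_sum; last by move=> b; apply: bdd_measM => //; exact: bdd_meas_cst.
    by apply: eq_bigr => b _; rewrite ExZ.
  have bS : bdd_meas (fun w => \sum_(b < a.+1) u ^+ b * (W M w * (N M w == b)%:R)).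
    by apply: bdd_meas_sum => b; apply: bdd_measM => //; exact: bdd_meas_cst.
  rewrite -ExB//; last exact: bpow.
  have pt w : 0 <= W M w * u ^+ N M w - \sum_(b < a.+1) u ^+ b * (W M w * (N M w == b)%:R)
      <= u ^+ a.+1.
    have /andP[w0 w1] := W01 M w.
    have [Na|Na] := leqP (N M w) a.
      have Na' : (N M w < a.+1)%N by [].
      rewrite (bigD1 (Ordinal Na'))//= eqxx mulr1 big1 ?addr0; last first.
        by move=> b bN; rewrite -val_eqE /= eq_sym in bN; rewrite (negbTE bN) !mulr0.
      by rewrite [u ^+ _ * _]mulrC subrr lexx exprn_ge0.
    rewrite big1 ?subr0; last first.
      by move=> b _; rewrite gtn_eqF ?mulr0// (leq_ltn_trans _ Na)// -ltnS.
    rewrite mulr_ge0 ?exprn_ge0//=.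
    apply: (@le_trans _ _ (u ^+ N M w)); first by rewrite ler_piMl ?exprn_ge0.
    exact: ler_wiXn2l.
  apply/andP; split; first by apply: Ex_ge0 => w; have /andP[] := pt w.
  rewrite -[leRHS](Ex_cst Pr); apply: Ex_le => //; last by move=> w; have /andP[] := pt w.
    by apply: bdd_measB => //; exact: bpow.
  exact: bdd_meas_cst.
apply/cvgrPdist_le => e e0.
(* The remainders contribute at most [(1 + C) * u] after division by [u ^+ a]. *)
pose u : R := Num.min 1 (e / (2 * (1 + C))).
have C1 : 0 < 1 + C by rewrite ltr_pwDl.
have up : 0 < u by rewrite lt_min ltr01 divr_gt0// mulr_gt0.
have u01 : 0 <= u <= 1 by rewrite ltW//= ge_min lexx.
have uC : (1 + C) * u <= e / 2.
  have : u <= e / (2 * (1 + C)) by rewrite ge_min lexx orbT.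
  by rewrite ler_pdivlMr ?mulr_gt0//; lra.
have ua : 0 < u ^+ a by rewrite exprn_gt0.
have lowcvg : Ex Pr (fun w => W M w * u ^+ N M w) - \sum_(b < a) u ^+ b * x M b
    @[M --> \oo] --> C * expR (lam * (u - 1)) - \sum_(b < a) u ^+ b * (C * pois lam b).
  apply: cvgB; first exact: gf.
  apply: cvgr_sum_seq => b; apply: cvgM; first exact: cvg_cst.
  exact: IH.
have e2 : 0 < e / 2 * u ^+ a by rewrite mulr_gt0// divr_gt0.
near=> M.
have h1 : `|C * expR (lam * (u - 1)) - \sum_(b < a) u ^+ b * (C * pois lam b) -
   (Ex Pr (fun w => W M w * u ^+ N M w) - \sum_(b < a) u ^+ b * x M b)| <= e / 2 * u ^+ a.
  by near: M; move/cvgrPdist_le : lowcvg; apply.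
have /andP[h2 h3] := key M u u01.
have /andP[h4 h5] := pois_gf a lam0 u01.
have h4C := mulr_ge0 C0 h4.
have h5C := ler_wpM2l C0 h5.
move: h1 h2 h3 h4C h5C; rewrite ![C * (_ - \sum_(_ < _) _)]mulrBr mulr_sumr !big_ord_recr /=.
rewrite -/(x M a) exprS.
have -> : \sum_(i < a) C * (u ^+ i * pois lam i) = \sum_(i < a) u ^+ i * (C * pois lam i).
  by apply: eq_bigr => b _; rewrite mulrCA.
set S1 := \sum_(i < a) _; set S2 := \sum_(i < a) _; set G := C * expR _.
set E := Ex Pr _; set p := pois lam a; set xa := x M a.
rewrite !ler_norml => /andP[g1 g2] g3 g4 g5 g6.
have g7 := ler_wpM2r (ltW ua) uC.
have g8 : 0 <= u * u ^+ a by rewrite mulr_ge0// ltW.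
have g9 : 0 <= C * (u * u ^+ a) by rewrite mulr_ge0.
have H : `|(C * p - xa) * u ^+ a| <= e * u ^+ a.
  by rewrite ler_norml; apply/andP; split; lra.
by rewrite normrM (ger0_norm (ltW ua)) ler_pM2r// in H; rewrite -ler_norml.
Unshelve. all: by end_near. Qed.

End gf_to_pmf.

(** * From point probabilities to convergence in distribution *)

Section count_vectors.
Context (R : realType) (d : measure_display) (T : measurableType d).
Context (Pr : probability T R) (I : finType) (N : T -> I -> nat).
Hypothesis mN : forall i, measurable_fun setT (fun w => N w i).

(** A vector of integers takes countably many values, so every function of it is
    measurable. *)
Lemma measurable_count_fun (d' : measure_display) (T' : measurableType d')
    (g : {ffun I -> nat} -> T') :
  measurable_fun setT (fun w => g [ffun i => N w i]).
Proof.
move=> _ V mV; rewrite setTI.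
pose lev (k : {ffun I -> nat}) := [set w | forall i, N w i = k i].
have mlev k : measurable (lev k).
  have -> : lev k = \bigcap_(i in [set: I]) ((fun w => N w i) @^-1` [set k i]).
    by apply/seteqP; split=> w h i => [_|]; exact: h.
  apply: fin_bigcap_measurable => [|i _]; first exact: finite_finset.
  by rewrite -[X in measurable X]setTI; exact: mN.
have -> : (fun w => g [ffun i => N w i]) @^-1` V =
    \bigcup_n (if (choice.unpickle n : option {ffun I -> nat}) is Some k then
                 (if `[< V (g k) >] then lev k else set0) else set0).
  apply/seteqP; split=> w /=.
    move=> Vw; exists (choice.pickle [ffun i => N w i]) => //.
    rewrite choice.pickleK; case: asboolP => // _ i.
    by rewrite ffunE.
  move=> [n _]; case: (choice.unpickle n) => // k; case: asboolP => // Vk kw.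
  by rewrite (_ : finfun _ = k)//; apply/ffunP => i; rewrite ffunE kw.
apply: bigcup_measurable => n _; case: (choice.unpickle n) => [k|//].
by case: asboolP.
Qed.

Definition pmf_at (k : I -> nat) : R := Ex Pr (fun w => \prod_i (N w i == k i)%:R).

Lemma bdd_point_indic (k : I -> nat) : bdd_meas (fun w => \prod_i (N w i == k i)%:R : R).
Proof.
apply: bdd_meas_prod => i; apply: (bdd_meas_nat (g := fun n => (n == k i)%:R) (C := 1)) => //.
by move=> n; case: eqP; rewrite ?normr1 ?normr0.
Qed.

Lemma point_indicE (k : I -> nat) w :
  \prod_i (N w i == k i)%:R = [forall i, N w i == k i]%:R :> R.
Proof.
case: forallP => [h|/forallP]; first by rewrite big1// => i _; rewrite h.
rewrite negb_forall => /existsP[i /negbTE Ni].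
by rewrite (bigD1 i)//= Ni mul0r.
Qed.

(** Outside the box [[0, K[^I] the function is bounded by [C], and the probability of
    the complement of the box is [1] minus the sum of the point probabilities. *)
Lemma box_approx (g : {ffun I -> nat} -> R) (C : R) (K : nat) :
  (forall k, `|g k| <= C) ->
  `|Ex Pr (fun w => g [ffun i => N w i]) -
    \sum_(k : {ffun I -> 'I_K}) g [ffun i => k i : nat] * pmf_at (fun i => k i)|
  <= C * (1 - \sum_(k : {ffun I -> 'I_K}) pmf_at (fun i => k i)).
Proof.
move=> gC.
have bg : bdd_meas (fun w => g [ffun i => N w i]).
  by split; [exact: measurable_count_fun|exists C].
pose p (k : {ffun I -> 'I_K}) w : R := \prod_i (N w i == k i)%:R.
have bp k : bdd_meas (p k) by exact: bdd_point_indic.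
have bgp (k : {ffun I -> 'I_K}) : bdd_meas (fun w => g [ffun i => k i : nat] * p k w).
  by apply: bdd_measM => //; exact: bdd_meas_cst.
have -> : \sum_(k : {ffun I -> 'I_K}) g [ffun i => k i : nat] * pmf_at (fun i => k i) =
    Ex Pr (fun w => \sum_(k : {ffun I -> 'I_K}) g [ffun i => k i : nat] * p k w).
  by rewrite Ex_sum//; apply: eq_bigr => k _; rewrite ExZ.
have -> : C * (1 - \sum_(k : {ffun I -> 'I_K}) pmf_at (fun i => k i)) =
    Ex Pr (fun w => C * (1 - \sum_(k : {ffun I -> 'I_K}) p k w)).
  rewrite ExZ; last by apply: bdd_measB; [exact: bdd_meas_cst|exact: bdd_meas_sum].
  by rewrite ExB ?Ex_cst ?Ex_sum//; [exact: bdd_meas_cst|exact: bdd_meas_sum].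
rewrite -ExB//; last exact: bdd_meas_sum.
apply: Ex_norm_le.
- by apply: bdd_measB => //; exact: bdd_meas_sum.
- apply: bdd_measM; first exact: bdd_meas_cst.
  by apply: bdd_measB; [exact: bdd_meas_cst|exact: bdd_meas_sum].
move=> w; have [/forallP inK|outK] := boolP [forall i, (N w i < K)%N].
  pose k0 : {ffun I -> 'I_K} := [ffun i => Ordinal (inK i)].
  have p1 : p k0 w = 1.
    by rewrite /p point_indicE (_ : [forall i, _] = true)//; apply/forallP => i; rewrite ffunE.
  have p0 k : k != k0 -> p k w = 0.
    move=> kk0; rewrite /p point_indicE; case: forallP => // h.
    by case/eqP: kk0; apply/ffunP => i; apply/val_inj; rewrite ffunE /= (eqP (h i)).
  rewrite (bigD1 k0)//= p1 mulr1 big1 ?addr0; last by move=> k /p0 ->; rewrite mulr0.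
  rewrite (bigD1 k0)//= p1 big1 ?addr0; last by move=> k /p0 ->.
  rewrite (_ : [ffun i => k0 i : nat] = [ffun i => N w i]); last first.
    by apply/ffunP => i; rewrite !ffunE.
  by rewrite !subrr normr0 mulr0.
have p0 k : p k w = 0.
  rewrite /p point_indicE; case: forallP => // h.
  by move/negP: outK => []; apply/forallP => i; rewrite (eqP (h i)).
rewrite big1; last by move=> k _; rewrite p0 mulr0.
by rewrite big1// !subr0 mulr1.
Qed.

End count_vectors.

Section gf_to_distribution.
Context (R : realType) (d : measure_display) (T : measurableType d).
Context (Pr : probability T R) (I : finType) (N : nat -> T -> I -> nat) (lam : I -> R).
Hypothesis mN : forall M i, measurable_fun setT (fun w => N M w i).
Hypothesis lam0 : forall i, 0 <= lam i.
Hypothesis gf : forall u : I -> R, (forall i, 0 <= u i <= 1) ->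
  Ex Pr (fun w => \prod_i u i ^+ N M w i) @[M --> \oo] -->
  \prod_i expR (lam i * (u i - 1)).

Let test (s : seq I) (u : I -> R) (a : I -> nat) (i : I) (n : nat) : R :=
  if i \in s then (n == a i)%:R else u i ^+ n.

Let target (s : seq I) (u : I -> R) (a : I -> nat) (i : I) : R :=
  if i \in s then pois (lam i) (a i) else expR (lam i * (u i - 1)).

Let test01 s u a i n : (forall i, 0 <= u i <= 1) -> 0 <= test s u a i n <= 1.
Proof.
move=> u01; rewrite /test; case: ifP => _.
  by case: eqP; rewrite ?lexx ?ler01.
by have /andP[? ?] := u01 i; rewrite exprn_ge0// exprn_ile1.
Qed.

(** Interpolates between the generating function, [s] empty, and the point
    probability, [s] the list of all coordinates; [gf_to_pmf_step] treats one more
    coordinate. *)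
Lemma gf_to_hybrid s : uniq s -> forall u a, (forall i, 0 <= u i <= 1) ->
  Ex Pr (fun w => \prod_i test s u a i (N M w i)) @[M --> \oo] -->
  \prod_i target s u a i.
Proof.
elim: s => [_ u a u01|i0 s IH /= /andP[i0s us] u a u01].
  by rewrite /test /target /=; exact: gf.
rewrite (bigD1 i0)//= {1}/target mem_head mulrC.
pose W M w := \prod_(i | i != i0) test s u a i (N M w i).
have testE i n : i != i0 -> test (i0 :: s) u a i n = test s u a i n.
  by move=> ii0; rewrite /test in_cons (negbTE ii0).
have -> : (fun M => Ex Pr (fun w => \prod_i test (i0 :: s) u a i (N M w i))) =
    (fun M => Ex Pr (fun w => W M w * (N M w i0 == a i0)%:R)).
  apply/funext => M; congr Ex; apply/funext => w.
  rewrite (bigD1 i0)//= {1}/test mem_head mulrC; congr (_ * _).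
  by apply: eq_bigr => i; exact: testE.
have -> : \prod_(i | i != i0) target (i0 :: s) u a i = \prod_(i | i != i0) target s u a i.
  by apply: eq_bigr => i ii0; rewrite /target in_cons (negbTE ii0).
apply: gf_to_pmf_step => //.
- apply: prodr_ge0 => i _; rewrite /target /pois; case: ifP => _; last exact: expR_ge0.
  by rewrite mulr_ge0 ?expR_ge0// divr_ge0 ?exprn_ge0.
- move=> M; apply: bdd_meas_prod => i.
  apply: (bdd_meas_nat (g := test s u a i) (C := 1)) => // n.
  by have /andP[? ?] := test01 s a i n u01; rewrite ger0_norm.
- move=> M w; rewrite prodr_ge0 ?prodr_ile1// => i _; first exact: test01.
  by have /andP[] := test01 s a i (N M w i) u01.
- move=> v v01.
  pose u' i := if i == i0 then v else u i.
  have u'01 i : 0 <= u' i <= 1 by rewrite /u'; case: ifP.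
  have := IH us u' a u'01.
  have tg0 : target s u' a i0 = expR (lam i0 * (v - 1)).
    by rewrite /target (negbTE i0s) /u' eqxx.
  rewrite [\prod_i target _ _ _ _](bigD1 i0)//= tg0 mulrC.
  have -> : \prod_(i | i != i0) target s u' a i = \prod_(i | i != i0) target s u a i.
    by apply: eq_bigr => i ii0; rewrite /target /u' (negbTE ii0).
  have -> // : (fun M => Ex Pr (fun w => \prod_i test s u' a i (N M w i))) =
    (fun M => Ex Pr (fun w => W M w * v ^+ N M w i0)).
  apply/funext => M; congr Ex; apply/funext => w.
  have tt0 : test s u' a i0 (N M w i0) = v ^+ N M w i0.
    by rewrite /test (negbTE i0s) /u' eqxx.
  rewrite (bigD1 i0)//= tt0 mulrC; congr (_ * _).
  by apply: eq_bigr => i ii0; rewrite /test /u' (negbTE ii0).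
Qed.

Lemma gf_to_pmf (a : I -> nat) :
  pmf_at Pr (N M) a @[M --> \oo] --> \prod_i pois (lam i) (a i).
Proof.
have u01 (i : I) : 0 <= (1 : R) <= 1 by rewrite ler01 lexx.
have := @gf_to_hybrid (enum I) (enum_uniq I) (fun=> 1) a u01.
rewrite /test /target.
under eq_bigr do rewrite mem_enum.
have -> // : (fun M => Ex Pr (fun w => \prod_i
      (if i \in enum I then (N M w i == a i)%:R else 1 ^+ N M w i))) =
    (fun M => pmf_at Pr (N M) a).
apply/funext => M; congr Ex; apply/funext => w.
by apply: eq_bigr => i _; rewrite mem_enum.
Qed.

(** The limiting point probabilities have total mass [1], so a large box carries
    almost all the mass of the limit, hence also of the sequence. *)
Lemma gf_to_bounded (d' : measure_display) (T' : measurableType d')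
    (Pr' : probability T' R) (Z : T' -> I -> nat) (g : {ffun I -> nat} -> R) (C : R) :
  (forall i, measurable_fun setT (fun w => Z w i)) ->
  (forall a : I -> nat, pmf_at Pr' Z a = \prod_i pois (lam i) (a i)) ->
  (forall k, `|g k| <= C) ->
  Ex Pr (fun w => g [ffun i => N M w i]) @[M --> \oo] -->
  Ex Pr' (fun w => g [ffun i => Z w i]).
Proof.
move=> mZ pZ gC.
have C0 : 0 <= C by apply: le_trans (gC [ffun=> 0%N]).
have tight : \sum_(k : {ffun I -> 'I_K}) \prod_i pois (lam i) (k i) @[K --> \oo] --> (1 : R).
  have -> : (fun K => \sum_(k : {ffun I -> 'I_K}) \prod_i pois (lam i) (k i)) =
      (fun K => \prod_i \sum_(b < K) pois (lam i) b).
    by apply/funext => K; rewrite -(bigA_distr_bigA (fun i (b : 'I_K) => pois (lam i) b)).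
  have := @cvgr_prod_seq R nat I \oo _ (index_enum I)
    (fun i K => \sum_(b < K) pois (lam i) b) (fun=> 1)
    (fun i => pois_sum1 (lam0 i)).
  have -> : \prod_(i : I) (1 : R) = 1 by rewrite big1.
  exact.
apply/cvgrPdist_le => e e0.
pose e' := e / (4 * (1 + C)).
have C1 : 0 < 1 + C by rewrite ltr_pwDl.
have e'0 : 0 < e' by rewrite divr_gt0// mulr_gt0.
have Ce' : (1 + C) * e' = e / 4 by rewrite /e'; field; rewrite gt_eqF.
move/cvgrPdist_le : (tight) => /(_ _ e'0)[K _ /(_ K (leqnn K)) HK].
set S := \sum_(k : {ffun I -> 'I_K}) _ in HK.
have {}HK : C * (1 - S) <= e / 4.
  rewrite -Ce'; apply: le_trans (_ : _ <= C * e') _.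
    by rewrite ler_wpM2l// (le_trans (ler_norm _)).
  by rewrite ler_pM2r// lerDr.
have cS : \sum_(k : {ffun I -> 'I_K}) pmf_at Pr (N M) (fun i => k i) @[M --> \oo] --> S.
  by apply: cvgr_sum_seq => k; exact: gf_to_pmf.
have cg : \sum_(k : {ffun I -> 'I_K}) g [ffun i => k i : nat] * pmf_at Pr (N M) (fun i => k i)
   @[M --> \oo] -->
   \sum_(k : {ffun I -> 'I_K}) g [ffun i => k i : nat] * pmf_at Pr' Z (fun i => k i).
  apply: cvgr_sum_seq => k; apply: cvgM; first exact: cvg_cst.
  by rewrite pZ; exact: gf_to_pmf.
have e4 : 0 < e / 4 by rewrite divr_gt0.
have hZ := box_approx Pr' mZ K gC.
have ES : \sum_(k : {ffun I -> 'I_K}) pmf_at Pr' Z (fun i => k i) = S.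
  by apply: eq_bigr => k _; exact: pZ.
rewrite ES in hZ.
near=> M.
have hN := box_approx Pr (mN M) K gC.
have h1 : `|S - \sum_(k : {ffun I -> 'I_K}) pmf_at Pr (N M) (fun i => k i)| <= e'.
  by near: M; move/cvgrPdist_le : cS; apply.
have h2 : `|\sum_(k : {ffun I -> 'I_K}) g [ffun i => k i : nat] * pmf_at Pr' Z (fun i => k i)
    - \sum_(k : {ffun I -> 'I_K}) g [ffun i => k i : nat] * pmf_at Pr (N M) (fun i => k i)|
    <= e / 4.
  by near: M; move/cvgrPdist_le : cg; apply.
have h3 : C * (1 - \sum_(k : {ffun I -> 'I_K}) pmf_at Pr (N M) (fun i => k i)) <= e / 4 + e / 4.
  move: h1; rewrite ler_norml => /andP[_ /(ler_wpM2l C0) h1].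
  have h4 : C * e' <= e / 4 by rewrite -Ce' mulrDl mul1r lerDr ltW.
  have h5 := le_trans h1 h4.
  apply: le_trans (lerD HK h5); rewrite -mulrDr le_eqVlt.
  by apply/orP; left; apply/eqP; congr (_ * _); ring.
move: hZ hN h2 h3 HK; rewrite !ler_norml => /andP[? ?] /andP[? ?] /andP[? ?] ? ?.
by apply/andP; split; lra.
Unshelve. all: by end_near. Qed.

End gf_to_distribution.

(** * Independent Poisson variables *)

Section independent_family.
Context (R : realType).

(** Built by induction as an iterated product of the given laws. *)
Lemma independent_family (n : nat) (law : 'I_n -> probability nat R) :
  exists (d' : measure_display) (T' : measurableType d') (Pr' : probability T' R)
    (Z : 'I_n -> T' -> nat),
    (forall i, measurable_fun setT (Z i)) /\
    (forall A : 'I_n -> set nat,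
      Pr' (\bigcap_(i in [set: 'I_n]) (Z i @^-1` A i)) = (\prod_i law i (A i))%E).
Proof.
elim: n law => [|n IH] law.
  exists _, nat, (poisson_prob (0 : R) 0%N), (fun _ _ => 0%N); split.
    by move=> i; exact: measurable_cst.
  move=> A; rewrite big_ord0 (_ : \bigcap_(_ in _) _ = setT) ?probability_setT//.
  by apply/seteqP; split=> // w _ [].
have [d' [T' [Pr' [Z [mZ ZE]]]]] := IH (fun i => law (lift ord0 i)).
exists _, (T' * nat)%type, (Pr' \x law ord0)%E,
  (fun i x => if unlift ord0 i is Some j then Z j x.1 else x.2); split.
  move=> i; case: (unlift ord0 i) => [j|]; last exact: measurable_snd.
  exact: (measurableT_comp (mZ j) measurable_fst).
move=> A.
have -> : \bigcap_(i in [set: 'I_n.+1])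
    ((fun x : T' * nat => if unlift ord0 i is Some j then Z j x.1 else x.2) @^-1` A i) =
  (\bigcap_(j in [set: 'I_n]) (Z j @^-1` A (lift ord0 j))) `*` A ord0.
  apply/seteqP; split=> -[x k] /=.
    move=> h; split; last by have := h ord0 I; rewrite /= unlift_none.
    by move=> j _; have := h (lift ord0 j) I; rewrite /= liftK.
  move=> [h1 h2] i _ /=; case: unliftP => [j ->|->//]; exact: h1.
have mB : measurable (\bigcap_(j in [set: 'I_n]) (Z j @^-1` A (lift ord0 j))).
  apply: fin_bigcap_measurable => [|i _]; first exact: finite_finset.
  by rewrite -[X in measurable X]setTI; exact: mZ.
transitivity (Pr' (\bigcap_(j in [set: 'I_n]) (Z j @^-1` A (lift ord0 j))) *
    law ord0 (A ord0))%E; first exact: product_measure1E.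
by rewrite ZE big_ord_recl muleC.
Qed.

Lemma independent_poisson (I : finType) (lam : I -> R) :
  exists (d' : measure_display) (T' : measurableType d') (Pr' : probability T' R)
    (Z : I -> {RV Pr' >-> nat}),
  mutually_independent Pr' Z /\
  forall i A, Pr' (Z i @^-1` A) = poisson_prob (lam i) 0%N A.
Proof.
have [d' [T' [Pr' [Z0 [mZ0 Z0E]]]]] :=
  independent_family (fun k : 'I_#|I| => poisson_prob (lam (enum_val k)) 0%N).
pose f (i : I) := Z0 (enum_rank i).
have mf i : measurable_fun setT (f i) by exact: mZ0.
pose Z (i : I) : {RV Pr' >-> nat} :=
  HB.pack (f i) (isMeasurableFun.Build _ _ _ _ (f i) (mf i)).
have ZE (A : I -> set nat) :
    Pr' (\bigcap_(i in [set: I]) (Z i @^-1` A i)) =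
    (\prod_i poisson_prob (lam i) 0%N (A i))%E.
  have := Z0E (fun k => A (enum_val k)).
  rewrite (_ : \bigcap_(k in _) (Z0 k @^-1` _) = \bigcap_(i in [set: I]) (Z i @^-1` A i)).
    move=> ->; rewrite [RHS](reindex_onto enum_val enum_rank) /=; last first.
      by move=> i _; rewrite enum_rankK.
    by apply: eq_bigl => k; rewrite enum_valK eqxx.
  apply/seteqP; split=> w h i _ /=.
    by have := h (enum_rank i) Logic.I; rewrite /= enum_rankK.
  by have := h (enum_val i) Logic.I; rewrite /= /f enum_valK.
have ZJ (J : {set I}) (A : I -> set nat) :
    Pr' (\bigcap_(i in [set` J]) (Z i @^-1` A i)) =
    (\prod_(i in J) poisson_prob (lam i) 0%N (A i))%E.
  have := ZE (fun i => if i \in J then A i else setT).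
  rewrite (_ : \bigcap_(i in setT) _ = \bigcap_(i in [set` J]) (Z i @^-1` A i)).
    move=> ->; rewrite (bigID (fun i => i \in J)) /=.
    rewrite [X in (_ * X)%E]big1 ?mule1; last first.
      by move=> i /negbTE ->; rewrite probability_setT.
    by apply: eq_bigr => i ->.
  apply/seteqP; split=> w h i /=; first by move=> iJ; have := h i Logic.I; rewrite iJ.
  by move=> _; case: ifP => // iJ; exact: h.
have Zi i A : Pr' (Z i @^-1` A) = poisson_prob (lam i) 0%N A.
  have := ZJ [set i]%SET (fun=> A); rewrite big_set1 => <-; congr (Pr' _).
  apply/seteqP; split=> w h.
    by move=> j /=; rewrite inE => /eqP ->.
  by apply: (h i); rewrite /= inE.
exists d', T', Pr', Z; split=> // J A mA.
by rewrite ZJ; apply: eq_bigr => i _; rewrite Zi.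
Qed.

End independent_family.

(** * Hits of the point process *)

Lemma card_fset_set_inj (U : finType) (V : choiceType) (f : U -> V) (A : pred U) :
  injective f -> #|` fset_set (f @` [set x | A x])| = #|A|.
Proof.
move=> finj; have fin : finite_set (f @` [set x | A x]).
  by apply: finite_image; exact: finite_finset.
have -> : fset_set (f @` [set x | A x]) = [fset y in [seq f x | x <- enum A]]%fset.
  apply/fsetP => y; rewrite in_fset_set// !inE /=.
  apply/idP/mapP => [/set_mem[x Ax <-]|[x xA ->]].
    by exists x => //; rewrite mem_enum.
  by apply/mem_set; exists x => //; rewrite mem_enum in xA.
by rewrite card_fseq undup_id ?size_map -?cardE// map_inj_uniq ?enum_uniq.
Qed.

Section array.
Context (R : realType) (dO dX : measure_display).
Context (Omega : measurableType dO) (Pr : probability Omega R).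
Context (X : measurableType dX) (np : nat) (K : 'I_np -> set X).
Context (d S : nat) (P : set 'rV[R]_d) (D : 'I_S -> set 'rV[R]_d).
Context (xi : nat -> idx d -> {RV Pr >-> nat}) (nu : nat -> idx d -> {RV Pr >-> X}).
Context (xip : nat -> idx d -> 'I_np -> {RV Pr >-> nat}).
Hypothesis DP : forall s, D s `<=` P.
Hypothesis tD : trivIset setT D.
Hypothesis xi_sum : forall M t w, (0 < M)%N -> Pi P M t ->
  xi M t w = (\sum_(p < np) xip M t p w)%N.
Hypothesis xi_nu : forall M t p w, (0 < M)%N -> Pi P M t -> xi M t w = 1%N ->
  xip M t p w = (nu M t w \in K p).

(** Indicator that the process has a point in [K i.1 `*` D i.2] over the lattice
    point [t]: see [count_hits]. *)
Definition hits (M : nat) (t : idx d) (i : 'I_np * 'I_S) (w : Omega) : bool :=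
  [&& `[< D i.2 (scaled R M t) >], xip M t i.1 w == xi M t w & xi M t w == 1%N].

Lemma hitsE M t i w : D i.2 (scaled R M t) ->
  (hits M t i w)%:R = eta_var R (xi M t) (xip M t i.1) w.
Proof. by move=> Di; rewrite /hits /eta_var asboolT. Qed.

Lemma measurable_hits M t i : measurable_fun setT (fun w => (hits M t i w : nat)).
Proof.
pose g (k : {ffun bool -> nat}) : nat :=
  [&& `[< D i.2 (scaled R M t) >], k true == k false & k false == 1%N].
pose N w (b : bool) := if b then xip M t i.1 w else xi M t w.
have -> : (fun w => (hits M t i w : nat)) = (fun w => g [ffun b => N w b]).
  by apply/funext => w; rewrite /g !ffunE.
by apply: measurable_count_fun => -[]; exact: measurable_funPT.
Qed.

Lemma bdd_hits M t i : bdd_meas (fun w => (hits M t i w)%:R : R).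
Proof.
split; last by exists 1 => w; case: hits; rewrite ?normr1 ?normr0.
exact: (measurableT_comp (f := fun n : nat => n%:R : R) _ (measurable_hits M t i)).
Qed.

(** The pieces [D s] are disjoint, and if [xi M t w = 1] then a single [xip M t p w]
    is nonzero. *)
Lemma hits_excl M t w i i' : (0 < M)%N -> hits M t i w -> hits M t i' w -> i = i'.
Proof.
move=> M0 /and3P[/asboolP Di /eqP e1 /eqP x1] /and3P[/asboolP Di' /eqP e2 _].
have s12 : i.2 = i'.2 by apply: tD => //; exists (scaled R M t).
have p12 : i.1 = i'.1.
  apply: contrapT => /eqP ne.
  have := xi_sum w M0 (DP Di).
  rewrite (bigD1 i.1)//= (bigD1 i'.1)/= ?e1 ?e2 ?x1; last by rewrite eq_sym.
  by rewrite !add1n.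
by case: i i' s12 p12 {Di Di' e1 e2} => [? ?] [? ?] /= -> ->.
Qed.

Lemma any_hitsE M t w : (0 < M)%N ->
  any_hit R hits M t w != 0 -> Pi P M t /\ xi M t w = 1%N.
Proof.
move=> M0; rewrite /any_hit => /negP n0; apply: contrapT => nP; apply: n0.
apply/eqP; apply: big1 => i _; case: (boolP (hits M t i w)) => //.
by move=> /and3P[/asboolP Di _ /eqP x1]; exfalso; apply: nP; split=> //; exact: DP Di.
Qed.

Lemma any_hits01 M t w : (0 < M)%N -> 0 <= any_hit R hits M t w <= 1.
Proof.
by apply: any_hit01; exact: hits_excl.
Qed.

Lemma single_hits (C : R) : (forall M t, (0 < M)%N -> Pi P M t ->
     ('E_Pr[fun w => (xi M t w)%:R] <= (C / M%:R ^+ d)%:E)%E) ->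
  forall M t, (0 < M)%N -> Ex Pr (any_hit R hits M t) <= `|C| / M%:R ^+ d.
Proof.
move=> h1 M t M0.
have bA : bdd_meas (any_hit R hits M t).
  by apply: bdd_meas_sum => i; exact: bdd_hits.
have [Pt|nPt] := pselect (Pi P M t); last first.
  rewrite (_ : any_hit R hits M t = fun=> 0) ?Ex_cst.
    by rewrite divr_ge0// exprn_ge0.
  apply/funext => w; apply/eqP; apply: contrapT => /negP.
  by move=> /(any_hitsE M0)[].
apply: (@le_trans _ _ (C / M%:R ^+ d)); last first.
  by rewrite ler_wpM2r ?ler_norm// invr_ge0 exprn_ge0.
rewrite -lee_fin -Ex_EFin//; apply: le_trans (h1 M t M0 Pt).
have mx : measurable_fun setT (fun w => (xi M t w)%:R : R).
  by apply: (measurableT_comp (f := fun n : nat => n%:R : R)) => //; exact: measurable_funPT.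
rewrite unlock; apply: ge0_le_integral => //.
- by move=> w _; rewrite lee_fin; have /andP[] := any_hits01 t w M0.
- by apply/measurable_EFinP; case: bA.
- exact/measurable_EFinP.
- move=> w _; rewrite lee_fin.
  have [->|/(any_hitsE M0)[_ ->]] := eqVneq (any_hit R hits M t w) 0; first by [].
  by have /andP[] := any_hits01 t w M0.
Qed.

Lemma pair_hits (C : R) : (forall M t t', (0 < M)%N -> Pi P M t -> Pi P M t' ->
     t <> t' ->
     (Pr [set w | (1 <= xi M t w)%N /\ (1 <= xi M t' w)%N]
        <= (C / M%:R ^+ (2 * d))%:E)%E) ->
  forall M t t', (0 < M)%N -> t != t' ->
  Ex Pr (fun w => any_hit R hits M t w * any_hit R hits M t' w) <= `|C| / M%:R ^+ (2 * d).
Proof.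
move=> h3 M t t' M0 tt'.
have bA t0 : bdd_meas (any_hit R hits M t0).
  by apply: bdd_meas_sum => i; exact: bdd_hits.
pose V := [set w | (1 <= xi M t w)%N /\ (1 <= xi M t' w)%N].
have [[Pt Pt']|nPt] := pselect (Pi P M t /\ Pi P M t'); last first.
  rewrite (_ : (fun w => _) = fun=> 0) ?Ex_cst.
    by rewrite divr_ge0// exprn_ge0.
  apply/funext => w; apply/eqP; apply: contrapT => /negP; rewrite mulf_eq0 negb_or.
  by move=> /andP[/(any_hitsE M0)[Pt _] /(any_hitsE M0)[Pt' _]]; apply: nPt.
apply: (@le_trans _ _ (C / M%:R ^+ (2 * d))); last first.
  by rewrite ler_wpM2r ?ler_norm// invr_ge0 exprn_ge0.
have mV : measurable V.
  have mx t0 : measurable [set w | (1 <= xi M t0 w)%N].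
    rewrite (_ : [set w | _] = xi M t0 @^-1` [set k | (1 <= k)%N])//.
    by rewrite -[X in measurable X]setTI; exact: measurable_funPT.
  by rewrite (_ : V = [set w | (1 <= xi M t w)%N] `&` [set w | (1 <= xi M t' w)%N])//;
     exact: measurableI.
have := h3 M t t' M0 Pt Pt' (elimN eqP tt').
rewrite -/V -[X in (X <= _)%E]fineK ?fin_num_measure// lee_fin.
apply: le_trans; rewrite -Ex_indic//; apply: Ex_le; first exact: bdd_measM.
  exact: bdd_meas_indic.
move=> w; rewrite indicE.
have /andP[a0 a1] := any_hits01 t w M0; have /andP[b0 b1] := any_hits01 t' w M0.
have [ab0|] := eqVneq (any_hit R hits M t w * any_hit R hits M t' w) 0.
  by rewrite ab0.
rewrite mulf_eq0 negb_or => /andP[/(any_hitsE M0)[_ x1] /(any_hitsE M0)[_ x1']].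
rewrite mem_set; last by rewrite /V /= x1 x1'.
by rewrite mulr_ile1.
Qed.

(** On [xi M t w = 1] the equality [xip M t p w = xi M t w] means that [nu M t w]
    is in [K p]. *)
Lemma count_hits (B M : nat) p s w : (0 < M)%N ->
  (forall x j, P x -> 0 <= x 0 j <= B%:R) ->
  #|` fset_set (point_process P (fun M t => xi M t : Omega -> nat)
                     (fun M t => nu M t : Omega -> X) M w `&` (K p `*` D s)) |%N =
  (\sum_(f : {ffun 'I_d -> 'I_(B * M).+1}) hits M (lattice_pt f) (p, s) w)%N.
Proof.
move=> M0 PB; have M0' : 0 < M%:R :> R by rewrite ltr0n.
pose U := {ffun 'I_d -> 'I_(B * M).+1}.
pose psi (f : U) : X * 'rV[R]_d := (nu M (lattice_pt f) w, scaled R M (lattice_pt f)).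
have psi_inj : injective psi.
  move=> f g [_ fg]; apply/ffunP => j; apply/val_inj/eqP.
  have /rowP/(_ j) := fg; rewrite !scaledE => /(mulIf _) h.
  by rewrite -(eqr_nat R); apply/eqP/h; rewrite invr_eq0 gt_eqF.
transitivity #|(fun f : U => hits M (lattice_pt f) (p, s) w)|; last first.
  by rewrite -sum1_card big_mkcond /=; apply: eq_bigr => f _; rewrite unfold_in; case: hits.
rewrite -(card_fset_set_inj _ psi_inj); congr (size (fset_set _)).
apply/seteqP; split=> [[x y] [[t [Pt x1] [<- <-]]] [/= Kx Dy]|
  _ [f /and3P[/asboolP/= Ds /eqP e1 /eqP x1] <-]].
  have tB j : (t j <= B * M)%N.
    have /andP[_] := PB _ j Pt; rewrite mxE ler_pdivrMr// -natrM.
    by rewrite ler_nat.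
  pose f : U := [ffun j => inord (t j)].
  have ft : lattice_pt f = t.
    by apply/ffunP => j; rewrite !ffunE inordK// ltnS.
  exists f; last by rewrite /psi ft.
  rewrite /= /hits /= ft asboolT//= x1 (xi_nu p M0 Pt x1).
  by rewrite mem_set.
have Pf : Pi P M (lattice_pt f) by exact: DP Ds.
split; first by exists (lattice_pt f).
split => //=; have := xi_nu p M0 Pf x1; rewrite e1 x1.
by case: (boolP (_ \in _)) => // /set_mem.
Qed.

(** [decoupling] with [kappa] the table of all hits over [V]; it is constant on the
    elements of [F M t'] that meet [E M], because so are the [xip] and hence their
    sum [xi]. *)
Lemma dec_hits (sigma0 : R) (sigma : 'I_d -> R) (F : nat -> idx d -> set (set Omega))
    (R0 c Ch CE : R) (E : nat -> set Omega) (q : 'I_np -> R) :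
  (forall M t, (0 < M)%N -> Pi P M t -> prob_partition Pr (F M t)) ->
  (forall M, (0 < M)%N -> measurable (E M)) ->
  (forall M, (0 < M)%N -> (Pr (~` E M) <= (CE / M%:R ^+ (100 * d))%:E)%E) ->
  (forall p, 0 <= q p <= c) ->
  (forall M t t' p, (0 < M)%N -> Pi P M t -> Pi P M t' ->
     affine_form sigma0 sigma t >= affine_form sigma0 sigma t' + R0 * ln M%:R ->
     exists2 Y, is_condexp Pr (sigma_part (F M t')) (eta_var R (xi M t) (xip M t p)) Y &
       forall w, E M w -> `|Y w - q p / M%:R ^+ d| <= Ch / M%:R ^+ (2 * d)) ->
  (forall M t tbar p w, (0 < M)%N -> Pi P M t -> Pi P M tbar ->
     affine_form sigma0 sigma tbar > affine_form sigma0 sigma t + R0 * ln M%:R -> E M w ->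
     forall w', pblock (F M tbar) id w w' -> xip M t p w' = xip M t p w) ->
  forall u M t t' i (V : seq (idx d)),
  (forall i, 0 <= u i <= 1) -> (0 < M)%N ->
  Pi P M t -> Pi P M t' -> D i.2 (scaled R M t) ->
  linN sigma t >= linN sigma t' + R0 * ln M%:R ->
  (forall r, r \in V -> Pi P M r /\ linN sigma t' > linN sigma r + R0 * ln M%:R) ->
  `|Ex Pr (fun w => \prod_(r <- V) (1 - loss hits u M r w) * (hits M t i w)%:R)
    - q i.1 / M%:R ^+ d * Ex Pr (fun w => \prod_(r <- V) (1 - loss hits u M r w))|
  <= (`|Ch| + (1 + c) * `|CE|) / M%:R ^+ (2 * d).
Proof.
move=> pF mE PE q0c h4 h5 u M t t' i V u01 M0 Pt Pt' Di tt' Vt'.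
have M1 : 1 <= M%:R :> R by rewrite ler1n.
have affE r : affine_form sigma0 sigma r = sigma0 + linN sigma r by [].
have tt'' : affine_form sigma0 sigma t >= affine_form sigma0 sigma t' + R0 * ln M%:R.
  by rewrite !affE; lra.
have [Y cY YE] := h4 M t t' i.1 M0 Pt Pt' tt''.
pose J : finType := {ffun 'I_(size V) * ('I_np * 'I_S) -> bool}.
pose V_ (k : 'I_(size V)) := nth t V k.
pose kappa w : J := [ffun z => hits M (V_ z.1) z.2 w].
(* [1 - loss] is rewritten as a product of powers, which is in [0, 1] also for the
   tables [x] that are not realized by hits. *)
pose phi (x : J) : R := \prod_(k < size V) \prod_i u i ^+ x (k, i).
have ppow r w : \prod_i u i ^+ hits M r i w = 1 - loss hits u M r w.
  by apply: prod_pow_hit => //; exact: hits_excl.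
have phiE w : phi (kappa w) = \prod_(r <- V) (1 - loss hits u M r w).
  rewrite (big_nth t) big_mkord; apply: eq_bigr => k _.
  rewrite -ppow.
  by apply: eq_bigr => j _; rewrite ffunE.
have V_in k : V_ k \in V by rewrite mem_nth.
have bool01 (r : R) (b : bool) : 0 <= r <= 1 -> 0 <= r ^+ b <= 1.
  by case: b; rewrite ?expr1 ?expr0 ?ler01 ?lexx.
have phi01 x : 0 <= phi x <= 1.
  have in01 k : 0 <= \prod_i u i ^+ x (k, i) <= 1.
    rewrite prodr_ge0 ?prodr_ile1// => j _; first exact: bool01.
    by case/andP: (bool01 _ (x (k, j)) (u01 j)).
  by rewrite prodr_ge0 ?prodr_ile1// => j _; case/andP: (in01 j).
have mkappa x : measurable (kappa @^-1` [set x]).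
  have -> : kappa @^-1` [set x] = \bigcap_(z in [set: 'I_(size V) * ('I_np * 'I_S)])
      ((fun w => (hits M (V_ z.1) z.2 w : nat)) @^-1` [set (x z : nat)]).
    apply/seteqP; split=> w /=; first by move=> <- z _ /=; rewrite ffunE.
    move=> h; apply/ffunP => z; rewrite ffunE; have /= := h z Logic.I.
    by case: hits; case: (x z).
  apply: fin_bigcap_measurable => [|z _]; first exact: finite_finset.
  by rewrite -[X in measurable X]setTI; exact: measurable_hits.
have kE w : E M w -> forall w', pblock (F M t') id w w' -> kappa w' = kappa w.
  move=> Ew w' ww'; apply/ffunP => z; rewrite !ffunE /hits.
  have [Pr_ hr] := Vt' _ (V_in z.1).
  have aff : affine_form sigma0 sigma t' > affine_form sigma0 sigma (V_ z.1) + R0 * ln M%:R.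
    by rewrite !affE; lra.
  have same p := h5 M _ t' p w M0 Pr_ Pt' aff Ew w' ww'.
  rewrite !(xi_sum _ M0 Pr_) !same.
  by under eq_bigr do rewrite same.
have fE : (fun w => (hits M t i w)%:R) = eta_var R (xi M t) (xip M t i.1).
  by apply/funext => w; exact: hitsE.
have CM0 : 0 <= `|Ch| / M%:R ^+ (2 * d) by rewrite divr_ge0// exprn_ge0.
have /andP[q0 qc] := q0c i.1.
have qM0 : 0 <= q i.1 / M%:R ^+ d by rewrite divr_ge0// exprn_ge0.
have Ma k : 1 <= M%:R ^+ k :> R by rewrite exprn_ege1.
have Mp k : 0 < M%:R ^+ k :> R by rewrite exprn_gt0// ltr0n.
have qMc : q i.1 / M%:R ^+ d <= c.
  by rewrite ler_pdivrMr// (le_trans qc)// ler_peMr// (le_trans q0).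
have PEM : fine (Pr (~` E M)) <= `|CE| / M%:R ^+ (2 * d).
  rewrite -lee_fin fineK ?fin_num_measure//; last by apply: measurableC; exact: mE.
  apply: le_trans (PE M M0) _; rewrite lee_fin.
  apply: le_trans (ler_norm _) _; rewrite normrM normfV (ger0_norm (ltW (Mp _))).
  rewrite ler_wpM2l// lef_pV2 ?posrE// -!natrX ler_nat.
  by apply: leq_pexp2l => //; rewrite leq_mul2r orbT.
have YE' w : E M w -> `|Y w - q i.1 / M%:R ^+ d| <= `|Ch| / M%:R ^+ (2 * d).
  move=> Ew; apply: le_trans (YE w Ew) _.
  by apply: ler_wpM2r; [rewrite invr_ge0 exprn_ge0|exact: ler_norm].
have bf : bdd_meas (eta_var R (xi M t) (xip M t i.1)) by rewrite -fE; exact: bdd_hits.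
have f01 w : 0 <= eta_var R (xi M t) (xip M t i.1) w <= 1.
  by rewrite /eta_var ler0n lern1 leq_b1.
have H := decoupling (pF M t' M0 Pt') (mE M M0) mkappa phi01 kE bf f01 cY qM0 CM0 YE'.
have E1 : (fun w => \prod_(r <- V) (1 - loss hits u M r w)) = phi \o kappa.
  by apply/funext => w /=; rewrite phiE.
have E2 : (fun w => \prod_(r <- V) (1 - loss hits u M r w) * (hits M t i w)%:R) =
    (fun w => phi (kappa w) * eta_var R (xi M t) (xip M t i.1) w).
  by apply/funext => w; rewrite phiE -fE.
rewrite E1 E2; apply: le_trans H _; rewrite [leRHS]mulrDl lerD2l -mulrA.
apply: ler_pM => //; first by rewrite addr_ge0.
  exact: fine_ge0.
by rewrite lerD2l.
Qed.

End array.

(** * The Poisson limit *)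

Theorem theorem6p1 (R : realType)
  (dO dX : measure_display)
  (Omega : measurableType dO) (Pr : probability Omega R)
  (X : measurableType dX) (m : probability X R)
  (np : nat -> nat) (K : forall k, 'I_(np k) -> set X)
  (d : nat) (P : set 'rV[R]_d) (sigma0 : R) (sigma : 'I_d -> R)
  (xi : nat -> idx d -> {RV Pr >-> nat})
  (nu : nat -> idx d -> {RV Pr >-> X})
  (xip : forall k, nat -> idx d -> 'I_(np k) -> {RV Pr >-> nat})
  (F : nat -> idx d -> set (set Omega))
  (c R0 : R) (E : nat -> set Omega) :
  (forall k, finite_partition (K k)) ->
  cvg_to_point_partition m K ->
  piecewise_smooth_domain P ->
  (* t ranges over N^d, so that P lies in the orthant of t / M *)
  (forall x j, P x -> 0 <= x 0 j) ->
  (exists j, sigma j != 0) ->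
  (forall k M t w, (0 < M)%N -> Pi P M t ->
     xi M t w = (\sum_(p < np k) xip k M t p w)%N) ->
  (forall k M t p w, (0 < M)%N -> Pi P M t -> xi M t w = 1%N ->
     xip k M t p w = (nu M t w \in K k p)) ->
  (forall M t, (0 < M)%N -> Pi P M t -> prob_partition Pr (F M t)) ->
  0 < c -> 0 < R0 ->
  (forall M, (0 < M)%N -> measurable (E M)) ->
  (exists C : R, forall M, (0 < M)%N ->
     (Pr (~` E M) <= (C / M%:R ^+ (100 * d))%:E)%E) ->
  (* h1 *)
  (exists C : R, forall M t, (0 < M)%N -> Pi P M t ->
     ('E_Pr[fun w => (xi M t w)%:R] <= (C / M%:R ^+ d)%:E)%E) ->
  (* h2 *)
  (exists C : R, forall M t, (0 < M)%N -> Pi P M t ->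
     (Pr [set w | (1 < xi M t w)%N] <= (C / M%:R ^+ (2 * d))%:E)%E) ->
  (* h3 *)
  (exists C : R, forall M t t', (0 < M)%N -> Pi P M t -> Pi P M t' ->
     t <> t' ->
     (Pr [set w | (1 <= xi M t w)%N /\ (1 <= xi M t' w)%N]
        <= (C / M%:R ^+ (2 * d))%:E)%E) ->
  (* h4a *)
  (exists C : R, forall M t t', (0 < M)%N -> Pi P M t -> Pi P M t' ->
     affine_form sigma0 sigma t >= affine_form sigma0 sigma t' + R0 * ln M%:R ->
     exists2 Y, is_condexp Pr (sigma_part (F M t'))
                  (fun w => (xi M t w)%:R) Y &
       forall w, E M w ->
         `|Y w - c * fine (m setT) / M%:R ^+ d| <= C / M%:R ^+ (2 * d)) ->
  (* h4b *)
  (forall k, exists C : R, forall M t t' p, (0 < M)%N ->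
     Pi P M t -> Pi P M t' ->
     affine_form sigma0 sigma t >= affine_form sigma0 sigma t' + R0 * ln M%:R ->
     exists2 Y, is_condexp Pr (sigma_part (F M t'))
                  (fun w => (xip k M t p w)%:R) Y &
       forall w, E M w ->
         `|Y w - c * fine (m (K k p)) / M%:R ^+ d| <= C / M%:R ^+ (2 * d)) ->
  (* h4c *)
  (forall k, exists C : R, forall M t t' p, (0 < M)%N ->
     Pi P M t -> Pi P M t' ->
     affine_form sigma0 sigma t >= affine_form sigma0 sigma t' + R0 * ln M%:R ->
     exists2 Y, is_condexp Pr (sigma_part (F M t')) (eta_var R (xi M t) (xip k M t p)) Y &
       forall w, E M w ->
         `|Y w - c * fine (m (K k p)) / M%:R ^+ d| <= C / M%:R ^+ (2 * d)) ->
  (* h5 *)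
  (forall k M t tbar p w, (0 < M)%N -> Pi P M t -> Pi P M tbar ->
     affine_form sigma0 sigma tbar > affine_form sigma0 sigma t + R0 * ln M%:R -> E M w ->
     forall w', pblock (F M tbar) id w w' -> xip k M t p w' = xip k M t p w) ->
  (* h6 *)
  (forall M t tbar w, (0 < M)%N -> Pi P M t -> Pi P M tbar ->
     affine_form sigma0 sigma tbar > affine_form sigma0 sigma t + R0 * ln M%:R -> E M w ->
     pblock (F M tbar) id w `<=` pblock (F M t) id w) ->
  cvg_poisson_process Pr m K P c
    (point_process P (fun M t => xi M t : Omega -> nat)
                     (fun M t => nu M t : Omega -> X)).
Proof.
move=> Kpart _ [oP cP P_ne bP _] P0 [j0 sj0] xi_sum xi_nu pF c0 R0_gt0 mE [CE PE].
move=> [C1 h1] _ [C3 h3] _ _ h4c h5 _ k S D [tD cD vol0 psbD].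
have [Ch h4] := h4c k.
have [B PB] := orthant_box bP P0.
have d0 : (0 < d)%N := leq_ltn_trans (leq0n _) (ltn_ord j0).
have DP s : D s `<=` P by move=> x Dx; rewrite -cD; exists s.
have volD s := lattice_count_cvg d0 (fun x j Dx => PB x j (DP s x Dx)) (psbD s).
pose q p : R := c * fine (m (K k p)).
have mK p : measurable (K k p) by have [] := Kpart k.
have q0c p : 0 <= q p <= c.
  rewrite /q mulr_ge0 ?fine_ge0 ?(ltW c0)//= ler_piMr ?(ltW c0)//.
  by rewrite -lee_fin fineK ?fin_num_measure//; exact: probability_le1.
pose I : finType := ('I_(np k) * 'I_S)%type.
pose hit := @hits R dO Omega Pr (np k) d S D xi (xip k).
have exc := hits_excl DP tD (xi_sum k).
have dec := dec_hits DP tD (xi_sum k) pF mE PE q0c h4 (h5 k).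
have CdE0 : 0 <= `|Ch| + (1 + c) * `|CE|.
  by rewrite addr_ge0// mulr_ge0// addr_ge0// ltW.
pose N M w (i : I) : nat :=
  (\sum_(f : {ffun 'I_d -> 'I_(B * M.+1).+1}) hit M.+1 (lattice_pt f) i w)%N.
pose vol (i : I) : R := fine (leb (D i.2)).
have gf (u : I -> R) : (forall i, 0 <= u i <= 1) ->
    Ex Pr (fun w => \prod_i u i ^+ N M w i) @[M --> \oo] -->
    \prod_i expR (q i.1 * vol i * (u i - 1)).
  move=> u01.
  apply: (@gf_cvg R dO Omega Pr d I P sigma j0 B R0 hit (fun i => D i.2)
    (fun i => q i.1) (`|Ch| + (1 + c) * `|CE|) `|C1| `|C3|) => //.
  - by move=> i; have /andP[] := q0c i.1.
  - by move=> M t i M0; exact: bdd_hits.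
  - by move=> M t i w M0 /and3P[/asboolP].
  - exact: (single_hits DP tD (xi_sum k) h1).
  - exact: (pair_hits DP tD (xi_sum k) h3).
  - by move=> i; have [] := volD i.2.
have mN M (i : I) : measurable_fun setT (fun w => N M w i).
  pose U := {ffun 'I_d -> 'I_(B * M.+1).+1}.
  pose g (x : {ffun U -> nat}) : nat := (\sum_f x f)%N.
  have -> : (fun w => N M w i) =
      (fun w => g [ffun f : U => hit M.+1 (lattice_pt f) i w : nat]).
    by apply/funext => w; rewrite /N /g; apply: eq_bigr => f _; rewrite ffunE.
  by apply: (measurable_count_fun
    (N := fun w (f : U) => hit M.+1 (lattice_pt f) i w : nat)) => f; exact: measurable_hits.
have [d' [T' [Pr' [Z [indZ lawZ]]]]] := independent_poisson (fun i : I => q i.1 * vol i).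
have lam0 (i : I) : 0 <= q i.1 * vol i.
  by rewrite mulr_ge0 ?fine_ge0 ?leb_ge0//; case/andP: (q0c i.1).
exists d', T', Pr', Z; split=> //.
have mZ i : measurable_fun setT (fun w => Z i w) by exact: measurable_funPT.
have pmfZ (a : I -> nat) :
    pmf_at Pr' (fun w i => Z i w) a = \prod_i pois (q i.1 * vol i) (a i).
  have mA : measurable (\bigcap_(i in [set` [set: I]%SET]) (Z i @^-1` [set a i])).
    apply: fin_bigcap_measurable => [|i _]; first exact: finite_finset.
    by rewrite -[X in measurable X]setTI; exact: mZ.
  rewrite /pmf_at (_ : (fun w => _) =
      \1_(\bigcap_(i in [set` [set: I]%SET]) (Z i @^-1` [set a i]))).
    rewrite Ex_indic// (indZ [set: I]%SET (fun i => [set a i]))//.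
    rewrite (eq_bigr (fun i => (pois (q i.1 * vol i) (a i))%:E)); last first.
      by move=> i _; rewrite lawZ pois_prob.
    rewrite prodEFin /=; apply: eq_bigl => i; by rewrite inE.
  apply/funext => w; rewrite (point_indicE R (fun w i => Z i w)) indicE.
  congr (nat_of_bool _)%:R.
  apply/forallP/idP => [h|/set_mem h i].
    by apply/mem_set => i _ /=; exact/eqP.
  by apply/eqP/(h i); rewrite /= inE.
move=> f cf [Cf [_ bf]].
pose g (x : {ffun I -> nat}) : R := f (\matrix_(p, s) (x (p, s))%:R).
have gC x : `|g x| <= `|Cf| + 1.
  by apply: bf => //; rewrite (le_lt_trans (ler_norm Cf))// ltrDl.
have lim := gf_to_bounded mN lam0 gf mZ pmfZ gC.
have bg (dT : measure_display) (T : measurableType dT) (N0 : T -> I -> nat) :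
    (forall i, measurable_fun setT (fun w => N0 w i)) ->
    bdd_meas (fun w => g [ffun i => N0 w i]).
  by move=> mN0; split; [exact: measurable_count_fun|exists (`|Cf| + 1)].
rewrite -cvg_shiftS.
have -> : 'E_Pr'[f \o (fun w => \matrix_(p, s) (Z (p, s) w)%:R)]%E =
    (Ex Pr' (fun w => g [ffun i => Z i w]))%:E.
  rewrite -Ex_EFin; last exact: bg.
  congr ('E_Pr'[_])%E; apply/funext => w; rewrite /g /=; congr f.
  by apply/matrixP => p s; rewrite !mxE ffunE.
have EN M : 'E_Pr[f \o (fun w => \matrix_(p, s) (#|` fset_set
      (point_process P (fun M t => xi M t : Omega -> nat)
                     (fun M t => nu M t : Omega -> X) M.+1 w `&` (K k p `*` D s)) |%N)%:R)]%E =
    (Ex Pr (fun w => g [ffun i => N M w i]))%:E.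
  rewrite -Ex_EFin; last exact: bg.
  congr ('E_Pr[_])%E; apply/funext => w; rewrite /g /=; congr f.
  apply/matrixP => p s; rewrite !mxE ffunE; congr (_%:R).
  exact: (count_hits DP (xi_nu k)).
under eq_fun do rewrite EN.
exact: cvg_comp lim _.
Qed.
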